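(* Let $p:\mathbb{R}\to(1,\infty)$ be a measurable function in the class $LH$, and let $U\in h^{p(\cdot)}(\mathbb{C}_+)$. Then there exists a unique $u\in L^{p(\cdot)}(\mathbb{R})$ such that for every $x\in\mathbb{R}$ and $y>0$, $$U(x+iy)=\int_{-\infty}^{\infty}P_y(x-t)\,u(t)\,dt,\qquad P_y(x)=\frac1\pi\frac{y}{x^2+y^2}.$$ Moreover, $\sup_{y>0}\|U_y\|_{L^{p(\cdot)}(\mathbb{R})}\sim\|u\|_{L^{p(\cdot)}(\mathbb{R})}$, i.e. there are constants $c,C>0$ independent of $U$ with $c\|u\|_{L^{p(\cdot)}(\mathbb{R})}\le\sup_{y>0}\|U_y\|_{L^{p(\cdot)}(\mathbb{R})}\le C\|u\|_{L^{p(\cdot)}(\mathbb{R})}$, where $U_y(x)=U(x+iy)$.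
   Context: $\mathbb{C}_+=\{z\in\mathbb{C}:\operatorname{Im}z>0\}$. A measurable $p:\mathbb{R}\to(1,\infty)$ is in the class $LH$ if (i) there is $C_{\log}>0$ with $|p(x)-p(y)|\le C_{\log}/\log(1/|x-y|)$ for all $x,y\in\mathbb{R}$ with $|x-y|<1/2$, and (ii) there are constants $p_\infty\in\mathbb{R}$, $C_\infty>0$ with $|p(x)-p_\infty|\le C_\infty/\log(e+|x|)$ for all $x\in\mathbb{R}$. $L^{p(\cdot)}(\mathbb{R})$ is the space of measurable $f:\mathbb{R}\to\mathbb{C}$ with $\int_{\mathbb{R}}|f(x)|^{p(x)}dx<\infty$, with norm $\|f\|_{L^{p(\cdot)}(\mathbb{R})}=\inf\{\lambda>0:\int_{\mathbb{R}}|f(x)/\lambda|^{p(x)}dx\le1\}$. The space $h^{p(\cdot)}(\mathbb{C}_+)$ consists of harmonic functions $U$ on $\mathbb{C}_+$ with $\sup_{y>0}\int_{-\infty}^{\infty}|U(x+iy)|^{p(x)}\,dx<\infty$. *)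

(* Defs.v *)
From HB Require Import structures.
From mathcomp Require Import all_boot all_order all_algebra.
From mathcomp Require Import all_classical all_reals all_analysis.
Set Implicit Arguments. Unset Strict Implicit. Unset Printing Implicit Defensive.
Import Order.TTheory GRing.Theory Num.Theory.
Import numFieldNormedType.Exports.
Local Open Scope classical_set_scope.
Local Open Scope ring_scope.

(* Complex numbers z = a + i b are represented by pairs of reals; a
   complex-valued function is given by its real and imaginary parts. *)
Section Defs.
Variable R : realType.

Definition cmod (a b : R) : R := Num.sqrt (a ^+ 2 + b ^+ 2).

Definition modular (p : R -> R) (fr fi : R -> R) : \bar R :=
  (\int[@lebesgue_measure R]_x ((cmod (fr x) (fi x)) `^ (p x))%:E)%E.

Definition in_Lp (p : R -> R) (fr fi : R -> R) : Prop :=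
  [/\ measurable_fun setT fr, measurable_fun setT fi &
      (modular p fr fi < +oo)%E].

(* Luxemburg norm  inf {lambda > 0 : int |f/lambda|^{p(x)} <= 1}
   (taken in the extended reals; inf of the empty set is +oo) *)
Definition lp_norm (p : R -> R) (fr fi : R -> R) : \bar R :=
  ereal_inf [set l%:E | l in
    [set l : R | 0 < l /\ (modular p (fun x => (fr x / l)%R) (fun x => (fi x / l)%R) <= 1)%E]].

Definition LH (p : R -> R) : Prop :=
  (exists Clog : R, 0 < Clog /\ forall x y : R, `|x - y| < 2^-1 ->
       `|p x - p y| <= Clog / ln (`|x - y|)^-1) /\
  (exists pinf Cinf : R, 0 < Cinf /\ forall x : R,
       `|p x - pinf| <= Cinf / ln (expR 1 + `|x|)).

Definition upper_half_plane : set (R * R) := [set z | 0 < z.2].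

Definition e1 : R * R := (1, 0).
Definition e2 : R * R := (0, 1).
Definition dx (f : R * R -> R) : R * R -> R := 'D_e1 f.
Definition dy (f : R * R -> R) : R * R -> R := 'D_e2 f.

Definition harmonic_on (D : set (R * R)) (f : R * R -> R) : Prop :=
  open D /\ forall z, D z ->
  [/\ (derivable f z e1 /\ derivable f z e2),
      [/\ derivable (dx f) z e1, derivable (dx f) z e2,
          derivable (dy f) z e1 & derivable (dy f) z e2],
      [/\ {for z, continuous f}, {for z, continuous (dx f)}
        & {for z, continuous (dy f)}],
      [/\ {for z, continuous (dx (dx f))}, {for z, continuous (dy (dx f))},
          {for z, continuous (dx (dy f))} & {for z, continuous (dy (dy f))}] &
      dx (dx f) z + dy (dy f) z = 0].

Definition in_hp (p : R -> R) (Ur Ui : R * R -> R) : Prop :=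
  [/\ harmonic_on upper_half_plane Ur, harmonic_on upper_half_plane Ui &
      exists M : R, forall y : R, 0 < y ->
        (modular p (fun x => Ur (x, y)) (fun x => Ui (x, y)) <= M%:E)%E].

Definition poisson (y x : R) : R := pi^-1 * (y / (x ^+ 2 + y ^+ 2)).

Definition poisson_rep (Ur Ui : R * R -> R) (ur ui : R -> R) : Prop :=
  forall x y : R, 0 < y ->
    (\int[@lebesgue_measure R]_t (poisson y (x - t) * ur t)%:E = (Ur (x, y))%:E)%E /\
    (\int[@lebesgue_measure R]_t (poisson y (x - t) * ui t)%:E = (Ui (x, y))%:E)%E.

Definition sup_norm_hp (p : R -> R) (Ur Ui : R * R -> R) : \bar R :=
  ereal_sup [set lp_norm p (fun x => Ur (x, y)) (fun x => Ui (x, y)) | y in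
             [set y : R | 0 < y]].

End Defs.

(* Main.v *)
(** Existence. Comparison with a logarithmic barrier, using the four-point
    Laplacian in place of second derivatives, shows that a bounded harmonic
    function on [Im z >= s] is the Poisson extension of its trace on [Im z = s].
    The modular bound controls the horizontal averages of [U], which makes [U]
    bounded on each such half-plane. As [p > 1], the weighted traces
    [P_1(t) U(t + is)] are equi-integrable, so their limit along an ultrafilter
    as [s] tends to [0] is an absolutely continuous charge, and its
    Radon-Nikodym density divided by [P_1] is [u]. Uniqueness and the lower norm
    bound follow from the a.e. convergence of Poisson extensions at Lebesgue
    points, together with Fatou's lemma. For the upper bound, the splitting
    [a <= K + K^(1-q) a^q] replaces Jensen's inequality: for
    [m = P_y * |f|^p(.)] one takes [K = m^(1/p(x))], and since [m <= 1/y] the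
    log-Hoelder condition makes [K^(p(x)-p(t))] bounded for
    [|x - t| <= sqrt y / 2]; the part [|f| <= 1] is compared with the constant
    exponent [p_oo]. *)
Require Import Defs.
From HB Require Import structures.
From mathcomp Require Import all_boot all_order all_algebra.
From mathcomp Require Import all_classical all_reals all_analysis.
From mathcomp Require Import measurable_realfun ring lra.
Set Implicit Arguments. Unset Strict Implicit. Unset Printing Implicit Defensive.
Import Order.TTheory GRing.Theory Num.Theory.
Import numFieldNormedType.Exports.
Local Open Scope classical_set_scope.
Local Open Scope ring_scope.

Section RealIntegrals.
Context d (T : measurableType d) (R : realType) (mu : {measure set T -> \bar R}).
Variables (D : set T) (mD : measurable D).
Implicit Types f g : T -> R.

Lemma integrable_addr f g : mu.-integrable D (EFin \o f) -> mu.-integrable D (EFin \o g) ->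
  mu.-integrable D (EFin \o (fun x => f x + g x)).
Proof. by move=> fi gi; apply: eq_integrable (integrableD mD fi gi). Qed.

Lemma integrable_subr f g : mu.-integrable D (EFin \o f) -> mu.-integrable D (EFin \o g) ->
  mu.-integrable D (EFin \o (fun x => f x - g x)).
Proof. by move=> fi gi; apply: eq_integrable (integrableB mD fi gi). Qed.

Lemma integrable_mulrl c f : mu.-integrable D (EFin \o f) ->
  mu.-integrable D (EFin \o (fun x => c * f x)).
Proof. by move=> fi; apply: eq_integrable (integrableZl mD c fi). Qed.

Lemma integrable_normr f : mu.-integrable D (EFin \o f) ->
  mu.-integrable D (EFin \o (fun x => `|f x|)).
Proof. by move=> fi; apply: eq_integrable (integrable_abse fi). Qed.

Lemma integrable_dominated f g : measurable_fun D f -> mu.-integrable D (EFin \o g) ->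
  (forall x, D x -> `|f x| <= g x) -> mu.-integrable D (EFin \o f).
Proof.
move=> mf gi fg; apply: le_integrable gi => //; first exact/measurable_EFinP.
by move=> x Dx; rewrite /= lee_fin (le_trans (fg x Dx)) ?ler_norm.
Qed.

Lemma ler_normr_Rintegral f g : measurable_fun D f -> mu.-integrable D (EFin \o g) ->
  (forall x, D x -> `|f x| <= g x) -> `|\int[mu]_(x in D) f x| <= \int[mu]_(x in D) g x.
Proof.
move=> mf gi fg; have fi := integrable_dominated mf gi fg.
apply: le_trans (le_normr_Rintegral mD fi) _.
by apply: le_Rintegral => //; exact: integrable_normr.
Qed.

Lemma EFin_Rintegral f : mu.-integrable D (EFin \o f) ->
  (\int[mu]_(x in D) f x)%:E = (\int[mu]_(x in D) (f x)%:E)%E.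
Proof. by move=> fi; rewrite /Rintegral fineK//; exact: integrable_fin_num. Qed.

Lemma ge0_integrable_lty f : measurable_fun D f -> (forall x, 0 <= f x) ->
  (\int[mu]_(x in D) (f x)%:E < +oo)%E -> mu.-integrable D (EFin \o f).
Proof.
move=> mf f0 foo; apply/integrableP; split; first exact/measurable_EFinP.
by under eq_integral do rewrite /= ger0_norm//.
Qed.

End RealIntegrals.

Section RealIntegralSubset.
Context d (T : measurableType d) (R : realType) (mu : {measure set T -> \bar R}).
Implicit Types (A B : set T) (f : T -> R).

Lemma integrable_restr A f : measurable A -> mu.-integrable setT (EFin \o f) ->
  mu.-integrable A (EFin \o f).
Proof. by move=> mA; exact: integrableS. Qed.

Lemma le_Rintegral_subset A B f : measurable A -> measurable B -> A `<=` B ->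
  mu.-integrable B (EFin \o f) -> (forall x, 0 <= f x) ->
  \int[mu]_(x in A) f x <= \int[mu]_(x in B) f x.
Proof.
move=> mA mB AB fi f0; rewrite -lee_fin !EFin_Rintegral//; last exact: integrableS fi.
apply: ge0_subset_integral => //; first exact: measurable_int fi.
by move=> x _; rewrite lee_fin.
Qed.

Lemma Rintegral_indicM A f : \int[mu]_x (\1_A x * f x) = \int[mu]_(x in A) f x.
Proof.
rewrite [RHS]Rintegral_mkcond; apply: eq_Rintegral => x _.
by rewrite patchE indicE; case: (_ \in _); rewrite ?mul1r ?mul0r.
Qed.

Lemma integrable_indicM A f : measurable A -> mu.-integrable A (EFin \o f) ->
  mu.-integrable setT (EFin \o (fun x => \1_A x * f x)).
Proof.
move=> mA /(integrable_mkcond _ mA).1; apply: eq_integrable => // x _ /=.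
by rewrite patchE indicE; case: (_ \in _); rewrite ?mul1r ?mul0r.
Qed.

Lemma measurable_fun_integrable f : mu.-integrable setT (EFin \o f) -> measurable_fun setT f.
Proof. by move=> fi; apply/measurable_EFinP; exact: measurable_int fi. Qed.

End RealIntegralSubset.

(** * The Poisson kernel *)

Section AffineSubstitution.
Context {R : realType}.
Local Notation mu := (@lebesgue_measure R).

Lemma integral_affine (G : R -> R) (a b : R) : 0 < a -> continuous G -> (forall t, 0 <= G t) ->
  (\int[mu]_t (G (a * t + b) * a)%:E = \int[mu]_t (G t)%:E)%E.
Proof.
move=> a0 cG G0; pose F t := a * t + b.
have dF (t : R) : is_derive t 1 F a.
  by apply: is_derive_eq; rewrite addr0 /GRing.scale/= mulr1.
have F'E : derive1 F = cst a by apply/funext => t; rewrite derive1E derive_val.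
rewrite (@increasing_ge0_integration_by_substitutionT _ F G)// ?F'E//.
- by move=> s t st; rewrite /F ltrD2r ltr_pM2l.
- exact: cst_continuous.
- exact: is_cvg_cst.
- exact: is_cvg_cst.
- apply/cvgrNyPle => A; exists ((A - b) / a); split; first exact: num_real.
  by move=> t; rewrite ltr_pdivlMr// mulrC => /ltW tA; rewrite /F -lerBrDr.
- apply/cvgryPge => A; exists ((A - b) / a); split; first exact: num_real.
  by move=> t; rewrite ltr_pdivrMr// mulrC => /ltW tA; rewrite /F -lerBlDr.
Qed.

Lemma integral_oneDsqrV : (\int[mu]_t ((oneDsqr t)^-1)%:E = (pi : R)%:E)%E.
Proof.
have V0 (t : R) : 0 <= (oneDsqr t)^-1 by rewrite invr_ge0 (le_trans ler01)// oneDsqr_ge1.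
have VN : (fun t : R => (oneDsqr t)^-1) =1 (fun t => (oneDsqr t)^-1) \o -%R.
  by move=> t /=; rewrite /oneDsqr sqrrN.
rewrite (ge0_symfun_integralT V0 (@continuous_oneDsqrV R) VN) -set_itvcy.
by rewrite integral0y_oneDsqr -EFinM; congr EFin; field.
Qed.

End AffineSubstitution.

Section PoissonKernel.
Context {R : realType}.
Local Notation mu := (@lebesgue_measure R).
Implicit Types x y t s d : R.

Lemma invpi_gt0 : 0 < pi^-1 :> R.
Proof. by rewrite invr_gt0 pi_gt0. Qed.

Lemma invpi_le1 : pi^-1 <= 1 :> R.
Proof. by rewrite invf_le1 ?pi_gt0// (le_trans _ (pi_ge2 R))// ler1n. Qed.

Lemma sqrD_gt0 x y : 0 < y -> 0 < x ^+ 2 + y ^+ 2.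
Proof. by move=> y0; rewrite ltr_wpDl ?sqr_ge0// exprn_gt0. Qed.

Lemma poisson_gt0 y x : 0 < y -> 0 < poisson y x.
Proof. by move=> y0; rewrite mulr_gt0 ?invpi_gt0// divr_gt0// sqrD_gt0. Qed.

Lemma poisson_ge0 y x : 0 < y -> 0 <= poisson y x.
Proof. by move=> /poisson_gt0/ltW. Qed.

Lemma normr_poissonM y x a : 0 < y -> `|poisson y x * a| = poisson y x * `|a|.
Proof. by move=> y0; rewrite normrM ger0_norm ?poisson_ge0. Qed.

Lemma poissonN y x : poisson y (- x) = poisson y x.
Proof. by rewrite /poisson sqrrN. Qed.

Lemma poissonBC y x t : poisson y (x - t) = poisson y (t - x).
Proof. by rewrite -poissonN opprB. Qed.

Lemma poisson1E t : poisson 1 t = pi^-1 * (oneDsqr t)^-1.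
Proof. by rewrite /poisson /oneDsqr expr1n mul1r addrC. Qed.

Lemma poisson_affine y x t : 0 < y -> poisson y (x - t) = poisson 1 (y^-1 * t - x / y) * y^-1.
Proof.
move=> y0; rewrite poissonBC (mulrC y^-1) -mulrBl /poisson -mulrA; congr (_ * _).
have -> : ((t - x) / y) ^+ 2 + 1 ^+ 2 = ((t - x) ^+ 2 + y ^+ 2) / y ^+ 2.
  by field; rewrite gt_eqF.
by field; rewrite !gt_eqF ?sqrD_gt0.
Qed.

Lemma continuous_poisson y : 0 < y -> continuous (poisson y).
Proof.
move=> y0 x; apply: cvgM; first exact: cvg_cst.
apply: cvgM; first exact: cvg_cst.
apply: cvgV; first by rewrite gt_eqF// sqrD_gt0.
by apply: cvgD; [exact: exprn_continuous|exact: cvg_cst].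
Qed.

Lemma measurable_poissonB y x : 0 < y -> measurable_fun setT (fun t => poisson y (x - t)).
Proof.
move=> y0; apply: (measurableT_comp (f := poisson y)); last exact: measurable_funB.
by apply: continuous_measurable_fun; exact: continuous_poisson.
Qed.

Lemma integral_poissonB y x : 0 < y -> (\int[mu]_t (poisson y (x - t))%:E = 1%:E)%E.
Proof.
move=> y0; under eq_integral do rewrite (poisson_affine _ _ y0).
rewrite (integral_affine (- (x / y))) ?invr_gt0//; last 2 first.
- exact: continuous_poisson.
- by move=> t; exact: poisson_ge0.
under eq_integral do rewrite poisson1E EFinM.
rewrite ge0_integralZl ?lee_fin ?(ltW invpi_gt0)//; last first.
  by apply/measurable_EFinP; apply: continuous_measurable_fun; exact: continuous_oneDsqrV.
by rewrite integral_oneDsqrV -EFinM mulVf// gt_eqF// pi_gt0.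
Qed.

Lemma integrable_poissonB y x : 0 < y -> mu.-integrable setT (EFin \o (fun t => poisson y (x - t))).
Proof.
move=> y0; apply: ge0_integrable_lty; first exact: measurable_poissonB.
  by move=> t; exact: poisson_ge0.
by rewrite integral_poissonB// ltry.
Qed.

Lemma Rintegral_poissonB y x : 0 < y -> \int[mu]_t poisson y (x - t) = 1.
Proof. by move=> y0; rewrite /Rintegral integral_poissonB. Qed.

Lemma poisson_le y s : 0 < y -> poisson y s <= y^-1.
Proof.
move=> y0; rewrite -[leRHS]mul1r; apply: ler_pM; rewrite ?invpi_le1 ?(ltW invpi_gt0)//.
  by rewrite divr_ge0 ?(ltW y0) ?(ltW (sqrD_gt0 _ _)).
rewrite ler_pdivrMr ?sqrD_gt0// mulrC ler_pdivlMr// -expr2.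
by rewrite lerDr sqr_ge0.
Qed.

Lemma poisson_le_sqr y s : 0 < y -> s != 0 -> poisson y s <= y / s ^+ 2.
Proof.
move=> y0 s0; have s20 : 0 < s ^+ 2 by rewrite exprn_even_gt0.
rewrite -[leRHS]mul1r; apply: ler_pM; rewrite ?invpi_le1 ?(ltW invpi_gt0)//.
  by rewrite divr_ge0 ?(ltW y0) ?(ltW (sqrD_gt0 _ _)).
by rewrite ler_pM2l// lef_pV2 ?posrE ?sqrD_gt0// lerDl sqr_ge0.
Qed.

Lemma poisson_tail y d s : 0 < y -> 0 < d -> d <= `|s| ->
  poisson y s <= 2 * y / d * poisson d s.
Proof.
move=> y0 d0 ds; rewrite /poisson [leRHS]mulrCA ler_pM2l ?invpi_gt0//.
have ds2 : d ^+ 2 <= s ^+ 2 by rewrite -(real_normK (num_real s)) lerXn2r// nnegrE ltW.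
have -> : 2 * y / d * (d / (s ^+ 2 + d ^+ 2)) = 2 * y / (s ^+ 2 + d ^+ 2).
  by field; rewrite !gt_eqF ?sqrD_gt0.
rewrite ler_pdivrMr ?sqrD_gt0// mulrAC ler_pdivlMr ?sqrD_gt0//.
rewrite -mulrA mulrCA ler_pM2l//; nra.
Qed.

Lemma poisson_le_poisson1 x y : 0 < y ->
  exists2 C : R, 0 <= C & forall t, poisson y (x - t) <= C * poisson 1 t.
Proof.
move=> y0; pose C := y * (2 + (1 + 2 * x ^+ 2) / y ^+ 2).
have x20 := sqr_ge0 x; have y20 : 0 < y ^+ 2 by rewrite exprn_gt0.
exists C => [|t]; first by rewrite mulr_ge0 ?addr_ge0 ?divr_ge0//; lra.
have N0 := sqrD_gt0 (x - t) y0; have t0 : 0 < t ^+ 2 + 1 ^+ 2 := sqrD_gt0 t ltr01.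
rewrite /poisson [leRHS]mulrCA ler_pM2l ?invpi_gt0// mul1r ler_pdivlMr// mulrAC ler_pdivrMr//.
rewrite /C -!mulrA ler_pM2l// expr1n.
have -> : (2 + (1 + 2 * x ^+ 2) / y ^+ 2) * ((x - t) ^+ 2 + y ^+ 2) =
    2 * (x - t) ^+ 2 + 2 * y ^+ 2 + (1 + 2 * x ^+ 2) * ((x - t) ^+ 2 / y ^+ 2) + (1 + 2 * x ^+ 2).
  by field; rewrite gt_eqF.
have : 0 <= (1 + 2 * x ^+ 2) * ((x - t) ^+ 2 / y ^+ 2).
  by rewrite mulr_ge0 ?divr_ge0 ?sqr_ge0 ?(ltW y20)//; lra.
have := sqr_ge0 (2 * x - t); nra.
Qed.

Lemma poisson_sub_numerator (y y' s s' : R) :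
  y' * (s ^+ 2 + y ^+ 2) - y * (s' ^+ 2 + y' ^+ 2) =
  (y' - y) * (s' ^+ 2 + y' ^+ 2) - y' * ((s' - s) * (s' + s) + (y' - y) * (y' + y)).
Proof. by ring. Qed.

Lemma poisson_ratio y y' s s' : 0 < y -> `|s' - s| <= y / 2 -> `|y' - y| <= y / 2 ->
  `|poisson y' s' - poisson y s| <= 4 / y * (`|s' - s| + `|y' - y|) * poisson y s.
Proof.
move=> y0 sy yy; have /andP[yy1 yy2] : - (y / 2) <= y' - y <= y / 2 by rewrite -ler_norml.
have y'0 : 0 < y' by lra.
have N0 := sqrD_gt0 s y0; have N'0 := sqrD_gt0 s' y'0.
rewrite /poisson -mulrBr [leRHS]mulrCA normrM (gtr0_norm invpi_gt0) ler_pM2l ?invpi_gt0//.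
set N := s ^+ 2 + y ^+ 2 in N0 *; set N' := s' ^+ 2 + y' ^+ 2 in N'0 *.
have -> : y' / N' - y / N = (y' * N - y * N') / (N' * N) by field; rewrite !gt_eqF.
rewrite normrM (gtr0_norm (_ : 0 < (N' * N)^-1)) ?invr_gt0 ?mulr_gt0//.
rewrite ler_pdivrMr ?mulr_gt0//.
set a := `|s' - s|; set b := `|y' - y|.
have a0 : 0 <= a by exact: normr_ge0.
have b0 : 0 <= b by exact: normr_ge0.
have -> : 4 / y * (a + b) * (y / N) * (N' * N) = 4 * (a + b) * N' by field; rewrite !gt_eqF.
have s's : `|s' + s| <= 2 * `|s'| + y'.
  have -> : s' + s = 2 * s' - (s' - s) by ring.
  by rewrite (le_trans (ler_normB _ _))// normrM ger0_norm// lerD2l (le_trans sy)//; lra.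
have y'y : `|y' + y| <= 3 * y' by rewrite ger0_norm; lra.
have num_le : `|y' * N - y * N'| <= b * N' + y' * (a * (2 * `|s'| + y') + b * (3 * y')).
  rewrite poisson_sub_numerator (le_trans (ler_normB _ _))// !normrM -/b.
  rewrite (gtr0_norm N'0) (gtr0_norm y'0) lerD2l ler_pM2l//.
  by rewrite (le_trans (ler_normD _ _))// !normrM lerD// ler_wpM2l.
apply: le_trans num_le _.
have x_part : y' * (2 * `|s'| + y') <= 2 * N'.
  rewrite /N' -(real_normK (num_real s')).
  by have := sqr_ge0 (`|s'| - y'); have := sqr_ge0 `|s'|; lra.
have y_part : y' * (3 * y') <= 3 * N' by rewrite /N'; have := sqr_ge0 s'; lra.
have := ler_wpM2l a0 x_part; have := ler_wpM2l b0 y_part; have := mulr_ge0 a0 (ltW N'0); lra.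
Qed.

End PoissonKernel.

(** * The four-point Laplacian *)

Section FourPointLaplacian.
Context {R : realType}.
Implicit Types (x y r e B c : R) (z : R * R) (V W : R * R -> R).

Definition lap4 V z r :=
  V (z.1 + r, z.2) + V (z.1 - r, z.2) + V (z.1, z.2 + r) + V (z.1, z.2 - r) - 4 * V z.

Definition null_lap4 V z := forall e, 0 < e -> \forall r \near 0^'+, `|lap4 V z r| <= e * r ^+ 2.

Lemma null_lap4B V W z : null_lap4 V z -> null_lap4 W z -> null_lap4 (fun z => V z - W z) z.
Proof.
move=> nV nW e e0; have e20 : 0 < e / 2 by rewrite divr_gt0.
apply: filterS2 (nV _ e20) (nW _ e20) => r Vr Wr.
have -> : lap4 (fun z => V z - W z) z r = lap4 V z r - lap4 W z r by rewrite /lap4; ring.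
by rewrite (le_trans (ler_normB _ _))// (le_trans (lerD Vr Wr))// -mulrDl -splitr.
Qed.

Lemma null_lap4N V z : null_lap4 V z -> null_lap4 (fun z => - V z) z.
Proof.
move=> nV e e0; apply: filterS (nV e e0) => r.
by have -> : lap4 (fun z => - V z) z r = - lap4 V z r; [rewrite /lap4; ring|rewrite normrN].
Qed.

Lemma lap4_quartic_null V z c a : 0 < a -> 0 <= c ->
  (forall r, 0 < r <= a -> `|lap4 V z r| <= c * r ^+ 4) -> null_lap4 V z.
Proof.
move=> a0 c0 Vc e e0; have c10 : 0 < c + 1 by lra.
near=> r.
have r0 : 0 < r by [].
have ra : r <= a by near: r; exact: nbhs_right_le.
have r1 : r <= 1 by near: r; exact: nbhs_right_le.
have re : r <= e / (c + 1) by near: r; apply: nbhs_right_le; rewrite divr_gt0.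
rewrite (le_trans (Vc r _)) ?r0// (_ : r ^+ 4 = r ^+ 2 * r ^+ 2); last by ring.
rewrite mulrA ler_wpM2r ?sqr_ge0//.
have rr : r ^+ 2 <= r by rewrite expr2 ler_piMr// ltW.
by have := ler_wpM2l c0 rr; rewrite ler_pdivlMr// in re; lra.
Unshelve. all: by end_near. Qed.

Lemma continuous_pair (T : topologicalType) (f g : T -> R) t : {for t, continuous f} ->
  {for t, continuous g} -> {for t, continuous (fun t => (f t, g t))}.
Proof. by move=> cf cg; exact: (cvg_pair cf cg). Qed.

Lemma near_prod_dist z e : 0 < e -> \forall z' \near z, `|z'.1 - z.1| < e /\ `|z'.2 - z.2| < e.
Proof.
move=> e0; apply/nbhs_ballP; exists e => // -[x y] [/= xe ye].
by rewrite distrC (distrC y).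
Qed.

Lemma near_segment (I : Type) (F : set_system I) {FF : Filter F} (P : I -> R -> Prop) (a b : R) :
  (forall x, a <= x <= b -> \forall x' \near x & i \near F, P i x') ->
  \forall i \near F, forall x, a <= x <= b -> P i x.
Proof.
move=> HP; have /compact_near_coveringP/(_ I F P FF) cov : compact `[a, b].
  exact: segment_compact.
apply: filterS (cov _) => [i iP x xab|x]; first by apply: iP; rewrite /= in_itv.
by rewrite /= in_itv/=; exact: HP.
Qed.

Lemma near_cross z (P : set (R * R)) : (\forall z' \near z, P z') ->
  \forall r \near 0^'+, [/\ P (z.1 + r, z.2), P (z.1 - r, z.2), P (z.1, z.2 + r)
                          & P (z.1, z.2 - r)].
Proof.
move=> /nbhs_ballP[e /= e0 eP]; near=> r.
have r0 : 0 < r by [].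
have re : r < e by near: r; exact: nbhs_right_lt.
by split; apply: eP; split; rewrite /ball/= ?subrr ?normr0// ?opprD ?opprK ?addNKr
  ?normrN gtr0_norm.
Unshelve. all: by end_near. Qed.

Lemma lap4_local_max_le0 V z : (\forall z' \near z, V z' <= V z) ->
  \forall r \near 0^'+, lap4 V z r <= 0.
Proof. by move=> /near_cross; apply: filterS => r []; rewrite /lap4; lra. Qed.

(* With [z = x + i y], this is [|z^4 - r^4|^2]. *)
Definition cross_prod x y r :=
  ((x + r) ^+ 2 + y ^+ 2) * ((x - r) ^+ 2 + y ^+ 2) *
  (x ^+ 2 + (y + r) ^+ 2) * (x ^+ 2 + (y - r) ^+ 2).

Lemma cross_prodE x y r : cross_prod x y r =
  (x ^+ 2 + y ^+ 2) ^+ 4 - 2 * r ^+ 4 * (x ^+ 4 - 6 * x ^+ 2 * y ^+ 2 + y ^+ 4) +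
  r ^+ 4 * r ^+ 4.
Proof. by rewrite /cross_prod; ring. Qed.

Lemma normr_re_quartic_le x y :
  `|x ^+ 4 - 6 * x ^+ 2 * y ^+ 2 + y ^+ 4| <= (x ^+ 2 + y ^+ 2) ^+ 2.
Proof.
have -> : x ^+ 4 - 6 * x ^+ 2 * y ^+ 2 + y ^+ 4 =
    2 * (x ^+ 2 - y ^+ 2) ^+ 2 - (x ^+ 2 + y ^+ 2) ^+ 2 by ring.
rewrite ler_norml; apply/andP; split; first by have := sqr_ge0 (x ^+ 2 - y ^+ 2); lra.
have -> : (x ^+ 2 - y ^+ 2) ^+ 2 = (x ^+ 2 + y ^+ 2) ^+ 2 - 4 * (x * y) ^+ 2 by ring.
by have := sqr_ge0 (x * y); lra.
Qed.

Lemma cross_prod_ge x y r : 0 <= r <= y / 2 -> (x ^+ 2 + y ^+ 2) ^+ 4 / 4 <= cross_prod x y r.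
Proof.
move=> /andP[r0 ry]; rewrite cross_prodE.
have := normr_re_quartic_le x y; rewrite ler_norml => /andP[_].
move: (_ - _ * _ * _ + _) => Q Qle.
have r4 : r ^+ 4 <= (x ^+ 2 + y ^+ 2) ^+ 2 / 16.
  have r2 : r ^+ 2 <= (x ^+ 2 + y ^+ 2) / 4.
    have : r ^+ 2 <= (y / 2) ^+ 2 by rewrite lerXn2r ?nnegrE//; lra.
    by have := sqr_ge0 x; lra.
  have -> : (x ^+ 2 + y ^+ 2) ^+ 2 / 16 = ((x ^+ 2 + y ^+ 2) / 4) ^+ 2 by field.
  by rewrite (exprM r 2 2) lerXn2r ?nnegrE ?sqr_ge0// divr_ge0 ?addr_ge0 ?sqr_ge0.
have -> : (x ^+ 2 + y ^+ 2) ^+ 4 = (x ^+ 2 + y ^+ 2) ^+ 2 * (x ^+ 2 + y ^+ 2) ^+ 2 by ring.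
move: ((x ^+ 2 + y ^+ 2) ^+ 2) (sqr_ge0 (x ^+ 2 + y ^+ 2)) => N N0 in Qle r4 *.
have r40 : 0 <= r ^+ 4 by rewrite exprn_ge0.
have := ler_wpM2l r40 Qle; have := ler_wpM2l N0 r4; have := mulr_ge0 r40 r40.
by have := mulr_ge0 N0 N0; lra.
Qed.

Lemma cross_prod_le x y r : 1 <= x ^+ 2 + y ^+ 2 -> 0 <= r <= 1 ->
  cross_prod x y r <= (x ^+ 2 + y ^+ 2) ^+ 4 * (1 + 4 * r ^+ 4).
Proof.
move=> N1 /andP[r0 r1]; rewrite cross_prodE.
have := normr_re_quartic_le x y; rewrite ler_norml => /andP[+ _].
move: (_ - _ * _ * _ + _) (x ^+ 2 + y ^+ 2) N1 => Q N N1 Qge.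
have r40 : 0 <= r ^+ 4 by rewrite exprn_ge0.
have r41 : r ^+ 4 <= 1 by rewrite exprn_ile1.
have N21 : 1 <= N ^+ 2 by rewrite exprn_ege1.
have N41 : 1 <= N ^+ 4 by rewrite exprn_ege1.
have N24 : N ^+ 2 <= N ^+ 4 by rewrite (exprM N 2 2) expr2 ler_peMr// (le_trans ler01).
have := ler_wpM2l r40 Qge; have := ler_wpM2l r40 N24; have := ler_wpM2l r40 r41.
have := ler_wpM2l r40 N41; lra.
Qed.

Lemma cross_prod_gt0 x y r : 0 < y - r -> 0 < r -> 0 < cross_prod x y r.
Proof. by move=> yr r0; rewrite /cross_prod !mulr_gt0 ?sqrD_gt0//; lra. Qed.

(* The Poisson kernel is [- Im (1 / z) / pi], whose four-point Laplacian is
   [- Im (4 r^4 / (z (z^4 - r^4))) / pi]. *)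
Lemma lap4_poissonE x y r : 0 < r -> 0 < y - r ->
  lap4 (fun z => poisson z.2 z.1) (x, y) r =
  4 * r ^+ 4 * (5 * x ^+ 4 - 10 * (x ^+ 2 * y ^+ 2) + y ^+ 4 - r ^+ 4) /
    cross_prod x y r * poisson y x.
Proof.
move=> r0 yr; have pi0 := pi_gt0 R.
rewrite /lap4 /poisson /cross_prod /=; move: (pi : R) pi0 => q q0.
by field; rewrite !gt_eqF ?sqrD_gt0//; lra.
Qed.

Lemma lap4_poisson y : 0 < y -> exists2 C : R, 0 <= C & forall x r, 0 < r <= y / 2 ->
  `|lap4 (fun z => poisson z.2 z.1) (x, y) r| <= C * r ^+ 4 * poisson y x.
Proof.
move=> y0; have y40 : 0 < y ^+ 4 by rewrite exprn_gt0.
exists (176 / y ^+ 4) => [|x r /andP[r0 ry]]; first by rewrite divr_ge0// ltW.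
have yr : 0 < y - r by lra.
have D0 : 0 < cross_prod x y r by exact: cross_prod_gt0.
have Dge : (x ^+ 2 + y ^+ 2) ^+ 4 / 4 <= cross_prod x y r by rewrite cross_prod_ge ?ry ?ltW.
rewrite lap4_poissonE// normrM (gtr0_norm (poisson_gt0 x y0)).
rewrite ler_wpM2r ?poisson_ge0// normrM normfV (gtr0_norm D0) ler_pdivrMr//.
rewrite normrM (ger0_norm (_ : 0 <= 4 * r ^+ 4)) ?mulr_ge0 ?exprn_ge0 ?(ltW r0)//.
rewrite (mulrAC 4) [leRHS]mulrAC ler_pM2r ?exprn_gt0//.
have x20 := sqr_ge0 x; have y20 := sqr_ge0 y.
have r4y : r ^+ 4 <= y ^+ 4 by rewrite lerXn2r ?nnegrE//; lra.
have r40 : 0 <= r ^+ 4 by rewrite exprn_ge0// ltW.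
have Qle : `|5 * x ^+ 4 - 10 * (x ^+ 2 * y ^+ 2) + y ^+ 4 - r ^+ 4| <=
    11 * (x ^+ 2 + y ^+ 2) ^+ 2.
  rewrite sqrrD -!exprM -mulr_natr ler_norml.
  have := mulr_ge0 x20 y20; have : 0 <= x ^+ 4 by rewrite (exprM x 2 2) sqr_ge0.
  by move=> *; apply/andP; split; lra.
have N2y : y ^+ 4 * (x ^+ 2 + y ^+ 2) ^+ 2 <= (x ^+ 2 + y ^+ 2) ^+ 4.
  rewrite (exprM y 2 2) (exprM _ 2 2) [leRHS]expr2 ler_wpM2r ?sqr_ge0//.
  by rewrite lerXn2r ?nnegrE ?addr_ge0// lerDr.
by rewrite [leRHS]mulrAC ler_pdivlMr//; have := ler_wpM2r (ltW y40) Qle; lra.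
Qed.

Definition log_barrier z := ln (z.1 ^+ 2 + (1 + z.2) ^+ 2) + ln (1 + z.2).

Lemma log_barrier_ge0 z : 0 <= z.2 -> 0 <= log_barrier z.
Proof.
move=> z0; rewrite addr_ge0// ln_ge0 ?lerDl//.
by rewrite ler_wpDl ?sqr_ge0// exprn_ege1// lerDl.
Qed.

Lemma log_barrier_coercive B : exists L : R, forall z, 0 <= z.2 -> log_barrier z < B ->
  `|z.1| <= L /\ z.2 <= L.
Proof.
exists (1 + expR B) => -[x y] /= y0 zB.
have N0 : 0 < x ^+ 2 + (1 + y) ^+ 2 by apply: sqrD_gt0; lra.
have : x ^+ 2 + (1 + y) ^+ 2 <= expR B.
  rewrite -[leLHS]lnK ?posrE// ler_expR; apply: le_trans (ltW zB).
  by rewrite /log_barrier lerDl ln_ge0//= lerDl.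
rewrite -[x ^+ 2]real_normK ?num_real//.
by have := sqr_ge0 (`|x| - 1); have := sqr_ge0 (1 + y); have := sqr_ge0 `|x|; split; nra.
Qed.

Lemma log_barrier_continuous z : 0 < z.2 -> {for z, continuous log_barrier}.
Proof.
case: z => x y /= y0.
have cvg_height : (fun z : R * R => 1 + z.2) @ (x, y) --> 1 + y.
  by apply: cvgD; [exact: cvg_cst|exact: cvg_snd].
apply: cvgD.
  apply: (@continuous_comp _ _ _ (fun z : R * R => z.1 ^+ 2 + (1 + z.2) ^+ 2) (@ln R)).
    by apply: cvgD; rewrite expr2; apply: cvgM => //; exact: cvg_fst.
  by apply: continuous_ln; apply: sqrD_gt0 => /=; lra.
apply: (@continuous_comp _ _ _ (fun z : R * R => 1 + z.2) (@ln R)) => //.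
by apply: continuous_ln => /=; lra.
Qed.

Lemma lap4_log_barrier x y r : 0 <= y -> 0 < r <= 1 / 2 ->
  lap4 log_barrier (x, y) r <= 4 * r ^+ 4 - r ^+ 2 / (1 + y) ^+ 2.
Proof.
move=> y0 /andP[r0 r1]; set Y := 1 + y; set N := x ^+ 2 + Y ^+ 2.
have Yr : 0 < Y - r by rewrite /Y; lra.
have Yr' : 0 < Y + r by lra.
have Y0 : 0 < Y by lra.
have N1 : 1 <= N by rewrite /N ler_wpDl ?sqr_ge0// exprn_ege1// /Y; lra.
have N0 : 0 < N by lra.
have D0 := cross_prod_gt0 x Yr r0.
have -> : lap4 log_barrier (x, y) r =
    ln (cross_prod x Y r / N ^+ 4) + ln ((Y + r) * (Y - r) / Y ^+ 2).
  rewrite ln_div ?posrE ?exprn_gt0// ln_div ?posrE ?mulr_gt0// !lnXn// (lnM Yr' Yr).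
  rewrite /cross_prod !lnM ?posrE ?mulr_gt0 ?sqrD_gt0//.
  by rewrite /lap4 /log_barrier/= !addrA -/Y -/N; lra.
have YrE : (Y + r) * (Y - r) / Y ^+ 2 = 1 - r ^+ 2 / Y ^+ 2 by field; rewrite gt_eqF.
have Yr0 : 0 < (Y + r) * (Y - r) / Y ^+ 2 by rewrite divr_gt0 ?mulr_gt0//; lra.
apply: lerD; last by rewrite YrE in Yr0 *; rewrite le_ln1Dx//; lra.
have DN0 : 0 < cross_prod x Y r / N ^+ 4 by rewrite divr_gt0 ?exprn_gt0.
rewrite -[X in ln X](subrKC 1); apply: le_trans (le_ln1Dx _) _; first by lra.
by rewrite lerBlDl ler_pdivrMr ?exprn_gt0// mulrC cross_prod_le//; lra.
Qed.

Lemma near_lap4_log_barrier z : 0 <= z.2 ->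
  \forall r \near 0^'+, lap4 log_barrier z r <= - (r ^+ 2 / (2 * (1 + z.2) ^+ 2)).
Proof.
case: z => x y /= y0; near=> r.
have r0 : 0 < r by [].
have r1 : r <= 1 / 2 by near: r; apply: nbhs_right_le; lra.
have ry : r <= (1 + y)^-1 / 4 by near: r; apply: nbhs_right_le; rewrite divr_gt0 ?invr_gt0; lra.
apply: le_trans (lap4_log_barrier _ y0 _) _; first by rewrite r0.
have r2 : r ^+ 2 <= ((1 + y)^-1 / 4) ^+ 2.
  by rewrite lerXn2r ?nnegrE ?divr_ge0 ?invr_ge0 ?(ltW r0)//; lra.
have -> : 2 * (1 + y) ^+ 2 = ((1 + y)^-1 ^+ 2 / 2)^-1 by field; lra.
rewrite invrK -exprVn; have := ler_wpM2l (sqr_ge0 r) r2.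
have := mulr_ge0 (sqr_ge0 r) (sqr_ge0 (1 + y)^-1).
by rewrite (_ : r ^+ 4 = r ^+ 2 * r ^+ 2); [lra|ring].
Unshelve. all: by end_near. Qed.

End FourPointLaplacian.

Section MaximumPrinciple.
Context {R : realType}.
Local Notation H := (@upper_half_plane R).
Implicit Types (x y r e B : R) (z : R * R) (V : R * R -> R).

Lemma null_lap4_no_local_max V z e : 0 < z.2 -> 0 < e -> null_lap4 V z ->
  ~ \forall z' \near z, V z' - e * log_barrier z' <= V z - e * log_barrier z.
Proof.
move=> z0 e0 nV /lap4_local_max_le0 Wle; pose k := e / (2 * (1 + z.2) ^+ 2).
have k0 : 0 < k by rewrite divr_gt0 ?mulr_gt0 ?exprn_gt0//; lra.
near (0 : R)^'+ => r; have r20 : 0 < r ^+ 2 by rewrite exprn_gt0.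
have : lap4 (fun z => V z - e * log_barrier z) z r <= 0 by near: r.
have -> : lap4 (fun z => V z - e * log_barrier z) z r = lap4 V z r - e * lap4 log_barrier z r.
  by rewrite /lap4; ring.
have : `|lap4 V z r| <= k / 2 * r ^+ 2 by near: r; apply: nV; rewrite divr_gt0.
have : lap4 log_barrier z r <= - (r ^+ 2 / (2 * (1 + z.2) ^+ 2)).
  by near: r; apply: near_lap4_log_barrier; exact: ltW.
move=> /(ler_wpM2l (ltW e0)); rewrite mulrN mulrCA -/k ler_norml => b /andP[v _].
by have := mulr_gt0 k0 r20; lra.
Unshelve. all: by end_near. Qed.

Lemma near_boundary_segment (P : set (R * R)) (a b : R) :
  (forall x, \forall z \near within H (nbhs (x, 0)), P z) ->
  exists2 d : R, 0 < d & forall x y, a <= x <= b -> 0 < y < d -> P (x, y).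
Proof.
move=> HP; have [x _|d /= d0 dP] := @near_segment _ _ 0^'+ _ (fun y x => P (x, y)) a b.
  have [[A1 A2] /= [A1x [d /= d0 dA2]] AP] := HP x.
  exists (A1, A2 `&` [set y | 0 < y]) => /=.
    by split => //; exists d => // y yd y0; split => //; exact: dA2.
  by move=> [x' y] /= [A1x' [A2y y0]]; apply: (AP (x', y)).
exists d => // x y xab /andP[y0 yd].
by apply: dP; rewrite //= ?sub0r ?normrN ?gtr0_norm.
Qed.

(* The logarithmic barrier rules out a maximum escaping to infinity. *)
Lemma maximum_principle V B :
  (forall z, 0 < z.2 -> {for z, continuous V}) ->
  (forall z, 0 < z.2 -> V z <= B) ->
  (forall x e, 0 < e -> \forall z \near within H (nbhs (x, 0)), V z <= e) ->
  (forall z, 0 < z.2 -> null_lap4 V z) ->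
  forall z, 0 < z.2 -> V z <= 0.
Proof.
move=> cV VB V0 nV z0 z00; rewrite leNgt; apply/negP => Vz0.
have b0 := log_barrier_ge0 (ltW z00).
pose e := V z0 / (2 * (log_barrier z0 + 1)); have e0 : 0 < e by rewrite divr_gt0//; lra.
pose W z := V z - e * log_barrier z.
have W_le_V z : 0 < z.2 -> W z <= V z.
  by move=> z0'; rewrite gerBl mulr_ge0 ?(ltW e0)// log_barrier_ge0// ltW.
have Wz0 : V z0 / 4 < W z0.
  have : e * (log_barrier z0 + 1) = V z0 / 2 by rewrite /e; field; lra.
  by rewrite /W; lra.
have [L Lfar] := log_barrier_coercive (B / e).
have Vz04 : 0 < V z0 / 4 by rewrite divr_gt0.
have [d d0 dV] := near_boundary_segment (- L) L (fun x => V0 x _ Vz04).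
pose K : set (R * R) := `[- L, L]%classic `*` `[d, L]%classic.
have outside z : 0 < z.2 -> ~ K z -> W z <= V z0 / 4.
  case: z => x y /= y0 nK; have [xyB|] := ltP (log_barrier (x, y)) (B / e); last first.
    by rewrite ler_pdivrMr// /W => h; have := VB (x, y) y0; lra.
  have [/= xL yL] := Lfar (x, y) (ltW y0) xyB.
  apply: le_trans (W_le_V _ _) (dV _ _ _ _); rewrite -?ler_norml// y0/= ltNge.
  by apply/negP => dy; apply: nK; split; rewrite /= in_itv/= -?ler_norml ?dy.
have Kz0 : K z0 by apply: contrapT => /(outside _ z00); lra.
have K_pos z : K z -> 0 < z.2 by move=> [_ /=]; rewrite in_itv/= => /andP[/(lt_le_trans d0)].
have cW z : 0 < z.2 -> {for z, continuous W}.
  move=> z0'; apply: cvgB; first exact: cV.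
  by apply: cvgM; [exact: cvg_cst|exact: log_barrier_continuous].
have [c /[1!inE] Kc cmax] : exists2 c, c \in K & forall z, z \in K -> W z <= W c.
  apply: compact_EVT_max; first by exists z0.
    by apply: compact_setX; exact: segment_compact.
  by apply: continuous_in_subspaceT => z /[1!inE] /K_pos; exact: cW.
have c0 := K_pos _ Kc.
apply: (null_lap4_no_local_max c0 e0 (nV c c0)).
have : \forall z \near c, 0 < z.2 by exact: (cvg_snd (lt_nbhsr c0)).
apply: filterS => z z0'; rewrite -/(W z) -/(W c).
have Wz0c : W z0 <= W c by apply: cmax; rewrite inE.
by have [Kz|/(outside _ z0')] := pselect (K z); [apply: cmax; rewrite inE|lra].
Qed.

Lemma null_lap4_unique V B :
  (forall z, 0 < z.2 -> {for z, continuous V}) ->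
  (forall z, 0 < z.2 -> `|V z| <= B) ->
  (forall x, V z @[z --> within H (nbhs (x, 0))] --> 0) ->
  (forall z, 0 < z.2 -> null_lap4 V z) ->
  forall z, 0 < z.2 -> V z = 0.
Proof.
move=> cV VB V0 nV z z0.
have V0e x e : 0 < e -> \forall z \near within H (nbhs (x, 0)), `|V z| <= e.
  by move=> e0; have /cvgr0Pnorm_le := V0 x; apply.
apply/eqP; rewrite eq_le; apply/andP; split.
  apply: (@maximum_principle V B) => // [z' z'0|x e e0].
    exact: le_trans (ler_norm _) (VB _ z'0).
  by apply: filterS (V0e x e e0) => z'; apply: le_trans; exact: ler_norm.
rewrite -oppr_le0; apply: (@maximum_principle (fun z => - V z) B _ _ _ _ z z0).
- by move=> z' z'0; apply: cvgN; exact: cV.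
- by move=> z' z'0; apply: le_trans (ler_norm _) _; rewrite normrN; exact: VB.
- move=> x e e0; apply: filterS (V0e x e e0) => z'; apply: le_trans.
  by rewrite -normrN; exact: ler_norm.
- by move=> z' z'0; apply: null_lap4N; exact: nV.
Qed.

End MaximumPrinciple.

(** * Poisson extensions *)

Section Lap4Rintegral.
Context d (T : measurableType d) (R : realType) (mu : {measure set T -> \bar R}).
Variables (D : set T) (F : T -> R * R -> R).
Hypothesis mD : measurable D.
Hypothesis iF : forall z : R * R, 0 < z.2 -> mu.-integrable D (EFin \o (fun t => F t z)).

Lemma lap4_Rintegral (z : R * R) r : 0 < r < z.2 ->
  mu.-integrable D (EFin \o (fun t => lap4 (F t) z r)) /\
  lap4 (fun z => \int[mu]_(t in D) F t z) z r = \int[mu]_(t in D) lap4 (F t) z r.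
Proof.
move=> /andP[r0 rz]; have z0 := lt_trans r0 rz.
have i1 : mu.-integrable D (EFin \o (fun t => F t (z.1 + r, z.2))) by exact: iF.
have i2 : mu.-integrable D (EFin \o (fun t => F t (z.1 - r, z.2))) by exact: iF.
have i3 : mu.-integrable D (EFin \o (fun t => F t (z.1, z.2 + r))) by apply: iF => /=; lra.
have i4 : mu.-integrable D (EFin \o (fun t => F t (z.1, z.2 - r))) by apply: iF => /=; lra.
have i12 := integrable_addr mD i1 i2; have i123 := integrable_addr mD i12 i3.
have i1234 := integrable_addr mD i123 i4; have i0 := integrable_mulrl mD 4 (iF z0).
split; first exact: integrable_subr.
by rewrite /lap4 RintegralB// !RintegralD// RintegralZl//; exact: iF.
Qed.

End Lap4Rintegral.

Section PoissonExtension.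
Context {R : realType}.
Local Notation mu := (@lebesgue_measure R).
Implicit Types (x y r e B c d : R) (z : R * R) (f g u v : R -> R).

Definition poisson_ext u z := \int[mu]_t (poisson z.2 (z.1 - t) * u t).

Definition poisson_integrable u :=
  measurable_fun setT u /\ mu.-integrable setT (EFin \o (fun t : R => poisson 1 t * u t)).

Lemma measurable_poisson1 : measurable_fun setT (@poisson R 1).
Proof. by apply: continuous_measurable_fun; exact: continuous_poisson. Qed.

Lemma integrable_poisson1 : mu.-integrable setT (EFin \o @poisson R 1).
Proof.
apply: eq_integrable (integrable_poissonB 0 ltr01) => // t _ /=.
by rewrite sub0r poissonN.
Qed.

Lemma measurable_poisson_kernel x y u : 0 < y -> measurable_fun setT u ->
  measurable_fun setT (fun t : R => poisson y (x - t) * u t).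
Proof. by move=> y0 mu_; apply: measurable_funM => //; exact: measurable_poissonB. Qed.

Lemma integrable_poisson_kernel u x y : poisson_integrable u -> 0 < y ->
  mu.-integrable setT (EFin \o (fun t : R => poisson y (x - t) * u t)).
Proof.
move=> [mu_ iu] y0; have [C C0 CP] := poisson_le_poisson1 x y0.
have iCu := integrable_mulrl measurableT C (integrable_normr measurableT iu).
apply: integrable_dominated iCu _ => //.
  exact: measurable_poisson_kernel.
by move=> t _; rewrite !normr_poissonM// mulrA ler_wpM2r.
Qed.

Lemma poisson_integrable_dominated u v : measurable_fun setT u -> poisson_integrable v ->
  (forall t, `|u t| <= v t) -> poisson_integrable u.
Proof.
move=> mu_ [_ iv] uv; split => //; apply: integrable_dominated iv _ => //.
  by apply: measurable_funM => //; exact: measurable_poisson1.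
by move=> t _; rewrite normr_poissonM// ler_wpM2l ?poisson_ge0.
Qed.

Lemma poisson_integrable_cst c : poisson_integrable (cst c).
Proof.
split => //; apply: eq_integrable (integrable_mulrl measurableT c integrable_poisson1) => //.
by move=> t _ /=; rewrite mulrC.
Qed.

Lemma poisson_integrable_bounded u B : measurable_fun setT u -> (forall t, `|u t| <= B) ->
  poisson_integrable u.
Proof. by move=> mu_ uB; exact: poisson_integrable_dominated (poisson_integrable_cst B) uB. Qed.

Lemma poisson_integrableB u v : poisson_integrable u -> poisson_integrable v ->
  poisson_integrable (fun t => u t - v t).
Proof.
move=> [mu_ iu] [mv iv]; split; first exact: measurable_funB.
by apply: eq_integrable (integrable_subr measurableT iu iv) => // t _ /=; rewrite mulrBr.
Qed.

Lemma integrable_poisson_integrable u : mu.-integrable setT (EFin \o u) -> poisson_integrable u.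
Proof.
move=> iu; have mu_ := measurable_fun_integrable iu; split => //.
apply: (integrable_dominated measurableT _ (integrable_normr measurableT iu)) => [|t _].
  by apply: measurable_funM => //; exact: measurable_poisson1.
rewrite normr_poissonM// ler_piMl//; apply: le_trans (poisson_le t ltr01) _.
by rewrite invr1.
Qed.

Lemma poisson_integrableD u v : poisson_integrable u -> poisson_integrable v ->
  poisson_integrable (fun t => u t + v t).
Proof.
move=> [mu_ iu] [mv iv]; split; first exact: measurable_funD.
by apply: eq_integrable (integrable_addr measurableT iu iv) => // t _ /=; rewrite mulrDr.
Qed.

Lemma poisson_integrableMr u c : poisson_integrable u -> poisson_integrable (fun t => u t * c).
Proof.
move=> [mu_ iu]; split; first exact: measurable_funM.
by apply: eq_integrable (integrable_mulrl measurableT c iu) => // t _ /=; rewrite mulrC mulrA.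
Qed.

Lemma poisson_integrable_normr u : poisson_integrable u -> poisson_integrable (fun t => `|u t|).
Proof.
move=> [mu_ iu]; split; first exact: measurableT_comp.
apply: eq_integrable (integrable_normr measurableT iu) => // t _ /=.
by rewrite normr_poissonM.
Qed.

Lemma poisson_extD u v z : 0 < z.2 -> poisson_integrable u -> poisson_integrable v ->
  poisson_ext (fun t => u t + v t) z = poisson_ext u z + poisson_ext v z.
Proof.
move=> z0 iu iv; rewrite /poisson_ext; under eq_Rintegral do rewrite mulrDr.
by rewrite RintegralD//; exact: integrable_poisson_kernel.
Qed.

Lemma poisson_extB u v z : 0 < z.2 -> poisson_integrable u -> poisson_integrable v ->
  poisson_ext (fun t => u t - v t) z = poisson_ext u z - poisson_ext v z.
Proof.
move=> z0 iu iv; rewrite /poisson_ext; under eq_Rintegral do rewrite mulrBr.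
by rewrite RintegralB//; exact: integrable_poisson_kernel.
Qed.

Lemma poisson_extMr u c z : 0 < z.2 -> poisson_integrable u ->
  poisson_ext (fun t => u t * c) z = poisson_ext u z * c.
Proof.
move=> z0 iu; rewrite /poisson_ext; under eq_Rintegral do rewrite mulrA.
by rewrite RintegralZr//; exact: integrable_poisson_kernel.
Qed.

Lemma le_poisson_ext u v z : 0 < z.2 -> poisson_integrable u -> poisson_integrable v ->
  (forall t, u t <= v t) -> poisson_ext u z <= poisson_ext v z.
Proof.
move=> z0 iu iv uv; apply: le_Rintegral => //; try exact: integrable_poisson_kernel.
by move=> t _; rewrite ler_wpM2l// poisson_ge0.
Qed.

Lemma poisson_ext_le_Rintegral u z : 0 < z.2 -> mu.-integrable setT (EFin \o u) ->
  (forall t, 0 <= u t) -> poisson_ext u z <= z.2^-1 * \int[mu]_t u t.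
Proof.
move=> z0 iu u0; rewrite -(RintegralZl _ measurableT iu).
apply: le_Rintegral => //; last by move=> t _; rewrite ler_wpM2r// poisson_le.
- by apply: integrable_poisson_kernel => //; exact: integrable_poisson_integrable.
- exact: integrable_mulrl.
Qed.

Lemma poisson_ext_cst c z : 0 < z.2 -> poisson_ext (cst c) z = c.
Proof.
move=> z0; rewrite /poisson_ext RintegralZr//; last exact: integrable_poissonB.
by rewrite Rintegral_poissonB// mul1r.
Qed.

Lemma poisson_ext_ge0 u z : 0 < z.2 -> (forall t, 0 <= u t) -> 0 <= poisson_ext u z.
Proof. by move=> z0 u0; apply: Rintegral_ge0 => t _; rewrite mulr_ge0 ?poisson_ge0. Qed.

Lemma ler_normr_poisson_ext u v z : 0 < z.2 -> poisson_integrable v -> measurable_fun setT u ->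
  (forall t, `|u t| <= v t) -> `|poisson_ext u z| <= poisson_ext v z.
Proof.
move=> z0 iv mu_ uv; apply: ler_normr_Rintegral => //.
- exact: measurable_poisson_kernel.
- exact: integrable_poisson_kernel.
- by move=> t _; rewrite normr_poissonM// ler_wpM2l ?poisson_ge0.
Qed.

Lemma normr_poisson_ext_le u B z : 0 < z.2 -> measurable_fun setT u ->
  (forall t, `|u t| <= B) -> `|poisson_ext u z| <= B.
Proof.
move=> z0 mu_ uB; rewrite -[leRHS](poisson_ext_cst B z0).
exact: ler_normr_poisson_ext (poisson_integrable_cst B) mu_ uB.
Qed.

Lemma poisson_ext_lipschitz u z z' : 0 < z.2 -> poisson_integrable u ->
  `|z'.1 - z.1| <= z.2 / 2 -> `|z'.2 - z.2| <= z.2 / 2 ->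
  `|poisson_ext u z' - poisson_ext u z| <=
    4 / z.2 * (`|z'.1 - z.1| + `|z'.2 - z.2|) * poisson_ext (fun t => `|u t|) z.
Proof.
move=> z0 iu zx zy; have z'0 : 0 < z'.2 by move: zy; rewrite ler_norml => /andP[]; lra.
have iu1 := integrable_poisson_kernel z.1 iu z0; have iu2 := integrable_poisson_kernel z'.1 iu z'0.
have inu := integrable_poisson_kernel z.1 (poisson_integrable_normr iu) z0.
rewrite /poisson_ext -RintegralB// -RintegralZl//; apply: ler_normr_Rintegral => //.
- by apply: measurable_funB; apply: measurable_poisson_kernel => //; exact: iu.1.
- exact: integrable_mulrl.
move=> t _; rewrite -mulrBl normrM mulrA ler_wpM2r//.
have := @poisson_ratio _ z.2 z'.2 (z.1 - t) (z'.1 - t) z0.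
by rewrite (_ : z'.1 - t - (z.1 - t) = z'.1 - z.1); [apply|ring].
Qed.

Lemma poisson_ext_continuous u z : 0 < z.2 -> poisson_integrable u ->
  {for z, continuous (poisson_ext u)}.
Proof.
move=> z0 iu; pose C := 4 / z.2 * poisson_ext (fun t => `|u t|) z.
have C0 : 0 <= C by rewrite mulr_ge0 ?poisson_ext_ge0// divr_ge0// ltW.
apply/cvgrPdist_le => /= e e0; near=> z'.
have [x1 y1] : `|z'.1 - z.1| < z.2 / 2 /\ `|z'.2 - z.2| < z.2 / 2.
  by near: z'; apply: near_prod_dist; rewrite divr_gt0.
have [x2 y2] : `|z'.1 - z.1| < e / (2 * (C + 1)) /\ `|z'.2 - z.2| < e / (2 * (C + 1)).
  by near: z'; apply: near_prod_dist; rewrite divr_gt0//; lra.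
rewrite distrC; apply: le_trans (poisson_ext_lipschitz z0 iu (ltW x1) (ltW y1)) _.
rewrite mulrAC -/C; apply: le_trans (ler_wpM2l C0 (lerD (ltW x2) (ltW y2))) _.
rewrite (_ : C * _ = e * (C / (C + 1))); last by field; lra.
by rewrite ler_piMr ?(ltW e0)// ler_pdivrMr; lra.
Unshelve. all: by end_near. Qed.

Lemma integrable_poisson_lap4 u z r : 0 < r < z.2 -> poisson_integrable u ->
  mu.-integrable setT (EFin \o (fun t => lap4 (fun w => poisson w.2 w.1) (z.1 - t, z.2) r * u t)) /\
  lap4 (poisson_ext u) z r = \int[mu]_t (lap4 (fun w => poisson w.2 w.1) (z.1 - t, z.2) r * u t).
Proof.
move=> rz iu; have iF w := integrable_poisson_kernel w.1 iu (y := w.2).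
have lap4E : (fun t => lap4 (fun w => poisson w.2 w.1) (z.1 - t, z.2) r * u t) =
    (fun t => lap4 (fun w => poisson w.2 (w.1 - t) * u t) z r).
  by apply/funext => t; rewrite /lap4/= (addrAC z.1) (addrAC z.1 (- r)); ring.
by rewrite lap4E; exact: lap4_Rintegral.
Qed.

Lemma poisson_ext_null_lap4 u z : 0 < z.2 -> poisson_integrable u -> null_lap4 (poisson_ext u) z.
Proof.
move=> z0 iu; have [C C0 CP] := lap4_poisson z0.
have iu' := poisson_integrable_normr iu; have z20 : 0 < z.2 / 2 by rewrite divr_gt0.
apply: (lap4_quartic_null z20 (c := C * poisson_ext (fun t => `|u t|) z)) => [|r /andP[r0 rz]].
  by rewrite mulr_ge0// poisson_ext_ge0.
have rz' : 0 < r < z.2 by rewrite r0; lra.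
have [iL ->] := integrable_poisson_lap4 rz' iu.
rewrite mulrAC -RintegralZl//; last exact: integrable_poisson_kernel.
apply: ler_normr_Rintegral => //; first exact: measurable_fun_integrable iL.
  by apply: integrable_mulrl => //; exact: integrable_poisson_kernel.
by move=> t _; rewrite normrM mulrA ler_wpM2r// CP// r0.
Qed.

Lemma poisson_ext_le_tail g x y d e : 0 < y -> 0 < d -> poisson_integrable g ->
  (forall t, 0 <= g t) -> (forall t, `|x - t| < d -> g t <= e) -> 0 <= e ->
  poisson_ext g (x, y) <= e + 2 * y / d * poisson_ext g (x, d).
Proof.
move=> y0 d0 ig g0 ge e0.
have iP := integrable_poissonB x y0; have iPg := integrable_poisson_kernel x ig d0.
have ieP := integrable_mulrl measurableT e iP.
have icPg := integrable_mulrl measurableT (2 * y / d) iPg.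
have -> : e + 2 * y / d * poisson_ext g (x, d) =
    \int[mu]_t (e * poisson y (x - t) + 2 * y / d * (poisson d (x - t) * g t)).
  rewrite RintegralD// (RintegralZl _ measurableT iP) (RintegralZl _ measurableT iPg).
  by rewrite Rintegral_poissonB// mulr1.
apply: le_Rintegral => //; [exact: integrable_poisson_kernel|exact: integrable_addr|move=> t _].
rewrite /=; have Py := poisson_ge0 (x - t) y0; have Pd := poisson_ge0 (x - t) d0.
have [xtd|dxt] := ltP `|x - t| d.
  have c0 : 0 <= 2 * y / d by rewrite divr_ge0 ?mulr_ge0 ?(ltW y0) ?(ltW d0).
  by rewrite mulrC (ler_wpDr (mulr_ge0 c0 (mulr_ge0 Pd _)))// ler_wpM2r// ge.
by rewrite (ler_wpDl (mulr_ge0 e0 Py))// mulrA ler_wpM2r// poisson_tail.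
Qed.

Lemma poisson_ext_harnack g x x' y : 0 < y -> poisson_integrable g -> (forall t, 0 <= g t) ->
  `|x' - x| <= y / 2 -> poisson_ext g (x', y) <= 3 * poisson_ext g (x, y).
Proof.
move=> y0 ig g0 xx'; have gE : (fun t => `|g t|) = g by apply/funext => t; rewrite ger0_norm.
have := @poisson_ext_lipschitz g (x, y) (x', y) y0 ig xx'; rewrite /= subrr normr0 addr0 gE.
rewrite divr_ge0 ?(ltW y0)// => /(_ isT); rewrite ler_norml => /andP[_].
have g0' := poisson_ext_ge0 (z := (x, y)) y0 g0.
have : 4 / y * `|x' - x| <= 2 by rewrite mulrAC ler_pdivrMr//; lra.
by move=> /(ler_wpM2r g0'); lra.
Qed.

Lemma poisson_ext_le_near g x d e z : poisson_integrable g -> (forall t, 0 <= g t) ->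
  0 < d -> 0 <= e -> (forall t, `|x - t| < d -> g t <= e) -> 0 < z.2 -> `|z.1 - x| <= d / 4 ->
  poisson_ext g z <= e + 12 * z.2 / d * poisson_ext g (x, d / 2).
Proof.
move=> ig g0 d0 e0 ge z0 zx; have d20 : 0 < d / 2 by rewrite divr_gt0.
have ge_z t : `|z.1 - t| < d / 2 -> g t <= e.
  by move=> zt; apply: ge; rewrite (le_lt_trans (ler_distD z.1 _ _))// (distrC x); lra.
have := poisson_ext_le_tail z0 d20 ig g0 ge_z e0; rewrite -surjective_pairing.
move=> /le_trans; apply; rewrite lerD2l.
have Cz : poisson_ext g (z.1, d / 2) <= 3 * poisson_ext g (x, d / 2).
  by apply: poisson_ext_harnack => //; lra.
have -> : 12 * z.2 / d = 2 * z.2 / (d / 2) * 3 by field; rewrite gt_eqF.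
by rewrite -[leRHS]mulrA ler_wpM2l// ltW// divr_gt0// mulr_gt0.
Qed.

Lemma poisson_ext_boundary f x : poisson_integrable f -> {for x, continuous f} ->
  poisson_ext f z @[z --> within (@upper_half_plane R) (nbhs (x, 0))] --> f x.
Proof.
move=> if_ cf; pose g t := `|f t - f x|.
have ig : poisson_integrable g.
  by apply: poisson_integrable_normr; exact: poisson_integrableB (poisson_integrable_cst _).
have g0 t : 0 <= g t by exact: normr_ge0.
apply/cvgrPdist_le => /= e e0; have e20 : 0 < e / 2 by rewrite divr_gt0.
have /cvgrPdist_le/(_ _ e20)[d /= d0 dP] := cf.
have ge t : `|x - t| < d -> g t <= e / 2 by move=> xt; rewrite /g distrC; exact: dP.
pose C := 12 / d * poisson_ext g (x, d / 2).
have C0 : 0 <= C by rewrite mulr_ge0 ?poisson_ext_ge0 ?divr_ge0//= ?divr_gt0// ltW.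
near=> z.
have z0 : 0 < z.2 by near: z; exact: withinT.
have [zd _] : `|z.1 - x| < d / 4 /\ `|z.2 - 0| < d / 4.
  by near: z; apply: cvg_within; apply: (near_prod_dist (x, 0)); rewrite divr_gt0.
have [_] : `|z.1 - x| < e / 2 / (C + 1) /\ `|z.2 - 0| < e / 2 / (C + 1).
  by near: z; apply: cvg_within; apply: (near_prod_dist (x, 0)); rewrite divr_gt0// ltr_wpDl.
rewrite subr0 gtr0_norm// ltr_pdivlMr ?ltr_wpDl// => zC.
have -> : f x - poisson_ext f z = - poisson_ext (fun t => f t - f x) z.
  by rewrite (poisson_extB z0 if_ (poisson_integrable_cst _)) poisson_ext_cst// opprB.
rewrite normrN; apply: le_trans (ler_normr_poisson_ext z0 ig _ _) _ => //.
  by apply: measurable_funB => //; exact: if_.1.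
apply: le_trans (poisson_ext_le_near ig g0 d0 (ltW e20) ge z0 (ltW zd)) _.
rewrite [leRHS]splitr lerD2l (_ : 12 * z.2 / d * _ = z.2 * C); last by rewrite /C; ring.
by rewrite (le_trans _ (ltW zC))// ler_wpM2l ?(ltW z0)// lerDl.
Unshelve. all: by end_near. Qed.

(* The difference of the two sides vanishes on the boundary. *)
Lemma bounded_null_lap4_poisson_ext (G : R * R -> R) g B :
  (forall z, 0 < z.2 -> {for z, continuous G}) -> (forall z, 0 < z.2 -> `|G z| <= B) ->
  (forall z, 0 < z.2 -> null_lap4 G z) -> continuous g -> (forall t, `|g t| <= B) ->
  (forall x, G z @[z --> within (@upper_half_plane R) (nbhs (x, 0))] --> g x) ->
  forall z, 0 < z.2 -> G z = poisson_ext g z.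
Proof.
move=> cG GB nG cg gB Gg z z0.
have mg : measurable_fun setT g by exact: continuous_measurable_fun.
have ig := poisson_integrable_bounded mg gB.
apply/eqP; rewrite -subr_eq0; apply/eqP.
apply: (@null_lap4_unique _ (fun z => G z - poisson_ext g z) (B + B) _ _ _ _ z z0) => {z z0}.
- by move=> z z0; apply: cvgB; [exact: cG|exact: poisson_ext_continuous].
- move=> z z0; rewrite (le_trans (ler_normB _ _))// lerD ?GB//.
  exact: normr_poisson_ext_le.
- by move=> x; have := cvgB (Gg x) (poisson_ext_boundary ig (cg x)); rewrite subrr; exact.
- by move=> z z0; apply: null_lap4B; [exact: nG|exact: poisson_ext_null_lap4].
Qed.

Lemma translated_poisson_ext (G : R * R -> R) s B : 0 < s ->
  (forall z, 0 < z.2 -> {for z, continuous G}) -> (forall z, s <= z.2 -> `|G z| <= B) ->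
  (forall z, 0 < z.2 -> null_lap4 G z) ->
  forall z, 0 < z.2 -> G (z.1, s + z.2) = poisson_ext (fun t => G (t, s)) z.
Proof.
move=> s0 cG GB nG z z0; pose up (z : R * R) := (z.1, s + z.2).
have cup z' : {for z', continuous up}.
  apply: continuous_pair; first exact: cvg_fst.
  by apply: cvgD; [exact: cvg_cst|exact: cvg_snd].
have cGup (z' : R * R) : 0 <= z'.2 -> {for z', continuous (G \o up)}.
  by move=> z'0; apply: continuous_comp; [exact: cup|apply: cG; rewrite /= ltr_pwDl].
apply: (@bounded_null_lap4_poisson_ext (G \o up) (fun t => G (t, s)) B _ _ _ _ _ _ z z0) => {z z0}.
- by move=> z /ltW; exact: cGup.
- by move=> z z0; apply: GB; rewrite lerDl ltW.
- move=> z z0 e e0; have sz : 0 < (up z).2 by rewrite addr_gt0.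
  by apply: filterS (nG _ sz e e0) => r; rewrite /lap4/= /up/= !addrA.
- move=> t; apply: (@continuous_comp _ _ _ (fun t => (t, s)) G); last exact: cG.
  by apply: continuous_pair => //; exact: cst_continuous.
- by move=> t; exact: GB.
- move=> x; have -> : G (x, s) = (G \o up) (x, 0) by rewrite /= /up/= addr0.
  by apply: cvg_within_filter; exact: (cGup (x, 0)).
Qed.

End PoissonExtension.

(** * Harmonic functions in the half-plane *)

Section SecondDifferences.
Context {R : realType}.
Implicit Types (x y r e d K : R) (z : R * R) (g dg d2g : R -> R) (f : R * R -> R).

Lemma is_derive_shift g x t l : is_derive (x + t) 1 g l -> is_derive t 1 (fun t => g (x + t)) l.
Proof.
move=> dg; have d1 : is_derive t 1 (fun t => x + t) 1.
  by have := is_deriveD (is_derive_cst x t 1) (is_derive_id t 1); rewrite add0r.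
by have := @is_derive1_comp _ g (fun t => x + t) t _ _ dg d1; rewrite mulr1.
Qed.

Lemma is_derive_reflect g x t l : is_derive (x - t) 1 g l ->
  is_derive t 1 (fun t => g (x - t)) (- l).
Proof.
move=> dg; have d1 : is_derive t 1 (fun t => x - t) (-1).
  by have := is_deriveB (is_derive_cst x t 1) (is_derive_id t 1); rewrite sub0r.
by have := @is_derive1_comp _ g (fun t => x - t) t _ _ dg d1; rewrite mulrN1.
Qed.

Lemma is_derive_MVT g dg (a b : R) : a < b ->
  (forall t, a <= t <= b -> is_derive t 1 g (dg t)) ->
  exists2 c, a < c < b & g b - g a = dg c * (b - a).
Proof.
move=> ab dgP; have [t||c] := @MVT _ g dg a b ab; last by rewrite in_itv/=; exists c.
  by rewrite in_itv/= => /andP[ta tb]; apply: dgP; rewrite !ltW.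
apply: derivable_within_continuous => t; rewrite in_itv/= => tab.
by have [] := dgP t tab.
Qed.

Lemma second_difference g dg d2g x d K e r :
  (forall t, `|t - x| < d -> is_derive t 1 g (dg t)) ->
  (forall t, `|t - x| < d -> is_derive t 1 dg (d2g t)) ->
  (forall t, `|t - x| < d -> `|d2g t - K| <= e) ->
  0 < r < d -> `|g (x + r) + g (x - r) - 2 * g x - K * r ^+ 2| <= 2 * e * r ^+ 2.
Proof.
move=> dgP d2gP Ke /andP[r0 rd].
pose psi t := g (x + t) + g (x - t) - K * t ^+ 2.
pose dpsi t := dg (x + t) - dg (x - t) - K * (2 * t).
have dpsiP (t : R) : 0 <= t <= r -> is_derive t 1 psi (dpsi t).
  move=> /andP[t0 tr]; have td : `|t| < d by rewrite ger0_norm//; lra.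
  have dshift : is_derive t 1 (fun t => g (x + t)) (dg (x + t)).
    by apply: is_derive_shift; apply: dgP; rewrite addrAC subrr add0r.
  have dreflect : is_derive t 1 (fun t => g (x - t)) (- dg (x - t)).
    by apply: is_derive_reflect; apply: dgP; rewrite addrAC subrr add0r normrN.
  have dsquare : is_derive t 1 (fun t : R => K * t ^+ 2) (K * (2 * t)).
    by apply: is_derive_eq; rewrite /GRing.scale/=; ring.
  exact: is_deriveB (is_deriveD dshift dreflect) dsquare.
have [c /andP[c0 cr] psiE] := is_derive_MVT r0 dpsiP.
have dgP' t : x - c <= t <= x + c -> is_derive t 1 dg (d2g t).
  by move=> /andP[t1 t2]; apply: d2gP; rewrite ltr_norml; lra.
have xc : x - c < x + c by lra.
have [t /andP[tc ct] dgE] := is_derive_MVT xc dgP'.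
have -> : g (x + r) + g (x - r) - 2 * g x - K * r ^+ 2 = psi r - psi 0.
  by rewrite /psi addr0 subr0 expr0n/=; ring.
have -> : psi r - psi 0 = 2 * (d2g t - K) * (c * r).
  by rewrite psiE /dpsi dgE; ring.
have dt : `|t - x| < d by rewrite ltr_norml; lra.
rewrite -!mulrA normrM ger0_norm// ler_pM2l// normrM (gtr0_norm (mulr_gt0 c0 r0)) expr2.
apply: ler_pM; rewrite ?normr_ge0 ?(ltW (mulr_gt0 c0 r0)) ?Ke//.
by rewrite ler_pM2r// ltW.
Qed.

Lemma is_derive_dx f x y : derivable f (x, y) (@e1 R) ->
  is_derive x 1 (fun t => f (t, y)) (dx f (x, y)).
Proof.
move=> df.
have quotientE : (fun h : R => h^-1 *: (((fun t => f (t, y)) \o shift x) (h *: 1) - f (x, y))) =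
    (fun h : R => h^-1 *: ((f \o shift (x, y)) (h *: @e1 R) - f (x, y))).
  apply/funext => h /=; congr (_ *: (f _ - _)).
  by rewrite -[RHS]/(h *: (1 : R) + x, h *: (0 : R) + y) scaler0 add0r.
by split; [rewrite /derivable quotientE|rewrite /dx /derive quotientE].
Qed.

Lemma is_derive_dy f x y : derivable f (x, y) (@e2 R) ->
  is_derive y 1 (fun t => f (x, t)) (dy f (x, y)).
Proof.
move=> df.
have quotientE : (fun h : R => h^-1 *: (((fun t => f (x, t)) \o shift y) (h *: 1) - f (x, y))) =
    (fun h : R => h^-1 *: ((f \o shift (x, y)) (h *: @e2 R) - f (x, y))).
  apply/funext => h /=; congr (_ *: (f _ - _)).
  by rewrite -[RHS]/(h *: (0 : R) + x, h *: (1 : R) + y) scaler0 add0r.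
by split; [rewrite /derivable quotientE|rewrite /dy /derive quotientE].
Qed.

Definition twice_derivable f z :=
  [/\ derivable f z (@e1 R), derivable f z (@e2 R), derivable (dx f) z (@e1 R)
    & derivable (dy f) z (@e2 R)].

Lemma lap4_second_derivatives f x y d A B c r :
  (forall t, `|t - x| < d -> twice_derivable f (t, y) /\ `|dx (dx f) (t, y) - A| <= c) ->
  (forall t, `|t - y| < d -> twice_derivable f (x, t) /\ `|dy (dy f) (x, t) - B| <= c) ->
  0 < r < d -> `|lap4 f (x, y) r - (A + B) * r ^+ 2| <= 4 * c * r ^+ 2.
Proof.
move=> dxA dyB rd.
have horizontal : `|f (x + r, y) + f (x - r, y) - 2 * f (x, y) - A * r ^+ 2| <= 2 * c * r ^+ 2.
  apply: (@second_difference (fun t => f (t, y)) (fun t => dx f (t, y))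
    (fun t => dx (dx f) (t, y)) x d); last exact: rd.
  - by move=> t /dxA[[df _ _ _] _]; exact: (@is_derive_dx f).
  - by move=> t /dxA[[_ _ ddf _] _]; exact: (@is_derive_dx (dx f)).
  - by move=> t /dxA[].
have vertical : `|f (x, y + r) + f (x, y - r) - 2 * f (x, y) - B * r ^+ 2| <= 2 * c * r ^+ 2.
  apply: (@second_difference (fun t => f (x, t)) (fun t => dy f (x, t))
    (fun t => dy (dy f) (x, t)) y d); last exact: rd.
  - by move=> t /dyB[[_ df _ _] _]; exact: (@is_derive_dy f).
  - by move=> t /dyB[[_ _ _ ddf] _]; exact: (@is_derive_dy (dy f)).
  - by move=> t /dyB[].
have -> : lap4 f (x, y) r - (A + B) * r ^+ 2 =
    (f (x + r, y) + f (x - r, y) - 2 * f (x, y) - A * r ^+ 2) +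
    (f (x, y + r) + f (x, y - r) - 2 * f (x, y) - B * r ^+ 2).
  by rewrite /lap4/=; ring.
have -> : 4 * c * r ^+ 2 = 2 * c * r ^+ 2 + 2 * c * r ^+ 2 by ring.
exact: le_trans (ler_normD _ _) (lerD horizontal vertical).
Qed.

Lemma near_lap4_laplacian f z e : 0 < e -> (\forall z' \near z, twice_derivable f z') ->
  {for z, continuous (dx (dx f))} -> {for z, continuous (dy (dy f))} ->
  \forall z' \near z & r \near 0^'+,
    `|lap4 f z' r - (dx (dx f) z + dy (dy f) z) * r ^+ 2| <= e * r ^+ 2.
Proof.
move=> e0 tf /cvgrPdist_le cxx /cvgrPdist_le cyy; have e40 : 0 < e / 4 by rewrite divr_gt0.
have {}cxx : \forall z' \near z, `|dx (dx f) z - dx (dx f) z'| <= e / 4 by exact: cxx.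
have {}cyy : \forall z' \near z, `|dy (dy f) z - dy (dy f) z'| <= e / 4 by exact: cyy.
have /nbhs_ballP[d /= d0 dP] : \forall z' \near z, [/\ twice_derivable f z',
    `|dx (dx f) z - dx (dx f) z'| <= e / 4 & `|dy (dy f) z - dy (dy f) z'| <= e / 4].
  by apply: (@filterS3 _ _ (nbhs_filter z)) tf cxx cyy => z'; split.
case: z => a b in tf cxx cyy dP *; have d20 : 0 < d / 2 by rewrite divr_gt0.
have dPx x y t : `|x - a| < d / 2 -> `|y - b| < d / 2 -> `|t - x| < d / 2 ->
    twice_derivable f (t, y) /\ `|dx (dx f) (t, y) - dx (dx f) (a, b)| <= e / 4.
  move=> xa yb tx; have [|td dxx _] := dP (t, y); last by rewrite distrC.
  split; rewrite /ball/= distrC; last by lra.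
  by rewrite (le_lt_trans (ler_distD x _ _))//; lra.
have dPy x y t : `|x - a| < d / 2 -> `|y - b| < d / 2 -> `|t - y| < d / 2 ->
    twice_derivable f (x, t) /\ `|dy (dy f) (x, t) - dy (dy f) (a, b)| <= e / 4.
  move=> xa yb ty; have [|td _ dyy] := dP (x, t); last by rewrite distrC.
  split; rewrite /ball/= distrC; first by lra.
  by rewrite (le_lt_trans (ler_distD y _ _))//; lra.
have box x y r : `|x - a| < d / 2 -> `|y - b| < d / 2 -> 0 < r < d / 2 ->
    `|lap4 f (x, y) r - (dx (dx f) (a, b) + dy (dy f) (a, b)) * r ^+ 2| <= e * r ^+ 2.
  move=> xa yb rd; have eE : e = 4 * (e / 4) by field.
  rewrite [in leRHS]eE; apply: (lap4_second_derivatives _ _ rd) => t.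
    exact: dPx xa yb.
  exact: dPy xa yb.
near=> z r; have := box z.1 z.2 r; rewrite -surjective_pairing; apply.
- by near: z; apply: filterS (near_prod_dist (a, b) d20) => z [].
- by near: z; apply: filterS (near_prod_dist (a, b) d20) => z [].
- by apply/andP; split; near: r; [exact: nbhs_right_gt|exact: nbhs_right_lt].
Unshelve. all: by end_near. Qed.

Lemma harmonic_twice_derivable f z : harmonic_on (@upper_half_plane R) f -> 0 < z.2 ->
  twice_derivable f z.
Proof. by move=> [_ hf] /hf[[? ?] [? _ _ ?]]. Qed.

Lemma harmonic_continuous f z : harmonic_on (@upper_half_plane R) f -> 0 < z.2 ->
  {for z, continuous f}.
Proof. by move=> [_ hf] /hf[_ _ []]. Qed.

Definition near_null_lap4 f z := forall e, 0 < e ->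
  \forall z' \near z & r \near 0^'+, `|lap4 f z' r| <= e * r ^+ 2.

Lemma near_null_lap4_null f z : near_null_lap4 f z -> null_lap4 f z.
Proof.
move=> nf e /nf[[A B] /= [Az B0] AB]; apply: filterS B0 => r Br.
by apply: (AB (z, r)); split=> //=; exact: nbhs_singleton.
Qed.

Lemma harmonic_near_null_lap4 f z : harmonic_on (@upper_half_plane R) f -> 0 < z.2 ->
  near_null_lap4 f z.
Proof.
move=> hf z0 e e0; have [oH /(_ z z0)[_ _ _ [cxx _ _ cyy] lap0]] := hf.
have tf : \forall z' \near z, twice_derivable f z'.
  have : \forall z' \near z, 0 < z'.2 by exact: (open_nbhs_nbhs (conj oH z0)).
  by apply: (@filterS _ _ (nbhs_filter z)) => z'; exact: harmonic_twice_derivable.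
apply: filterS (near_lap4_laplacian e0 tf cxx cyy) => -[z' r] /=.
by rewrite lap0 mul0r subr0.
Qed.

End SecondDifferences.

Section SlidingIntegral.
Context {R : realType}.
Local Notation mu := (@lebesgue_measure R).
Implicit Types (a b c h t x : R) (g G : R -> R).

Lemma continuous_integrable_itv g a b : continuous g -> mu.-integrable `[a, b] (EFin \o g).
Proof.
move=> cg; apply: continuous_compact_integrable; first exact: segment_compact.
exact: continuous_subspaceT.
Qed.

Lemma Rintegral_cst_itv a b c : a <= b -> \int[mu]_(t in `[a, b]) c = c * (b - a).
Proof.
move=> ab; rewrite Rintegral_cst//= lebesgue_measure_itv/= lte_fin.
by case: ltgtP ab => // -> _; rewrite subrr.
Qed.

Lemma ler_normr_Rintegral_itv g a b c : a <= b -> mu.-integrable `[a, b] (EFin \o g) ->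
  (forall t, a <= t <= b -> `|g t| <= c) -> `|\int[mu]_(t in `[a, b]) g t| <= c * (b - a).
Proof.
move=> ab ig gc; rewrite -(Rintegral_cst_itv c ab); apply: ler_normr_Rintegral => //.
  by apply/measurable_EFinP; exact: measurable_int ig.
by apply: (@continuous_integrable_itv (cst c)); exact: cst_continuous.
Qed.

Lemma is_derive_FTC2 g G a b : a < b -> continuous g ->
  (forall t, a <= t <= b -> is_derive t 1 G (g t)) -> \int[mu]_(t in `[a, b]) g t = G b - G a.
Proof.
move=> ab cg dG; have cG t : a <= t <= b -> {for t, continuous G}.
  move=> tab; apply: differentiable_continuous.
  by apply/derivable1_diffP; have [] := dG t tab.
rewrite /Rintegral (@continuous_FTC2 _ g G)//; first exact: continuous_subspaceT.
  split.
  - by move=> t; rewrite in_itv/= => /andP[t1 t2]; have [] := dG t; rewrite ?(ltW t1) ?(ltW t2).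
  - by apply: cvg_at_right_filter; apply: cG; rewrite lexx ltW.
  - by apply: cvg_at_left_filter; apply: cG; rewrite lexx ltW.
move=> t; rewrite in_itv/= => /andP[t1 t2]; rewrite derive1E.
by have [] := dG t; rewrite ?(ltW t1) ?(ltW t2).
Qed.

Lemma is_derive_integral g c t : continuous g -> c < t ->
  is_derive t 1 (fun t => \int[mu]_(u in `[c, t]) g u) (g t).
Proof.
move=> cg ct; have tt : t < t + 1 by rewrite ltrDl.
have [d1 d2] := @continuous_FTC1_closed R g c t (t + 1) tt
  (continuous_integrable_itv c (t + 1) cg) ct (cg t).
by split; [exact: d1|rewrite -derive1E; exact: d2].
Qed.

Lemma continuous_translate g x : continuous g -> continuous (fun t => g (x + t)).
Proof.
move=> cg t; apply: (@continuous_comp _ _ _ (fun t => x + t) g); last exact: cg.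
by apply: cvgD; [exact: cvg_cst|exact: cvg_id].
Qed.

Lemma Rintegral_translate g c x h : continuous g -> c < x -> 0 < h ->
  \int[mu]_(t in `[0, h]) g (x + t) =
  \int[mu]_(u in `[c, x + h]) g u - \int[mu]_(u in `[c, x]) g u.
Proof.
move=> cg cx h0; pose G t := \int[mu]_(u in `[c, t]) g u.
have := @is_derive_FTC2 (fun t => g (x + t)) (fun t => G (x + t)) 0 h h0.
rewrite addr0; apply; first exact: continuous_translate.
by move=> t /andP[t0 th]; apply: is_derive_shift; apply: is_derive_integral => //; lra.
Qed.

Lemma Rintegral_translate_itv g x h : continuous g -> 0 < h ->
  \int[mu]_(t in `[0, h]) g (x + t) = \int[mu]_(u in `[x, x + h]) g u.
Proof.
move=> cg h0; have x1 : x - 1 < x by lra.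
rewrite (Rintegral_translate cg x1 h0).
apply/esym; apply: (@is_derive_FTC2 _ (fun t => \int[mu]_(u in `[x - 1, t]) g u)) => //.
  by rewrite ltrDl.
by move=> t /andP[t0 th]; apply: is_derive_integral => //; lra.
Qed.

Lemma is_derive_Rintegral_translate g x h : continuous g -> 0 < h ->
  is_derive x 1 (fun x => \int[mu]_(t in `[0, h]) g (x + t)) (g (x + h) - g x).
Proof.
move=> cg h0; pose G t := \int[mu]_(u in `[x - 1, t]) g u.
have dG t : x - 1 < t -> is_derive t 1 G (g t) by exact: is_derive_integral.
have dGh : is_derive x 1 (fun t => G (t + h)) (g (x + h)).
  have : is_derive (h + x) 1 G (g (h + x)) by apply: dG; lra.
  by move=> /is_derive_shift; rewrite addrC; under eq_fun do rewrite addrC.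
have x1 : x - 1 < x by lra.
apply: near_eq_is_derive (is_deriveB dGh (dG x x1)) => //.
exists 1 => //= t; rewrite /ball_/= ltr_norml => /andP[t1 t2].
by rewrite (@Rintegral_translate g (x - 1))//; lra.
Qed.

Lemma is_derive_le_lipschitz g x l K d : is_derive x 1 g l -> 0 < d ->
  (forall t, `|t| <= d -> `|g (x + t) - g x| <= K * `|t|) -> `|l| <= K.
Proof.
move=> [dg lE] d0 gK.
have c : h^-1 *: ((g \o shift x) (h *: 1) - g x) @[h --> 0^'] --> l by rewrite -lE; exact: dg.
apply: (ler_cvg_to (cvg_norm c) (cvg_cst K)); near=> h.
have h0 : h != 0 by near: h; exact: nbhs_dnbhs_neq.
have hd : `|h| <= d by near: h; apply: dnbhs0_le.
rewrite /GRing.scale/= mulr1 (addrC h) normrM normfV mulrC ler_pdivrMr ?normr_gt0//.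
exact: gK.
Unshelve. all: by end_near. Qed.

End SlidingIntegral.

Section HorizontalIntegral.
Context {R : realType}.
Local Notation mu := (@lebesgue_measure R).
Implicit Types (x y e : R) (z : R * R).
Variables (f : R * R -> R) (h : R).
Hypothesis cf : forall z, 0 < z.2 -> {for z, continuous f}.
Hypothesis h0 : 0 < h.

Definition horiz_int z := \int[mu]_(a in `[0, h]) f (z.1 + a, z.2).

Lemma continuous_slice y : 0 < y -> continuous (fun t => f (t, y)).
Proof.
move=> y0 x; apply: (@continuous_comp _ _ _ (fun t => (t, y)) f); last exact: cf.
by apply: continuous_pair => //; exact: cst_continuous.
Qed.

Lemma integrable_horiz_int z : 0 < z.2 ->
  mu.-integrable `[0, h] (EFin \o (fun a => f (z.1 + a, z.2))).
Proof.
move=> z0; apply: continuous_integrable_itv.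
exact: (@continuous_translate _ (fun t => f (t, z.2))) (continuous_slice z0).
Qed.

Lemma horiz_int_translate z : 0 < z.2 -> horiz_int z = \int[mu]_(t in `[z.1, z.1 + h]) f (t, z.2).
Proof.
move=> z0; apply: (@Rintegral_translate_itv _ (fun t => f (t, z.2))) h0.
exact: continuous_slice.
Qed.

Lemma is_derive_horiz_int x y : 0 < y ->
  is_derive x 1 (fun x => horiz_int (x, y)) (f (x + h, y) - f (x, y)).
Proof.
move=> y0; apply: (@is_derive_Rintegral_translate _ (fun t => f (t, y))) => //.
exact: continuous_slice.
Qed.

Lemma near_translate_segment z e : 0 < z.2 -> 0 < e -> \forall z' \near z, forall a, 0 <= a <= h ->
  `|f (z'.1 + a, z'.2) - f (z.1 + a, z.2)| <= e.
Proof.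
move=> z0 e0; apply: (near_segment (FF := nbhs_filter z)) => a _.
pose F (w : R * (R * R)) := f (w.2.1 + w.1, w.2.2) - f (z.1 + w.1, z.2).
have cF : {for (a, z), continuous F}.
  apply: cvgB; (apply: (@continuous_comp _ _ _ _ f); last exact: cf); apply: continuous_pair.
  - apply: cvgD; last exact: cvg_fst.
    by apply: (@continuous_comp _ _ _ snd fst); [exact: cvg_snd|exact: cvg_fst].
  - by apply: (@continuous_comp _ _ _ snd snd); exact: cvg_snd.
  - by apply: cvgD; [exact: cvg_cst|exact: cvg_fst].
  - exact: cst_continuous.
have /cvgrPdist_le/(_ e e0) := cF; rewrite /F/= subrr.
by apply: filterS => w; rewrite sub0r normrN.
Qed.

Lemma horiz_int_continuous z : 0 < z.2 -> {for z, continuous horiz_int}.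
Proof.
move=> z0; apply/cvgrPdist_le => /= e e0; have eh : 0 < e / h by rewrite divr_gt0.
have zP : \forall z' \near z, 0 < z'.2 by exact: (cvg_snd (lt_nbhsr z0)).
apply: filterS2 zP (near_translate_segment z0 eh) => z' z'0 z'P.
rewrite distrC /horiz_int -RintegralB//; [|exact: integrable_horiz_int|exact: integrable_horiz_int].
have -> : e = e / h * (h - 0) by field; rewrite gt_eqF.
apply: ler_normr_Rintegral_itv => //; first exact: ltW.
by apply: integrable_subr => //; exact: integrable_horiz_int.
Qed.

Hypothesis nf : forall z, 0 < z.2 -> near_null_lap4 f z.

Lemma near_lap4_segment z e : 0 < z.2 -> 0 < e -> \forall r \near 0^'+, forall a, 0 <= a <= h ->
  `|lap4 f (z.1 + a, z.2) r| <= e * r ^+ 2.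
Proof.
move=> z0 e0; apply: near_segment => a _.
have [[A B] /= [Aa B0] AB] := @nf (z.1 + a, z.2) z0 e e0.
have cA : {for a, continuous (fun a => (z.1 + a, z.2))}.
  by apply: continuous_pair; [apply: cvgD; [exact: cvg_cst|exact: cvg_id]|exact: cst_continuous].
exists ((fun a => (z.1 + a, z.2)) @^-1` A, B) => [/=|[a' r] /= [Aa' Br]].
  by split => //; exact: cA.
exact: (AB ((z.1 + a', z.2), r)).
Qed.

Lemma horiz_int_null_lap4 z : 0 < z.2 -> null_lap4 horiz_int z.
Proof.
move=> z0 e e0; have eh : 0 < e / h by rewrite divr_gt0.
have iF (w : R * R) (w0 : 0 < w.2) := integrable_horiz_int w0.
have rz : \forall r \near 0^'+, 0 < r < z.2.
  by near=> r; apply/andP; split => //; near: r; exact: nbhs_right_lt.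
apply: filterS2 rz (near_lap4_segment z0 eh) => r rz rP.
have [//|iL ->] := lap4_Rintegral _ iF rz.
have -> : e * r ^+ 2 = e / h * r ^+ 2 * (h - 0) by field; rewrite gt_eqF.
apply: ler_normr_Rintegral_itv => [||a ah]; [exact: ltW|exact: iL|].
apply: le_trans (rP a ah).
by rewrite /lap4/= (addrAC z.1) (addrAC z.1 (- r)).
Unshelve. all: by end_near. Qed.

End HorizontalIntegral.

Section InteriorBound.
Context {R : realType}.
Local Notation mu := (@lebesgue_measure R).
Implicit Types (x y h s : R) (z : R * R).
Variables (f : R * R -> R) (M : R).
Hypothesis hf : harmonic_on (@upper_half_plane R) f.
Hypothesis fM : forall x y, 0 < y -> \int[mu]_(t in `[x, x + 1]) `|f (t, y)| <= M.

Let cf z : 0 < z.2 -> {for z, continuous f}. Proof. exact: harmonic_continuous. Qed.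

Let M0 : 0 <= M.
Proof. by apply: le_trans (fM 0 ltr01); exact: Rintegral_ge0. Qed.

Lemma normr_horiz_int_le h z : 0 < h <= 1 -> 0 < z.2 -> `|horiz_int f h z| <= M.
Proof.
move=> /andP[h0 h1] z0; rewrite horiz_int_translate//; apply: le_trans (fM z.1 z0).
have ci a b := continuous_integrable_itv a b (continuous_slice cf z0).
apply: (le_trans (le_normr_Rintegral _ (ci _ _))) => //.
apply: le_Rintegral_subset => //; last by apply: integrable_normr.
by apply: subset_itvl; rewrite bnd_simp lerD2l.
Qed.

(* The difference is the [x]-derivative of [horiz_int f h], which is Lipschitz as
   the Poisson extension of a bounded function. *)
Lemma harmonic_increment_le s x y h : 0 < s -> s <= y -> 0 < h <= 1 ->
  `|f (x + h, s + y) - f (x, s + y)| <= 4 / s * M.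
Proof.
move=> s0 sy h01; have /andP[h0 h1] := h01; have y0 := lt_le_trans s0 sy.
have sy0 : 0 < s + y by exact: addr_gt0.
have rep x' : horiz_int f h (x', s + y) = poisson_ext (fun t => horiz_int f h (t, s)) (x', y).
  apply: (@translated_poisson_ext _ _ s M s0 _ _ _ (x', y) y0) => z.
  - exact: horiz_int_continuous.
  - by move=> sz; apply: normr_horiz_int_le => //; exact: lt_le_trans sz.
  - by apply: horiz_int_null_lap4 => // w w0; exact: harmonic_near_null_lap4.
have hM t : `|horiz_int f h (t, s)| <= M by exact: normr_horiz_int_le.
have ch : continuous (fun t => horiz_int f h (t, s)).
  by apply: (@continuous_slice _ (horiz_int f h) _ s s0) => z; exact: horiz_int_continuous.
have ih := poisson_integrable_bounded (continuous_measurable_fun ch) hM.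
have hd := is_derive_horiz_int cf h0 x sy0; have s20 : 0 < s / 2 by rewrite divr_gt0.
apply: (is_derive_le_lipschitz hd s20) => t ts; rewrite !rep.
have := @poisson_ext_lipschitz _ _ (x, y) (x + t, y) y0 ih.
rewrite /= subrr normr0 addr0 addrAC subrr add0r => /(_ _)/(_ _)/le_trans; apply.
- by rewrite (le_trans ts)// ler_pM2r.
- by rewrite divr_ge0// ltW.
have nhM : poisson_ext (fun t => `|horiz_int f h (t, s)|) (x, y) <= M.
  apply: le_trans (ler_norm _) (normr_poisson_ext_le _ _ _) => [//||u]; last by rewrite normr_id.
  by apply: measurableT_comp => //; exact: ih.1.
rewrite mulrAC ler_wpM2r//; apply: ler_pM => //.
- by rewrite divr_ge0// ltW.
- by apply: poisson_ext_ge0.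
- by rewrite ler_pM2l// lef_pV2 ?posrE.
Qed.

Lemma unit_segment_small_value x y : 0 < y -> exists2 a, 0 <= a <= 1 & `|f (x + a, y)| <= M + 1.
Proof.
move=> y0; apply: contrapT => no_small.
have f_ge t : x <= t <= x + 1 -> M + 1 <= `|f (t, y)|.
  move=> /andP[t0 t1]; rewrite leNgt; apply/negP => ft; apply: no_small.
  by exists (t - x); [apply/andP; split; lra|rewrite addrC subrK ltW].
have : M + 1 <= M; last by rewrite gerDl ler10.
apply: le_trans (fM x y0).
have -> : M + 1 = \int[mu]_(t in `[x, x + 1]) (M + 1).
  by rewrite Rintegral_cst_itv ?lerDl// addrAC subrr add0r mulr1.
apply: le_Rintegral => //.
- by apply: (@continuous_integrable_itv _ (cst (M + 1))); exact: cst_continuous.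
- by apply: integrable_normr => //; apply: continuous_integrable_itv; exact: continuous_slice.
Qed.

Lemma harmonic_bounded s : 0 < s -> exists B, forall z, s <= z.2 -> `|f z| <= B.
Proof.
move=> s0; have s20 : 0 < s / 2 by rewrite divr_gt0.
exists (M + 1 + 4 / (s / 2) * M) => -[x y] /= sy; have y0 := lt_le_trans s0 sy.
have [a /andP[a0 a1] fa] := unit_segment_small_value x y0.
have c0 : 0 <= 4 / (s / 2) * M by rewrite mulr_ge0// divr_ge0// ltW.
move: a0; rewrite le_eqVlt => /predU1P[a0|a0]; first by move: fa; rewrite -a0 addr0; lra.
have := @harmonic_increment_le (s / 2) x (y - s / 2) a s20; rewrite subrKC a0 a1 => /(_ _ isT).
have -> : s / 2 <= y - s / 2 by lra.
move=> /(_ isT) inc; rewrite -(subKr (f (x + a, y)) (f (x, y))).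
exact: le_trans (ler_normB _ _) (lerD fa inc).
Qed.

Lemma harmonic_poisson_ext s z : 0 < s -> 0 < z.2 ->
  f (z.1, s + z.2) = poisson_ext (fun t => f (t, s)) z.
Proof.
move=> s0 z0; have [B fB] := harmonic_bounded s0.
apply: (translated_poisson_ext s0 cf fB) => // w w0.
by apply: near_null_lap4_null; exact: harmonic_near_null_lap4.
Qed.

End InteriorBound.

(** * Weak compactness of equi-integrable families *)

Section UltrafilterLimits.
Context {R : realType} (I : Type) (F : set_system I).
Hypothesis UF : UltraFilter F.
Implicit Types (h : I -> R) (l N : R).

Lemma ultra_cvg_bounded h N : (forall i, `|h i| <= N) -> exists l : R, h @ F --> l.
Proof.
move=> hN; have PF : ProperFilter F by exact: ultra_proper.
have [l [_ cl]] : `[- N, N]%classic `&` cluster (h @ F) !=set0.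
  by apply: segment_compact; apply: nearW => i; rewrite /= in_itv/= -ler_norml.
exists l => V lV; have [//|FV] := in_ultra_setVsetC (h @^-1` V) UF.
by have [z [/=]] := cl (~` V) V FV lV.
Qed.

Lemma ultra_cvg_normr_le h l N : h @ F --> l -> (forall i, `|h i| <= N) -> `|l| <= N.
Proof.
move=> hl hN; have PF : ProperFilter F by exact: ultra_proper.
apply: (closed_cvg (fun x : R => x <= N)) (cvg_norm hl); first exact: closed_le.
exact: nearW.
Qed.

End UltrafilterLimits.

Section ChargeDensity.
Context d (T : measurableType d) (R : realType) (mu : {sigma_finite_measure set T -> \bar R}).
Implicit Types (nu : set T -> R) (v : T -> R).

Lemma real_charge_density nu : nu set0 = 0 -> semi_sigma_additive (EFin \o nu) ->
  (forall A, measurable A -> mu A = 0%E -> nu A = 0) ->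
  exists2 v, mu.-integrable setT (EFin \o v) &
    forall A, measurable A -> nu A = \int[mu]_(t in A) v t.
Proof.
move=> nu0 nu_sigma nu_dom.
pose nuC : {charge set T -> \bar R} := HB.pack (EFin \o nu)
  (isCharge.Build _ T R (EFin \o nu) (congr1 EFin nu0) (fun _ _ => isT) nu_sigma).
have dom : nuC `<< mu.
  by apply/null_content_dominatesP => A mA muA; rewrite /nuC/= nu_dom.
have fineE t : (fine (Radon_Nikodym nuC mu t))%:E = Radon_Nikodym nuC mu t.
  by rewrite fineK// Radon_Nikodym_fin_num.
exists (fine \o Radon_Nikodym nuC mu) => [|A mA].
  apply: eq_integrable (Radon_Nikodym_integrable dom) => //.
  by move=> t _ /=; rewrite fineE.
rewrite -[LHS]/(fine (nuC A)) (Radon_Nikodym_integral dom mA); congr fine.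
by apply: eq_integral => t _ /=; rewrite fineE.
Qed.

End ChargeDensity.

Section FinitelyAdditive.
Context d (T : measurableType d) (R : realType).
Variable nu : set T -> R.
Hypothesis nuU : forall A B, measurable A -> measurable B -> [disjoint A & B] ->
  nu (A `|` B) = nu A + nu B.

Lemma additive_set0 : nu set0 = 0.
Proof.
have dis0 : [disjoint (set0 : set T) & set0] by apply/disj_setPS; rewrite setI0.
have := nuU measurable0 measurable0 dis0; rewrite setU0 => /esym/eqP.
by rewrite -subr_eq0 addrK => /eqP.
Qed.

Lemma additive_bigsetU (G : nat -> set T) n : (forall k, measurable (G k)) -> trivIset setT G ->
  nu (\big[setU/set0]_(k < n) G k) = \sum_(k < n) nu (G k).
Proof.
move=> mG tG; elim: n => [|n IH]; first by rewrite !big_ord0 additive_set0.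
rewrite !big_ord_recr/= nuU ?IH//; first exact: bigsetU_measurable.
apply/disj_setPS => t []; rewrite -bigcup_mkord => -[i /= ni Git] Gnt.
by have iE := tG i n I I (ex_intro _ t (conj Git Gnt)); rewrite iE ltnn in ni.
Qed.

End FinitelyAdditive.

Section EquiIntegrable.
Context d (T : measurableType d) (R : realType) (mu : {measure set T -> \bar R}).
Variable w : T -> R.
Hypothesis iw : mu.-integrable setT (EFin \o w).
Hypothesis w0 : forall t, 0 <= w t.

Definition equi_integrable (I : Type) (g : I -> T -> R) := forall e : R, 0 < e ->
  exists2 K : R, 0 <= K & forall i A, measurable A ->
    \int[mu]_(t in A) `|g i t| <= K * \int[mu]_(t in A) w t + e.

Lemma Rintegral_setU_integrable (f : T -> R) A B : mu.-integrable setT (EFin \o f) ->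
  measurable A -> measurable B -> [disjoint A & B] ->
  \int[mu]_(t in A `|` B) f t = \int[mu]_(t in A) f t + \int[mu]_(t in B) f t.
Proof.
move=> fi mA mB AB; apply: Rintegral_setU => //.
by apply: integrable_restr => //; exact: measurableU.
Qed.

Lemma cvg_Rintegral_tail (G : nat -> set T) : (forall k, measurable (G k)) -> trivIset setT G ->
  \int[mu]_(t in \bigcup_k G k `\` \big[setU/set0]_(k < n) G k) w t @[n --> \oo] --> 0.
Proof.
move=> mG tG; have mUG : measurable (\bigcup_k G k) by exact: bigcupT_measurable.
have tailE n : \int[mu]_(t in \bigcup_k G k `\` \big[setU/set0]_(k < n) G k) w t =
    \int[mu]_(t in \bigcup_k G k) w t - \sum_(0 <= k < n) \int[mu]_(t in G k) w t.
  have mU : measurable (\big[setU/set0]_(k < n) G k) by exact: bigsetU_measurable.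
  rewrite big_mkord -(additive_bigsetU (nu := fun A => \int[mu]_(t in A) w t)) //.
    have dis : [disjoint \big[setU/set0]_(k < n) G k
        & \bigcup_k G k `\` \big[setU/set0]_(k < n) G k] by apply/disj_setPS => t [Ut []].
    have := Rintegral_setU_integrable iw mU (measurableD mUG mU) dis.
    by rewrite setDUK; [move=> ->; rewrite addrAC subrr add0r|exact: bigsetU_bigcup].
  by move=> A B; exact: Rintegral_setU_integrable.
rewrite (funext tailE) -[X in _ --> X](subrr (\int[mu]_(t in \bigcup_k G k) w t)).
apply: cvgB; first exact: cvg_cst.
have wE A : measurable A -> (\int[mu]_(t in A) (w t)%:E)%E = (\int[mu]_(t in A) w t)%:E.
  by move=> mA; rewrite EFin_Rintegral//; exact: integrable_restr.
have : (\sum_(0 <= k < n) \int[mu]_(t in G k) (w t)%:E)%E @[n --> \oo] -->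
    (\int[mu]_(t in \bigcup_k G k) (w t)%:E)%E.
  exact: (@charge_semi_sigma_additive _ _ _ (induced_charge iw) G mG tG mUG).
rewrite wE// => /fine_cvg; apply: cvg_trans; apply: near_eq_cvg; apply: nearW => n /=.
by rewrite (eq_bigr _ (fun k _ => wE _ (mG k))) sumEFin.
Qed.

Lemma equi_semi_sigma_additive (nu : set T -> R) :
  (forall A B, measurable A -> measurable B -> [disjoint A & B] -> nu (A `|` B) = nu A + nu B) ->
  (forall e : R, 0 < e -> exists2 K : R, 0 <= K &
    forall A, measurable A -> `|nu A| <= K * \int[mu]_(t in A) w t + e) ->
  semi_sigma_additive (EFin \o nu).
Proof.
move=> nuU nuw G mG tG mUG.
pose tail n := \bigcup_k G k `\` \big[setU/set0]_(k < n) G k.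
have mU n : measurable (\big[setU/set0]_(k < n) G k) by exact: bigsetU_measurable.
have mtail n : measurable (tail n) by exact: measurableD.
have nuE n : (\sum_(0 <= k < n) (EFin \o nu) (G k))%E = (nu (\bigcup_k G k) - nu (tail n))%:E.
  have dis : [disjoint \big[setU/set0]_(k < n) G k & tail n] by apply/disj_setPS => t [Ut []].
  rewrite big_mkord /= sumEFin -(additive_bigsetU nuU n mG tG); congr EFin.
  have := nuU _ _ (mU n) (mtail n) dis; rewrite setDUK; last exact: bigsetU_bigcup.
  by move=> ->; rewrite addrK.
rewrite (funext nuE); apply: cvg_EFin; first exact: nearW.
rewrite /= -[X in _ --> X]subr0; apply: cvgB; first exact: cvg_cst.
apply/cvgr0Pnorm_le => /= e e0; have e20 : 0 < e / 2 by rewrite divr_gt0.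
have [K K0 nuK] := nuw _ e20.
have eK : 0 < e / 2 / (K + 1) by rewrite divr_gt0// ltr_wpDl.
have /cvgr0Pnorm_le/(_ _ eK) := cvg_Rintegral_tail mG tG; apply: filterS => n.
rewrite -/(tail n) ger0_norm ?Rintegral_ge0// ler_pdivlMr ?ltr_wpDl// => wn.
apply: le_trans (nuK _ (mtail n)) _; rewrite [leRHS]splitr lerD2r.
by apply: le_trans wn; rewrite mulrC ler_wpM2l ?Rintegral_ge0// lerDl.
Qed.

End EquiIntegrable.

Section BoundedApproximation.
Context d (T : measurableType d) (R : realType).
Implicit Types (s e B : R).

Lemma staircase_approx s e n : 0 <= s < e * n.+1%:R ->
  `|s - \sum_(k < n) e * (e * k.+1%:R <= s)%R%:R| <= e.
Proof.
move=> /andP[s0]; elim: n => [|n IH] sn.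
  by rewrite big_ord0 subr0 ger0_norm// -[leRHS]mulr1 ltW.
have [ens|sen] := leP (e * n.+1%:R) s; last first.
  by rewrite big_ord_recr/= (lt_geF sen) mulr0 addr0 IH.
have e0 : 0 < e by move: (le_lt_trans ens sn); rewrite -subr_gt0 -mulrBr -natrB// subSnn mulr1.
have steps k : (k < n.+1)%N -> e * (e * k.+1%:R <= s)%R%:R = e.
  by move=> kn; rewrite (le_trans _ ens) ?mulr1// ler_pM2l// ler_nat.
have -> : \sum_(k < n.+1) e * (e * k.+1%:R <= s)%R%:R = e * n.+1%:R.
  rewrite (eq_bigr (fun=> e)) => [|k _]; last exact: steps.
  by rewrite sumr_const card_ord mulr_natr.
rewrite ger0_norm ?subr_ge0// lerBlDl -[X in _ + X]mulr1 -mulrDr -natr1 addrC.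
by rewrite natr1 nat1r ltW.
Qed.

Lemma bounded_simple_approx (phi : T -> R) B e : measurable_fun setT phi ->
  (forall t, `|phi t| <= B) -> 0 < e -> exists n (c : nat -> R) (A : nat -> set T),
  (forall k, measurable (A k)) /\
  forall t, `|phi t - \sum_(k < n) c k * \1_(A k) t| <= e.
Proof.
move=> mphi phiB e0; pose n := Num.truncn (2 * B / e).
exists n.+1, (fun k => if k == 0%N then - B else e), (fun k => [set t | e * k%:R <= phi t + B]).
split => [k|t].
  rewrite -[X in measurable X]setTI.
  apply: (measurable_fun_le (f := cst (e * k%:R)) (g := fun t => phi t + B)) => //.
  exact: measurable_funD.
have /andP[phi1 phi2] : - B <= phi t <= B by rewrite -ler_norml.
have s0 : 0 <= phi t + B by lra.
have sn : phi t + B < e * n.+1%:R.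
  rewrite mulrC -ltr_pdivrMr//; apply: le_lt_trans (truncnS_gt _).
  by rewrite ler_pM2r ?invr_gt0//; lra.
rewrite big_ord_recl/= indicE mem_set/= ?mulr0// mulr1 opprD opprK addrA.
have indicE' k : \1_[set t | e * k%:R <= phi t + B] t = (e * k%:R <= phi t + B)%R%:R :> R.
  by rewrite indicE; congr (nat_of_bool _)%:R; apply/idP/idP; rewrite inE.
rewrite (eq_bigr (fun k : 'I_n => e * (e * k.+1%:R <= phi t + B)%R%:R)) => [|k _].
  by apply: staircase_approx; rewrite s0.
by rewrite /bump/= add1n indicE'.
Qed.

End BoundedApproximation.

Section BoundedMultiplier.
Context d (T : measurableType d) (R : realType) (mu : {measure set T -> \bar R}).
Implicit Types (phi psi f v : T -> R) (B e N : R).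

Lemma integrable_boundedM phi B f : measurable_fun setT phi -> (forall t, `|phi t| <= B) ->
  mu.-integrable setT (EFin \o f) -> mu.-integrable setT (EFin \o (fun t => phi t * f t)).
Proof.
move=> mphi phiB fi; have iBf := integrable_mulrl measurableT B (integrable_normr measurableT fi).
apply: (integrable_dominated measurableT _ iBf) => [|t _]; last by rewrite normrM ler_wpM2r.
by apply: measurable_funM => //; exact: measurable_fun_integrable fi.
Qed.

Lemma normr_Rintegral_boundedM phi B f : measurable_fun setT phi ->
  (forall t, `|phi t| <= B) -> mu.-integrable setT (EFin \o f) ->
  `|\int[mu]_t (phi t * f t)| <= B * \int[mu]_t `|f t|.
Proof.
move=> mphi phiB fi; have i1 := integrable_normr measurableT fi.
rewrite -(RintegralZl _ measurableT i1).
apply: ler_normr_Rintegral; [exact: measurableT| |exact: integrable_mulrl|] => [|t _].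
  by apply: measurable_funM => //; exact: measurable_fun_integrable fi.
by rewrite normrM ler_wpM2r.
Qed.

Lemma integrable_simpleM n (c : nat -> R) (A : nat -> set T) f :
  (forall k, measurable (A k)) -> (forall k, mu.-integrable (A k) (EFin \o f)) ->
  mu.-integrable setT (EFin \o (fun t => (\sum_(k < n) c k * \1_(A k) t) * f t)) /\
  \int[mu]_t ((\sum_(k < n) c k * \1_(A k) t) * f t) =
    \sum_(k < n) c k * \int[mu]_(t in A k) f t.
Proof.
move=> mA fi; elim: n => [|n [IHi IHE]].
  under eq_fun do rewrite big_ord0 mul0r.
  by rewrite big_ord0 Rintegral_cst// mul0r; split=> //; exact: integrable0.
have i1 := integrable_indicM (mA n) (fi n).
under eq_fun do rewrite big_ord_recr/= mulrDl -mulrA.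
have ic := integrable_mulrl measurableT (c n) i1.
rewrite big_ord_recr/= RintegralD// IHE (RintegralZl _ measurableT i1) Rintegral_indicM.
by split=> //; exact: integrable_addr.
Qed.

Lemma Rintegral_simple_approx phi B e n (c : nat -> R) (A : nat -> set T) f :
  measurable_fun setT phi -> (forall t, `|phi t| <= B) -> (forall k, measurable (A k)) ->
  (forall t, `|phi t - \sum_(k < n) c k * \1_(A k) t| <= e) -> mu.-integrable setT (EFin \o f) ->
  `|\int[mu]_t (phi t * f t) - \sum_(k < n) c k * \int[mu]_(t in A k) f t| <=
    e * \int[mu]_t `|f t|.
Proof.
move=> mphi phiB mA phie fi.
have [si sE] := integrable_simpleM n c mA (fun k => integrable_restr (mA k) fi).
rewrite -sE -RintegralB//; last exact: integrable_boundedM phiB fi.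
under eq_Rintegral do rewrite -mulrBl.
apply: normr_Rintegral_boundedM => //; apply: measurable_funB => //.
apply: (measurable_sum _ (h := fun (k : 'I_n) t => c k * \1_(A k) t)) => k.
by apply: measurable_funM => //; exact: measurable_indic.
Qed.

Lemma weak_cvg_bounded (I : Type) (F : set_system I) (FF : Filter F) (g : I -> T -> R) v N :
  (forall i, mu.-integrable setT (EFin \o g i)) -> mu.-integrable setT (EFin \o v) ->
  (forall i, \int[mu]_t `|g i t| <= N) ->
  (forall A, measurable A -> \int[mu]_(t in A) g i t @[i --> F] --> \int[mu]_(t in A) v t) ->
  forall phi B, measurable_fun setT phi -> (forall t, `|phi t| <= B) ->
  \int[mu]_t (phi t * g i t) @[i --> F] --> \int[mu]_t (phi t * v t).
Proof.
move=> ig iv gN gv phi B mphi phiB; apply/cvgrPdist_le => /= e e0.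
set V := \int[mu]_t `|v t|; have V0 : 0 <= V by exact: Rintegral_ge0.
pose c0 := e / 2 / (V + `|N| + 1).
have c0_gt0 : 0 < c0 by rewrite !divr_gt0// ltr_wpDl// addr_ge0.
have c0E : c0 * V + c0 * `|N| <= e / 2.
  by rewrite -mulrDr -ler_pdivlMl// invf_div divfK ?gt_eqF ?divr_gt0// lerDl.
have [n [c [A [mA phic]]]] := bounded_simple_approx mphi phiB c0_gt0.
pose S h := \sum_(k < n) c k * \int[mu]_(t in A k) h t.
have : S (g i) @[i --> F] --> S v.
  apply: cvg_big => [|k _]; first exact: add_continuous.
  by apply: cvgMr; exact: gv.
have e20 : 0 < e / 2 by rewrite divr_gt0.
move=> /cvgrPdist_le/(_ _ e20); apply: filterS => i simplei.
have approxv : `|_ - S v| <= _ := Rintegral_simple_approx mphi phiB mA phic iv.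
have approxg : `|_ - S (g i)| <= _ := Rintegral_simple_approx mphi phiB mA phic (ig i).
have gNi : c0 * \int[mu]_t `|g i t| <= c0 * `|N|.
  by rewrite ler_pM2l// (le_trans (gN i)) ?ler_norm.
have := ler_distD (S v) (\int[mu]_t (phi t * v t)) (\int[mu]_t (phi t * g i t)).
have := ler_distD (S (g i)) (S v) (\int[mu]_t (phi t * g i t)).
by rewrite distrC in approxg; rewrite -/V in approxv; lra.
Qed.

End BoundedMultiplier.

Section DunfordPettis.
Context d (T : measurableType d) (R : realType) (mu : {sigma_finite_measure set T -> \bar R}).
Variables (I : Type) (F : set_system I) (g : I -> T -> R) (w : T -> R).
Hypotheses (UF : UltraFilter F) (ig : forall i, mu.-integrable setT (EFin \o g i)).
Hypotheses (iw : mu.-integrable setT (EFin \o w)) (w0 : forall t, 0 <= w t).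
Hypothesis equi_g : equi_integrable mu w g.

Lemma equi_integrable_bounded : exists N, forall i A, measurable A ->
  \int[mu]_(t in A) `|g i t| <= N.
Proof.
have [K K0 gK] := equi_g ltr01; exists (K * \int[mu]_t w t + 1) => i A mA.
by apply: le_trans (gK i A mA) _; rewrite lerD2r ler_wpM2l// le_Rintegral_subset.
Qed.

Lemma normr_Rintegral_restr i A : measurable A ->
  `|\int[mu]_(t in A) g i t| <= \int[mu]_(t in A) `|g i t|.
Proof. by move=> mA; apply: le_normr_Rintegral => //; exact: integrable_restr. Qed.

Let nu (A : set T) : R := lim (\int[mu]_(t in A) g i t @[i --> F]).

Lemma cvg_ultra_Rintegral A : measurable A -> \int[mu]_(t in A) g i t @[i --> F] --> nu A.
Proof.
move=> mA; have [N gN] := equi_integrable_bounded.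
have bounded i : `|\int[mu]_(t in A) g i t| <= N.
  by apply: le_trans (normr_Rintegral_restr i mA) _; exact: gN.
by have [l cl] := ultra_cvg_bounded UF bounded; apply/cvg_ex; exists l.
Qed.

Lemma weak_limit_additive A B : measurable A -> measurable B -> [disjoint A & B] ->
  nu (A `|` B) = nu A + nu B.
Proof.
move=> mA mB AB; have PF : ProperFilter F by exact: ultra_proper.
apply: cvg_unique (cvg_ultra_Rintegral (measurableU _ _ mA mB)) _ => //.
rewrite /= (funext (fun i => Rintegral_setU_integrable (ig i) mA mB AB)).
by apply: cvgD; exact: cvg_ultra_Rintegral.
Qed.

Lemma weak_limit_le (e : R) : 0 < e -> exists2 K : R, 0 <= K &
  forall A, measurable A -> `|nu A| <= K * \int[mu]_(t in A) w t + e.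
Proof.
move=> /equi_g[K K0 gK]; exists K => // A mA.
apply: (ultra_cvg_normr_le UF (cvg_ultra_Rintegral mA)) => i.
by apply: le_trans (normr_Rintegral_restr i mA) _; exact: gK.
Qed.

Lemma weak_limit_null A : measurable A -> mu A = 0%E -> nu A = 0.
Proof.
move=> mA A0; apply/eqP; rewrite -normr_le0; apply/ler_addgt0Pr => e e0; rewrite add0r.
have [K _ nuK] := weak_limit_le e0; apply: le_trans (nuK A mA) _.
by rewrite /Rintegral null_set_integral ?mulr0 ?add0r//; apply/measurable_EFinP;
   apply: measurable_funTS; exact: measurable_fun_integrable iw.
Qed.

Lemma dunford_pettis : exists2 v : T -> R, mu.-integrable setT (EFin \o v) &
  forall (phi : T -> R) (B : R), measurable_fun setT phi -> (forall t, `|phi t| <= B) ->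
  \int[mu]_t (phi t * g i t) @[i --> F] --> \int[mu]_t (phi t * v t).
Proof.
have PF : ProperFilter F by exact: ultra_proper.
have nu_sigma := equi_semi_sigma_additive iw w0 weak_limit_additive weak_limit_le.
have nu0 := additive_set0 weak_limit_additive.
have [v iv nuE] := real_charge_density nu0 nu_sigma weak_limit_null.
have [N gN] := equi_integrable_bounded.
exists v => //; apply: (weak_cvg_bounded _ ig iv (N := N)) => [i|A mA]; first exact: gN.
by rewrite -nuE//; exact: cvg_ultra_Rintegral.
Qed.

End DunfordPettis.

(** * The modular estimate for Poisson extensions *)

Section PowerInequalities.
Context {R : realType}.
Implicit Types (a b q s x C K : R).

Lemma le_powR q a b : 0 <= q -> 0 <= a -> a <= b -> a `^ q <= b `^ q.
Proof. by move=> q0 a0 ab; apply: ge0_ler_powR => //; rewrite nnegrE// (le_trans a0). Qed.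

Lemma powR_le_self q a : 1 <= q -> 0 <= a <= 1 -> a `^ q <= a.
Proof.
move=> q1 /andP[]; rewrite le_eqVlt => /predU1P[<- _|a0 a1].
  by rewrite powR0// gt_eqF// (lt_le_trans ltr01).
by apply: ge1r_powR => //; rewrite a0.
Qed.

Lemma powRD_le q a b : 0 <= q -> 0 <= a -> 0 <= b ->
  (a + b) `^ q <= 2 `^ q * (a `^ q + b `^ q).
Proof.
move=> q0 a0 b0.
have max0 : 0 <= Num.max a b by rewrite le_max a0.
apply: (@le_trans _ _ ((2 * Num.max a b) `^ q)).
  apply: le_powR => //; first exact: addr_ge0.
  by rewrite mulrDl mul1r lerD// le_max lexx ?orbT.
rewrite powRM// ler_wpM2l ?powR_ge0//.
by have [_|_] := leP a b; rewrite ?lerDr ?lerDl powR_ge0.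
Qed.

Lemma powR1BM K q : 0 < K -> K `^ (1 - q) * K `^ q = K.
Proof.
by move=> K0; rewrite -powRD ?subrK ?powRr1 ?(ltW K0)// (gt_eqF K0) implybT.
Qed.

(* Young-type splitting at height [K], the substitute for Jensen's inequality
   when the exponent varies with the integration variable. *)
Lemma young_split q a K : 1 <= q -> 0 <= a -> 0 < K -> a <= K + K `^ (1 - q) * a `^ q.
Proof.
move=> q1 a0 K0; have [aK|Ka] := leP a K.
  by rewrite (le_trans aK)// lerDl mulr_ge0// powR_ge0.
rewrite ler_wpDl ?(ltW K0)//; have aK1 : 1 <= a / K by rewrite ler_pdivlMr// mul1r ltW.
have aE : a = K * (a / K) by rewrite mulrC divfK ?gt_eqF.
have aK0 := le_trans ler01 aK1.
rewrite {2}aE powRM ?(ltW K0)// mulrA (powR1BM q K0) {1}aE ler_pM2l//.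
exact: le1r_powR.
Qed.

Lemma powR_le_of_young_split q a b : 1 <= q -> 0 <= a -> 0 <= b ->
  (forall K, 0 < K -> a <= K + K `^ (1 - q) * b) -> a `^ q <= 2 `^ q * b.
Proof.
move=> q1 a0 b0 aK; have q0 : 0 < q by exact: lt_le_trans q1.
move: b0; rewrite le_eqVlt => /predU1P[b0|b0].
  have -> : a = 0.
    apply/eqP; rewrite eq_le a0 andbT; apply/ler_addgt0Pr => e e0.
    by have := aK e e0; rewrite -b0 mulr0 addr0 add0r.
  by rewrite powR0 ?(gt_eqF q0)// -b0 mulr0.
pose K := b `^ q^-1; have K0 : 0 < K by exact: powR_gt0.
have bE : b = K `^ q by rewrite -powRrM (mulVf (lt0r_neq0 q0)) (powRr1 (ltW b0)).
rewrite [in leRHS]bE -powRM ?(ltW K0)//; apply: le_powR => //; first exact: ltW.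
by apply: le_trans (aK K K0) _; rewrite bE powR1BM// mulrDl mul1r.
Qed.

(* This is where the decay condition at infinity is used: changing the exponent
   to its limit only costs an integrable error. *)
Lemma powR_exchange x C a q s : 1 <= q -> 1 <= s -> 0 <= a <= 1 ->
  `|q - s| <= C / ln (expR 1 + `|x|) ->
  a `^ q <= expR (2 * C) * a `^ s + (oneDsqr x)^-1.
Proof.
move=> q1 s1 /andP[a0 a1] qs; pose E := expR 1 + `|x|.
have e2 : 2 <= expR 1 :> R by rewrite (le_trans _ (expR_ge1Dx _))//; lra.
have x0 := normr_ge0 x.
have E1 : 1 < E by rewrite /E; lra.
have E0 : 0 < E by lra.
have lnE : 0 < ln E by rewrite ln_gt0.
have Ew : (E ^+ 2)^-1 <= (oneDsqr x)^-1.
  rewrite lef_pV2 ?posrE ?exprn_gt0// ?(lt_le_trans ltr01 (oneDsqr_ge1 _))//.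
  by rewrite /oneDsqr /E -(real_normK (num_real x)); nra.
have [aE|Ea] := leP a (E ^+ 2)^-1.
  rewrite (le_trans (powR_le_self q1 _)) ?a0//.
  by rewrite (le_trans aE)// (le_trans Ew)// lerDr mulr_ge0 ?expR_ge0 ?powR_ge0.
apply: ler_wpDr => //.
have a00 : 0 < a by rewrite (lt_trans _ Ea)// invr_gt0 exprn_gt0.
have an0 : a != 0 by rewrite gt_eqF.
rewrite -(subrK s q) powRD ?an0 ?implybT// ler_wpM2r ?powR_ge0//.
rewrite /powR (negbTE an0) ler_expR.
have lna : - ln a <= 2 * ln E.
  rewrite -lnV ?posrE// mulr_natl -lnXn// ler_ln ?posrE ?invr_gt0 ?exprn_gt0//.
  by rewrite -[leRHS]invrK lef_pV2 ?posrE ?invr_gt0 ?exprn_gt0// ltW.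
have lna0 : ln a <= 0 by rewrite ln_le0.
apply: (@le_trans _ _ (`|q - s| * (- ln a))).
  by rewrite mulrN -mulNr ler_wnM2r// lerNl -normrN ler_norm.
apply: (@le_trans _ _ (C / ln E * (2 * ln E))); first by apply: ler_pM => //; rewrite oppr_ge0.
by rewrite mulrCA divfK// gt_eqF.
Qed.

Lemma measurable_powR_fun d (T : measurableType d) (h q : T -> R) :
  measurable_fun setT h -> measurable_fun setT q -> (forall t, q t != 0) ->
  measurable_fun setT (fun t => h t `^ q t).
Proof.
move=> mh mq q0.
rewrite (_ : (fun t => _) = (fun t => if h t == 0 then 0 else expR (q t * ln (h t)))); last first.
  by apply/funext => t; rewrite /powR (negbTE (q0 t)).
apply: measurable_fun_ifT => //.
  apply: (measurable_fun_bool true).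
  rewrite (_ : _ @^-1` _ = h @^-1` [set 0]); first exact: mh.
  by apply/seteqP; split => t /= /eqP.
apply: measurableT_comp => //; apply: measurable_funM => //.
exact: measurableT_comp.
Qed.

End PowerInequalities.

Section WeightedMean.
Context d (T : measurableType d) (R : realType) (mu : {measure set T -> \bar R}).
Variables (P f : T -> R).
Hypothesis iP : mu.-integrable setT (EFin \o P).
Hypothesis P0 : forall t, 0 <= P t.
Hypothesis P1 : \int[mu]_t P t <= 1.
Hypothesis mf : measurable_fun setT f.
Hypothesis f0 : forall t, 0 <= f t.

Lemma weighted_mean_young_split (q : T -> R) (K : R) : (forall t, 1 <= q t) -> 0 < K ->
  mu.-integrable setT (EFin \o (fun t => P t * (K `^ (1 - q t) * f t `^ q t))) ->
  \int[mu]_t (P t * f t) <= K + \int[mu]_t (P t * (K `^ (1 - q t) * f t `^ q t)).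
Proof.
move=> q1 K0 iq; have iKP := integrable_mulrl measurableT K iP.
have split_le t : `|P t * f t| <= K * P t + P t * (K `^ (1 - q t) * f t `^ q t).
  by rewrite ger0_norm ?mulr_ge0// (mulrC K) -mulrDr ler_wpM2l// young_split.
have mPf : measurable_fun setT (fun t => P t * f t).
  by apply: measurable_funM => //; exact: measurable_fun_integrable iP.
have := ler_normr_Rintegral measurableT mPf (integrable_addr measurableT iKP iq)
  (fun t _ => split_le t).
move=> /(le_trans (ler_norm _)) mean_le; apply: le_trans mean_le _.
by rewrite RintegralD// (RintegralZl _ measurableT iP) lerD2r ler_piMr// ltW.
Qed.

Lemma weighted_mean_powR (q : R) : 1 <= q ->
  mu.-integrable setT (EFin \o (fun t => P t * f t `^ q)) ->
  (\int[mu]_t (P t * f t)) `^ q <= 2 `^ q * \int[mu]_t (P t * f t `^ q).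
Proof.
move=> q1 iq; apply: powR_le_of_young_split => //.
- by apply: Rintegral_ge0 => t _; rewrite mulr_ge0.
- by apply: Rintegral_ge0 => t _; rewrite mulr_ge0// powR_ge0.
move=> K K0; have iKq := integrable_mulrl measurableT (K `^ (1 - q)) iq.
rewrite -(RintegralZl _ measurableT iq).
under [in leRHS]eq_Rintegral do rewrite mulrCA.
apply: (weighted_mean_young_split (q := cst q)) => //.
by under eq_fun do rewrite mulrCA.
Qed.

End WeightedMean.

Section LogHolder.
Context {R : realType}.
Variables (p : R -> R) (C : R).
Implicit Types (x t y K : R).

Lemma ln_expR1D_ge1 x : 1 <= ln (expR 1 + `|x|).
Proof. by rewrite -[leLHS]expRK ler_ln ?posrE ?expR_gt0 ?ltr_pwDl ?expR_gt0// lerDl. Qed.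

Lemma log_decay_bounded (pinf : R) : 0 <= C ->
  (forall x, `|p x - pinf| <= C / ln (expR 1 + `|x|)) -> forall x, p x <= pinf + C.
Proof.
move=> C0 pdecay x; have := pdecay x; rewrite ler_norml => /andP[_].
have ln1 := ln_expR1D_ge1 x.
have : C / ln (expR 1 + `|x|) <= C by rewrite ler_pdivrMr ?ler_peMr// (lt_le_trans ltr01).
lra.
Qed.

Lemma log_decay_limit_ge (pinf a : R) : (forall x, `|p x - pinf| <= C / ln (expR 1 + `|x|)) ->
  (forall x, a <= p x) -> a <= pinf.
Proof.
move=> pdecay ap; apply/ler_addgt0Pl => e e0.
pose x := expR (C / e); have x0 : 0 < x by exact: expR_gt0.
have := pdecay x; rewrite (gtr0_norm x0) ler_norml => /andP[_].
have lnx : C / e <= ln (expR 1 + x).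
  rewrite -[leLHS]expRK ler_ln ?posrE ?expR_gt0 ?addr_gt0 ?expR_gt0//.
  by rewrite lerDr expR_ge0.
have : C / ln (expR 1 + x) <= e.
  have ln0 : 0 < ln (expR 1 + x).
    by have := ln_expR1D_ge1 x; rewrite (gtr0_norm x0); exact: lt_le_trans.
  by rewrite ler_pdivrMr// mulrC -ler_pdivrMr.
by have := ap x; lra.
Qed.

Hypothesis C0 : 0 <= C.
Hypothesis plog : forall x t, `|x - t| < 2^-1 -> `|p x - p t| <= C / ln (`|x - t|)^-1.

Lemma log_holder_le x t y : 0 < y < 1 -> `|x - t| <= Num.sqrt y / 2 ->
  `|p x - p t| <= 2 * C / ln y^-1.
Proof.
move=> /andP[y0 y1] xty; have lny : 0 < ln y^-1 by rewrite ln_gt0// invf_gt1.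
have [->|xt] := eqVneq x t.
  by rewrite subrr normr0 divr_ge0 ?mulr_ge0// ltW.
have dist0 : 0 < `|x - t| by rewrite normr_gt0 subr_eq0.
have sqrty0 : 0 < Num.sqrt y by rewrite sqrtr_gt0.
have sqrty1 : Num.sqrt y < 1 by rewrite -sqrtr1 ltr_sqrt.
have dist_lt : `|x - t| < 2^-1 by lra.
have ln_dist : ln y^-1 / 2 <= ln (`|x - t|)^-1.
  rewrite !lnV ?posrE// mulNr lerN2 -(sqr_sqrtr (ltW y0)) lnXn//.
  rewrite (_ : ln (Num.sqrt y) *+ 2 / 2 = ln (Num.sqrt y)); last by field.
  by rewrite ler_ln ?posrE//; lra.
apply: le_trans (plog dist_lt) _.
have -> : 2 * C / ln y^-1 = C / (ln y^-1 / 2) by field; rewrite gt_eqF.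
by rewrite ler_wpM2l// lef_pV2 ?posrE ?divr_gt0// (lt_le_trans _ ln_dist) ?divr_gt0.
Qed.

Lemma log_holder_powR x t y K : 0 < y < 1 -> 1 <= K <= y^-1 -> `|x - t| <= Num.sqrt y / 2 ->
  K `^ (p x - p t) <= expR (2 * C).
Proof.
move=> y01 /andP[K1 Ky] xty; have /andP[y0 y1] := y01.
have lny : 0 < ln y^-1 by rewrite ln_gt0// invf_gt1.
apply: (@le_trans _ _ (K `^ `|p x - p t|)); first by apply: ler_powR => //; exact: ler_norm.
apply: (@le_trans _ _ (y^-1 `^ `|p x - p t|)).
  by apply: le_powR => //; rewrite (le_trans ler01).
rewrite /powR gt_eqF ?invr_gt0// ler_expR.
rewrite (le_trans (ler_wpM2r (ltW lny) (log_holder_le y01 xty)))//.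
by rewrite divfK// gt_eqF.
Qed.

Lemma log_holder_continuous : continuous p.
Proof.
move=> x; apply/cvgrPdist_le => /= e e0.
pose y := expR (- (2 * C / e + 1)); have Ce : 0 <= 2 * C / e by rewrite divr_ge0 ?mulr_ge0// ltW.
have y01 : 0 < y < 1 by rewrite expR_gt0 expR_lt1; lra.
have /andP[y0 _] := y01; have sqrty0 : 0 < Num.sqrt y / 2 by rewrite divr_gt0 ?sqrtr_gt0.
near=> t; have xt : `|x - t| <= Num.sqrt y / 2 by near: t; exact: (@cvgr_dist_le _ R^o _ _ _ id x).
apply: le_trans (log_holder_le y01 xt) _.
have -> : ln y^-1 = 2 * C / e + 1 by rewrite -expRN expRK opprK.
have den : 0 < 2 * C / e + 1 by rewrite ltr_wpDl.
by rewrite ler_pdivrMr// mulrDr mulrCA divff ?gt_eqF// !mulr1 lerDl ltW.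
Unshelve. all: by end_near. Qed.

End LogHolder.

Section LargeSmallParts.
Context {R : realType}.
Implicit Types (f : R -> R) (t : R).

Definition large_part f t := if 1 < f t then f t else 0.
Definition small_part f t := if 1 < f t then 0 else f t.

Lemma large_small_partE f t : f t = large_part f t + small_part f t.
Proof. by rewrite /large_part /small_part; case: ifP; rewrite ?addr0 ?add0r. Qed.

Lemma measurable_large_small_part f : measurable_fun setT f ->
  measurable_fun setT (large_part f) /\ measurable_fun setT (small_part f).
Proof.
move=> mf; have mlt : measurable_fun setT (fun t => 1 < f t).
  exact: (measurable_fun_ltr (f := cst 1)).
by split; exact: measurable_fun_ifT.
Qed.

Lemma large_part_ge0 f t : 0 <= f t -> 0 <= large_part f t.
Proof. by rewrite /large_part; case: ifP. Qed.

Lemma small_part_itv f t : 0 <= f t -> 0 <= small_part f t <= 1.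
Proof. by move=> f0; rewrite /small_part; case: ltP => [_|->]; rewrite ?lexx ?ler01 ?f0. Qed.

Lemma large_part_le_powR f t (q : R) : 1 <= q -> large_part f t <= large_part f t `^ q.
Proof.
rewrite /large_part; case: ifP => [/ltW ft1|_] q1; last exact: powR_ge0.
exact: le1r_powR.
Qed.

End LargeSmallParts.

Section VariableExponentMean.
Context {R : realType}.
Local Notation mu := (@lebesgue_measure R).
Variables (p : R -> R) (pmax C pinf Cinf : R).
Hypothesis mp : measurable_fun setT p.
Hypothesis p1 : forall x, 1 <= p x.
Hypothesis p_le : forall x, p x <= pmax.
Hypothesis C0 : 0 <= C.
Hypothesis plog : forall x t : R, `|x - t| < 2^-1 -> `|p x - p t| <= C / ln (`|x - t|)^-1.
Hypothesis pinf1 : 1 <= pinf.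
Hypothesis pdecay : forall x, `|p x - pinf| <= Cinf / ln (expR 1 + `|x|).
Implicit Types (x y t K : R) (z : R * R) (f g : R -> R).

Local Notation fp f := (fun t => f t `^ p t).
Local Notation w := (fun t : R => (oneDsqr t)^-1).

Lemma integrable_oneDsqrV : mu.-integrable setT (EFin \o w).
Proof.
apply: ge0_integrable_lty; rewrite ?integral_oneDsqrV ?ltry//.
by apply: continuous_measurable_fun; exact: continuous_oneDsqrV.
Qed.

Lemma measurable_powRp f : measurable_fun setT f -> measurable_fun setT (fp f).
Proof.
by move=> mf; apply: measurable_powR_fun => // t; rewrite gt_eqF// (lt_le_trans ltr01).
Qed.

Lemma poisson_powR_le x t y K : 0 < y < 1 -> 1 <= K <= y^-1 ->
  poisson y (x - t) * K `^ (1 - p t) <= expR (2 * C) * K `^ (1 - p x) * poisson y (x - t) + 4.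
Proof.
move=> y01 K1y; have /andP[y0 y1] := y01; have /andP[K1 _] := K1y.
have K0 : 0 < K by exact: lt_le_trans K1.
have P0 : 0 <= poisson y (x - t) by exact: poisson_ge0.
have [xt|xt] := leP `|x - t| (Num.sqrt y / 2).
  apply: ler_wpDr => //; rewrite mulrC ler_wpM2r//.
  have -> : 1 - p t = (p x - p t) + (1 - p x) by ring.
  rewrite powRD; last by rewrite (gt_eqF K0) implybT.
  by rewrite ler_wpM2r ?powR_ge0// (log_holder_powR C0 plog y01 K1y xt).
apply: ler_wpDl; first exact: mulr_ge0 (mulr_ge0 (expR_ge0 _) (powR_ge0 _ _)) P0.
have KpV : K `^ (1 - p t) <= 1.
  by rewrite -[leRHS](powRr0 K); apply: ler_powR => //; rewrite subr_le0.
have xt0 : x - t != 0 by rewrite -normr_gt0 (le_lt_trans _ xt)// divr_ge0 ?sqrtr_ge0.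
have xt2 : y / 4 <= (x - t) ^+ 2.
  have : (Num.sqrt y / 2) ^+ 2 <= `|x - t| ^+ 2.
    by rewrite lerXn2r ?nnegrE ?divr_ge0 ?sqrtr_ge0// ltW.
  by rewrite expr_div_n sqr_sqrtr ?(ltW y0)// (real_normK (num_real _)); lra.
rewrite -[leRHS]mulr1; apply: ler_pM; rewrite ?powR_ge0//.
apply: le_trans (poisson_le_sqr y0 xt0) _.
by rewrite ler_pdivrMr ?exprn_even_gt0//; lra.
Qed.

Lemma poisson_ext_young_split f x y K : 0 < y < 1 -> 1 <= K <= y^-1 ->
  measurable_fun setT f -> (forall t, 0 <= f t) -> mu.-integrable setT (EFin \o fp f) ->
  \int[mu]_t (f t `^ p t) <= 1 ->
  poisson_ext f (x, y) <= K + expR (2 * C) * K `^ (1 - p x) * poisson_ext (fp f) (x, y) + 4.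
Proof.
move=> y01 K1y mf f0 ifp fp1; have /andP[y0 _] := y01.
have K0 : 0 < K by have /andP[+ _] := K1y; exact: lt_le_trans.
have ker0 t : 0 <= poisson y (x - t) by exact: poisson_ge0.
have iP := integrable_poissonB x y0; have pfp := integrable_poisson_integrable ifp.
pose c := expR (2 * C) * K `^ (1 - p x).
have i1 := integrable_mulrl measurableT c (integrable_poisson_kernel x pfp y0).
have i2 := integrable_mulrl measurableT 4 ifp; have i12 := integrable_addr measurableT i1 i2.
pose g t := poisson y (x - t) * (K `^ (1 - p t) * f t `^ p t).
have split_le t : `|g t| <= c * (poisson y (x - t) * f t `^ p t) + 4 * f t `^ p t.
  rewrite ger0_norm; last exact: mulr_ge0 (ker0 t) (mulr_ge0 (powR_ge0 _ _) (powR_ge0 _ _)).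
  rewrite /g (mulrA (poisson _ _)) (mulrA c (poisson _ _)) -mulrDl.
  by apply: ler_wpM2r; [exact: powR_ge0|exact: poisson_powR_le].
have mg : measurable_fun setT g.
  apply: measurable_poisson_kernel => //; apply: measurable_funM; last exact: measurable_powRp.
  apply: (@measurable_comp _ _ _ _ _ _ setT (fun s => K `^ s)) => //.
    exact: measurable_powRr.
  exact: measurable_funB.
have ig : mu.-integrable setT (EFin \o g).
  by apply: integrable_dominated i12 _ => // t _; exact: split_le.
apply: le_trans (weighted_mean_young_split iP ker0 _ mf f0 p1 K0 ig) _.
  by rewrite Rintegral_poissonB.
rewrite -addrA lerD2l; apply: le_trans (ler_norm _) _.
apply: (@le_trans _ _ (\int[mu]_t (c * (poisson y (x - t) * f t `^ p t) + 4 * f t `^ p t))).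
  by apply: ler_normr_Rintegral => // t _; exact: split_le.
rewrite RintegralD// (RintegralZl _ measurableT ifp).
rewrite (RintegralZl _ measurableT (integrable_poisson_kernel x pfp y0)).
by rewrite lerD2l ler_piMr.
Qed.

Lemma large_poisson_ext_powR f x y : 0 < y -> measurable_fun setT f -> (forall t, 0 <= f t) ->
  (forall t, f t <= f t `^ p t) -> mu.-integrable setT (EFin \o fp f) ->
  \int[mu]_t (f t `^ p t) <= 1 ->
  poisson_ext f (x, y) `^ p x <= (5 + expR (2 * C)) `^ pmax * poisson_ext (fp f) (x, y).
Proof.
move=> y0 mf f0 f_le ifp fp1; set N := poisson_ext f _; set m := poisson_ext (fp f) _.
have fp0 t : 0 <= f t `^ p t by exact: powR_ge0.
have pfp := integrable_poisson_integrable ifp.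
have N0 : 0 <= N by exact: poisson_ext_ge0.
have pf : poisson_integrable f.
  by apply: poisson_integrable_dominated mf pfp _ => t; rewrite ger0_norm.
have Nm : N <= m by exact: le_poisson_ext.
have c0 := expR_gt0 (2 * C); have c1 : 1 <= 5 + expR (2 * C) by lra.
have [m1|m1] := leP m 1.
  apply: le_trans (powR_le_self (p1 x) _) _; first by rewrite N0 (le_trans Nm).
  rewrite (le_trans Nm)// ler_peMl ?(le_trans N0)//.
  rewrite -[leLHS](powRr0 (5 + expR (2 * C))) ler_powR//.
  by rewrite (le_trans _ (p_le x))// (le_trans ler01).
pose K := m `^ (p x)^-1; have px0 : 0 < p x by exact: lt_le_trans (p1 x).
have m0 : 0 < m by exact: lt_trans m1.
have KE : K `^ p x = m by rewrite -powRrM mulVf ?gt_eqF// powRr1// ltW.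
have K0 : 0 < K by exact: powR_gt0.
have K1 : 1 <= K.
  have pV0 : 0 <= (p x)^-1 by rewrite invr_ge0 ltW.
  by have := le_powR pV0 ler01 (ltW m1); rewrite powR1.
have Km : K <= m by apply: ler1_powR (ltW m1) _; rewrite invf_le1.
have my : m <= y^-1.
  apply: le_trans (@poisson_ext_le_Rintegral _ _ (x, y) y0 ifp fp0) _.
  by rewrite ler_piMr// invr_ge0 ltW.
have y1 : y < 1 by rewrite -invf_gt1// (lt_le_trans m1).
have y01 : 0 < y < 1 by rewrite y0.
have K1y : 1 <= K <= y^-1 by rewrite K1 (le_trans Km).
have N_le : N <= (5 + expR (2 * C)) * K.
  apply: le_trans (poisson_ext_young_split x y01 K1y mf f0 ifp fp1) _.
  by rewrite -/m -[in leLHS]KE -mulrA powR1BM//; lra.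
apply: le_trans (le_powR (ltW px0) N0 N_le) _.
rewrite powRM ?(ltW K0)// ?(le_trans ler01)// KE ler_wpM2r ?(ltW m0)//.
exact: ler_powR.
Qed.

Lemma small_poisson_ext_powR f x y : 0 < y -> measurable_fun setT f ->
  (forall t, 0 <= f t <= 1) -> mu.-integrable setT (EFin \o fp f) ->
  poisson_ext f (x, y) `^ p x <= expR (2 * Cinf) * 2 `^ pinf *
    (expR (2 * Cinf) * poisson_ext (fp f) (x, y) + poisson_ext w (x, y)) + w x.
Proof.
move=> y0 mf f01 ifp; have f0 t : 0 <= f t by have /andP[] := f01 t.
have f_norm t : `|f t| <= 1 by have /andP[_] := f01 t; rewrite ger0_norm.
pose fpinf t := f t `^ pinf; set c := expR (2 * Cinf).
have mfpinf : measurable_fun setT fpinf.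
  by apply: measurable_powR_fun => // t; rewrite gt_eqF// (lt_le_trans ltr01).
have pfpinf : poisson_integrable fpinf.
  apply: (poisson_integrable_bounded (B := 1)) mfpinf _ => t.
  rewrite ger0_norm ?powR_ge0//; apply: le_trans (powR_le_self pinf1 (f01 t)) _.
  by have /andP[] := f01 t.
have pfp := integrable_poisson_integrable ifp.
have pw := integrable_poisson_integrable integrable_oneDsqrV.
have mean01 : 0 <= poisson_ext f (x, y) <= 1.
  rewrite poisson_ext_ge0//=; apply: le_trans (ler_norm _) _.
  exact: normr_poisson_ext_le.
apply: le_trans (powR_exchange (p1 x) pinf1 mean01 (pdecay x)) _.
rewrite lerD2r -mulrA ler_wpM2l ?expR_ge0//.
have iP := integrable_poissonB x y0; have ker0 t : 0 <= poisson y (x - t) by exact: poisson_ge0.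
have jensen : poisson_ext f (x, y) `^ pinf <= 2 `^ pinf * poisson_ext fpinf (x, y).
  apply: (weighted_mean_powR iP ker0 _ mf f0 pinf1); first by rewrite Rintegral_poissonB.
  exact: integrable_poisson_kernel.
apply: le_trans jensen _; rewrite ler_wpM2l ?powR_ge0//.
rewrite (mulrC c) -poisson_extMr// -poisson_extD//; last exact: poisson_integrableMr.
apply: le_poisson_ext => // [|t].
  by apply: poisson_integrableD => //; exact: poisson_integrableMr.
by rewrite mulrC; apply: powR_exchange; rewrite // distrC.
Qed.

Lemma powRp_dominated f g : measurable_fun setT g -> (forall t, 0 <= g t <= f t) ->
  mu.-integrable setT (EFin \o fp f) ->
  [/\ mu.-integrable setT (EFin \o fp g), \int[mu]_t (g t `^ p t) <= \int[mu]_t (f t `^ p t) &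
      forall z, 0 < z.2 -> poisson_ext (fp g) z <= poisson_ext (fp f) z].
Proof.
move=> mg gf ifp; have gfp t : g t `^ p t <= f t `^ p t.
  by have /andP[g0 gft] := gf t; apply: le_powR => //; rewrite (le_trans ler01).
have ig : mu.-integrable setT (EFin \o fp g).
  apply: integrable_dominated ifp _ => //; first exact: measurable_powRp.
  by move=> t _; rewrite ger0_norm ?powR_ge0.
split; [exact: ig|by apply: le_Rintegral => // t _; exact: gfp|move=> z z0].
by apply: (le_poisson_ext z0 _ _ gfp); exact: integrable_poisson_integrable.
Qed.

Lemma poisson_ext_powR_le : exists2 K, 0 <= K & forall f x y, 0 < y ->
  measurable_fun setT f -> (forall t, 0 <= f t) -> mu.-integrable setT (EFin \o fp f) ->
  \int[mu]_t (f t `^ p t) <= 1 ->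
  poisson_ext f (x, y) `^ p x <= K * (poisson_ext (fp f) (x, y) + poisson_ext w (x, y) + w x).
Proof.
pose large_cst := (5 + expR (2 * C)) `^ pmax; pose decay_cst := expR (2 * Cinf).
have large_cst0 : 0 <= large_cst by exact: powR_ge0.
have decay_cst0 : 0 <= decay_cst by exact: expR_ge0.
have small_cst0 : 0 <= decay_cst * 2 `^ pinf by rewrite mulr_ge0 ?powR_ge0.
exists (2 `^ pmax * (large_cst + decay_cst * 2 `^ pinf * (decay_cst + 1) + 1)).
  by rewrite mulr_ge0 ?powR_ge0// !addr_ge0// mulr_ge0// addr_ge0.
move=> f x y y0 mf f0 ifp fp1; have [mlarge msmall] := measurable_large_small_part mf.
have large0 t : 0 <= large_part f t by exact: large_part_ge0.
have small01 t : 0 <= small_part f t <= 1 by exact: small_part_itv.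
have small0 t : 0 <= small_part f t by have /andP[] := small01 t.
have p0 t : 0 <= p t by rewrite (le_trans ler01).
have [|ilarge large_le large_ext_le] := powRp_dominated mlarge _ ifp.
  by move=> t; rewrite large0/= [leRHS]large_small_partE lerDl.
have [|ismall _ small_ext_le] := powRp_dominated msmall _ ifp.
  by move=> t; rewrite small0/= [leRHS]large_small_partE lerDr.
have plarge : poisson_integrable (large_part f).
  apply: poisson_integrable_dominated mlarge (integrable_poisson_integrable ilarge) _ => t.
  by rewrite ger0_norm// large_part_le_powR.
have psmall : poisson_integrable (small_part f).
  apply: (poisson_integrable_bounded (B := 1)) msmall _ => t.
  by rewrite ger0_norm//; have /andP[] := small01 t.
rewrite [in leLHS](funext (large_small_partE f)) poisson_extD//.
apply: le_trans (powRD_le (p0 x) (poisson_ext_ge0 _ large0) (poisson_ext_ge0 _ small0)) _ => //.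
rewrite -(mulrA (2 `^ pmax)); apply: ler_pM; rewrite ?addr_ge0 ?powR_ge0 ?ler_powR ?ler1n//.
have large_mean := large_poisson_ext_powR x y0 mlarge large0
  (fun t => large_part_le_powR f t (p1 t)) ilarge (le_trans large_le fp1).
have small_mean := small_poisson_ext_powR x y0 msmall small01 ismall.
have W0 : 0 <= poisson_ext w (x, y) by exact: poisson_ext_ge0.
have m0 : 0 <= poisson_ext (fp f) (x, y) by apply: poisson_ext_ge0 => // t; exact: powR_ge0.
set S := _ + _ + (oneDsqr x)^-1.
have mS : poisson_ext (fp f) (x, y) <= S by rewrite /S -addrA lerDl addr_ge0.
have WS : poisson_ext w (x, y) <= S by rewrite /S addrAC lerDr addr_ge0.
have wS : w x <= S by rewrite /S lerDr addr_ge0.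
apply: le_trans (lerD large_mean small_mean) _.
rewrite -/large_cst -/decay_cst !mulrDl mul1r -addrA.
apply: lerD; first exact: (ler_wpM2l large_cst0 (le_trans (large_ext_le (x, y) y0) mS)).
apply: lerD; last exact: wS.
rewrite -(mulrA _ _ S); apply: (ler_wpM2l small_cst0); rewrite mulrDl mul1r.
exact: lerD (ler_wpM2l decay_cst0 (le_trans (small_ext_le (x, y) y0) mS)) WS.
Qed.

End VariableExponentMean.

Section PoissonTonelli.
Context {R : realType}.
Local Notation mu := (@lebesgue_measure R).
Variables (y : R) (h : R -> R).
Hypothesis y0 : 0 < y.
Hypothesis mh : measurable_fun setT h.
Hypothesis h0 : forall t, 0 <= h t.

Let kernel (z : R * R) := (poisson y (z.1 - z.2) * h z.2)%:E.

Lemma measurable_poisson_kernel2 : measurable_fun setT kernel.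
Proof.
apply/measurable_EFinP; apply: measurable_funM.
  apply: (measurableT_comp (f := poisson y)).
    by apply: continuous_measurable_fun; exact: continuous_poisson.
  by apply: measurable_funB; [exact: measurable_fst|exact: measurable_snd].
by apply: (measurableT_comp (f := h)) => //; exact: measurable_snd.
Qed.

Lemma poisson_kernel2_ge0 z : (0 <= kernel z)%E.
Proof. by rewrite lee_fin mulr_ge0// poisson_ge0. Qed.

Lemma measurable_integral_poisson :
  measurable_fun setT (fun x : R => \int[mu]_t (poisson y (x - t) * h t)%:E)%E.
Proof.
apply: (@measurable_fun_fubini_tonelli_F _ _ _ _ R mu kernel).
  exact: measurable_poisson_kernel2.
exact: poisson_kernel2_ge0.
Qed.

Lemma measurable_poisson_ext : measurable_fun setT (fun x : R => poisson_ext h (x, y)).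
Proof. exact: (measurableT_comp _ measurable_integral_poisson). Qed.

Lemma poisson_tonelli :
  (\int[mu]_x \int[mu]_t (poisson y (x - t) * h t)%:E = \int[mu]_t (h t)%:E)%E.
Proof.
rewrite (@fubini_tonelli _ _ _ _ R mu mu kernel measurable_poisson_kernel2 poisson_kernel2_ge0).
apply: eq_integral => t _; rewrite /kernel /=; under eq_integral do rewrite mulrC EFinM poissonBC.
rewrite ge0_integralZl ?lee_fin//; last 2 first.
- by apply/measurable_EFinP; exact: measurable_poissonB.
- by move=> x _; rewrite lee_fin poisson_ge0.
by rewrite integral_poissonB// mule1.
Qed.

Lemma integral_poisson_ext : mu.-integrable setT (EFin \o h) ->
  (\int[mu]_x (poisson_ext h (x, y))%:E = \int[mu]_t (h t)%:E)%E.
Proof.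
move=> ih; rewrite -poisson_tonelli; apply: eq_integral => x _; rewrite EFin_Rintegral//.
by apply: integrable_poisson_kernel => //; exact: integrable_poisson_integrable.
Qed.

Lemma integrable_poisson_ext : mu.-integrable setT (EFin \o h) ->
  mu.-integrable setT (EFin \o (fun x : R => poisson_ext h (x, y))).
Proof.
move=> ih; apply: ge0_integrable_lty; first exact: measurable_poisson_ext.
  by move=> x; exact: poisson_ext_ge0.
by rewrite integral_poisson_ext// -EFin_Rintegral// ltry.
Qed.

Lemma Rintegral_poisson_ext : mu.-integrable setT (EFin \o h) ->
  \int[mu]_x poisson_ext h (x, y) = \int[mu]_t h t.
Proof. by move=> ih; rewrite /Rintegral integral_poisson_ext. Qed.

End PoissonTonelli.

Section PoissonModular.
Context {R : realType}.
Local Notation mu := (@lebesgue_measure R).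
Implicit Types (p f : R -> R) (x y t : R).

Definition poisson_modular_bound p (K : R) := forall f y, measurable_fun setT f ->
  (forall t, 0 <= f t) -> (\int[mu]_t (f t `^ p t)%:E <= 1)%E -> 0 < y ->
  (\int[mu]_x (poisson_ext f (x, y) `^ p x)%:E <= K%:E)%E.

Lemma LH_poisson_modular_bound p : measurable_fun setT p -> (forall x, 1 < p x) -> LH p ->
  exists2 K : R, 0 < K & poisson_modular_bound p K.
Proof.
move=> mp p_gt1 [[C [C0 plog]] [pinf [Cinf [Cinf0 pdecay]]]].
have p1 x : 1 <= p x by exact: ltW.
have p_le := log_decay_bounded (ltW Cinf0) pdecay.
have pinf1 := log_decay_limit_ge pdecay p1.
have [K K0 meanK] := poisson_ext_powR_le mp p1 p_le (ltW C0) plog pinf1 pdecay.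
exists (K * (1 + pi + pi) + 1) => [|f y mf f0 fle y0].
  by rewrite ltr_wpDl// mulr_ge0//; have := @pi_ge0 R; lra.
pose fp t := f t `^ p t; pose w t : R := (oneDsqr t)^-1.
have mfp : measurable_fun setT fp by exact: measurable_powRp.
have fp0 t : 0 <= fp t by exact: powR_ge0.
have ifp : mu.-integrable setT (EFin \o fp).
  by apply: ge0_integrable_lty => //; exact: le_lt_trans fle (ltry _).
have fp1 : \int[mu]_t fp t <= 1 by rewrite -lee_fin EFin_Rintegral.
have iw : mu.-integrable setT (EFin \o w) by exact: integrable_oneDsqrV.
have mw : measurable_fun setT w := measurable_fun_integrable iw.
have w0 t : 0 <= w t by rewrite invr_ge0 (le_trans ler01)// oneDsqr_ge1.
have wpi : \int[mu]_t w t = pi by rewrite /Rintegral integral_oneDsqrV.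
have ifp_ext := integrable_poisson_ext y0 mfp fp0 ifp.
have iw_ext := integrable_poisson_ext y0 mw w0 iw.
have i12 := integrable_addr measurableT ifp_ext iw_ext.
have i123 := integrable_addr measurableT i12 iw.
apply: (@le_trans _ _ (\int[mu]_x
    (K * (poisson_ext fp (x, y) + poisson_ext w (x, y) + w x))%:E)%E).
  apply: ge0_le_integral => //.
  - by move=> x _; rewrite lee_fin powR_ge0.
  - apply/measurable_EFinP; apply: measurable_powRp => //.
    exact: measurable_poisson_ext.
  - exact: measurable_int (integrable_mulrl measurableT K i123).
  - by move=> x _; rewrite lee_fin meanK.
rewrite -EFin_Rintegral//; last exact: integrable_mulrl.
rewrite lee_fin (RintegralZl _ measurableT i123) (RintegralD measurableT i12 iw).
rewrite (RintegralD measurableT ifp_ext iw_ext) !Rintegral_poisson_ext// wpi.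
by apply: ler_wpDr => //; rewrite ler_wpM2l// !lerD2r.
Qed.

End PoissonModular.

(** * Almost everywhere boundary values *)

Section DyadicPoisson.
Context {R : realType}.
Implicit Types (x y s d : R).

Lemma dyadic_scale y d : 0 < y < d -> exists N : nat, d / 2 <= 2 ^+ N * y < d.
Proof.
move=> /andP[y0 yd]; have exN : exists n : nat, d / 2 <= 2 ^+ n * y.
  exists (Num.truncn (d / 2 / y)).+1; rewrite -ler_pdivrMr//.
  apply: le_trans (ltW (truncnS_gt _)) _.
  by rewrite -natrX ler_nat ltnW// ltn_expl.
case: (ex_minnP exN) => N dN minN; exists N; rewrite dN /=.
case: N dN minN => [|M] dN minN; first by rewrite mul1r.
rewrite exprS -mulrA mulrC -ltr_pdivlMr// ltNge; apply/negP => /minN.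
by rewrite ltnn.
Qed.

(* Dyadic annuli: the mass of [P_y] on the [k]-th one is [O(2^-k)]. *)
Lemma poisson_dyadic_le N y s : 0 < y -> `|s| < 2 ^+ N * y ->
  poisson y s <= \sum_(k < N.+1) 4 / (4 ^+ k * y) * (`|s| < 2 ^+ k * y)%R%:R.
Proof.
move=> y0; elim: N => [|N IH] sN.
  rewrite big_ord1 sN mulr1 expr0 mul1r; apply: le_trans (poisson_le s y0) _.
  by rewrite -[leLHS]mul1r ler_wpM2r ?invr_ge0 ?(ltW y0)// ler1n.
have c0 k : 0 < 4 / (4 ^+ k * y) by rewrite divr_gt0// mulr_gt0// exprn_gt0.
rewrite big_ord_recr/=; have [/IH sN'|Ns] := ltP `|s| (2 ^+ N * y).
  by apply: ler_wpDr => //; rewrite mulr_ge0// ltW.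
apply: ler_wpDl; first by apply: sumr_ge0 => k _; rewrite mulr_ge0// ltW.
have Ny0 : 0 < 2 ^+ N * y by rewrite mulr_gt0// exprn_gt0.
have s0 : s != 0 by rewrite -normr_gt0 (lt_le_trans Ny0).
have s2 : (2 ^+ N * y) ^+ 2 <= s ^+ 2.
  by rewrite -(real_normK (num_real s)) lerXn2r ?nnegrE// ltW.
rewrite sN mulr1; apply: le_trans (poisson_le_sqr y0 s0) _.
apply: (@le_trans _ _ (y / (2 ^+ N * y) ^+ 2)).
  have Ny20 : 0 < (2 ^+ N * y) ^+ 2 by rewrite exprn_gt0.
  by rewrite ler_wpM2l ?(ltW y0)// lef_pV2 ?posrE// (lt_le_trans Ny20).
rewrite le_eqVlt; apply/orP; left; apply/eqP.
have -> : 4 ^+ N.+1 = 4 * (2 ^+ N) ^+ 2 :> R by rewrite exprS expr2 -exprMn -natrM.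
by field; rewrite ?expf_neq0// gt_eqF.
Qed.

Lemma sum_dyadic_le (N : nat) (e y : R) : 0 < y -> 0 <= e ->
  \sum_(k < N) 4 / (4 ^+ k * y) * (2 * (2 ^+ k * y) * e) <= 16 * e.
Proof.
move=> y0 e0; have halves : \sum_(k < N) (2^-1 : R) ^+ k = 2 * (1 - 2^-1 ^+ N).
  elim: N => [|N IH]; first by rewrite big_ord0 expr0 subrr mulr0.
  by rewrite big_ord_recr/= IH exprS; lra.
rewrite (eq_bigr (fun k : 'I_N => 8 * e * 2^-1 ^+ k)) => [|k _].
  rewrite -mulr_sumr halves; have : 0 <= e * 2^-1 ^+ N by rewrite mulr_ge0 ?exprn_ge0 ?invr_ge0.
  lra.
have -> : 4 ^+ k = 2 ^+ k * 2 ^+ k :> R by rewrite -exprMn -natrM.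
by rewrite exprVn; field; rewrite expf_neq0// gt_eqF.
Qed.

End DyadicPoisson.

Section BoundaryValues.
Context {R : realType}.
Local Notation mu := (@lebesgue_measure R).
Implicit Types (x y r d e : R) (u v g : R -> R).

Lemma poisson_integrable_restr u (A : set R) M : poisson_integrable u -> measurable A ->
  (forall t, A t -> `|t| <= M) -> mu.-integrable A (EFin \o u).
Proof.
move=> [mu_ iu] mA AM; pose B := pi * (1 + M ^+ 2) : R.
have iBu : mu.-integrable A (EFin \o (fun t => B * `|poisson 1 t * u t|)).
  by apply: integrable_restr => //; apply: integrable_mulrl => //; exact: integrable_normr.
apply: integrable_dominated iBu _ => // [|t At]; first exact: measurable_funTS.
rewrite normr_poissonM// mulrA ler_peMl// poisson1E /B mulrACA mulfV ?mul1r ?gt_eqF ?pi_gt0//.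
rewrite ler_pdivlMr ?(lt_le_trans ltr01 (oneDsqr_ge1 _))// mul1r lerD2l.
by rewrite -(real_normK (num_real t)) lerXn2r ?nnegrE ?AM// (le_trans _ (AM t At)).
Qed.

Lemma poisson_integrable_ball u x r : poisson_integrable u ->
  mu.-integrable (ball x r) (EFin \o u).
Proof.
move=> iu; apply: (poisson_integrable_restr (M := `|x| + r) iu) => [|t xt].
  exact: measurable_ball.
rewrite -[t in leLHS](subKr x) (le_trans (ler_normB _ _))// lerD2l.
exact: ltW xt.
Qed.

Lemma poisson_integrable_locally u : poisson_integrable u -> locally_integrable setT u.
Proof.
move=> iu; split => [||K _ cK]; [by case: iu|exact: openT|].
have [M [_ MK]] := compact_bounded cK.
have KM t : K t -> `|t| <= M + 1 by apply: MK; rewrite ltrDl.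
by have /integrableP[] := poisson_integrable_restr iu (compact_measurable cK) KM.
Qed.

Lemma poisson_ext_le_averages g x y d e : 0 < y < d -> poisson_integrable g ->
  (forall t, 0 <= g t) -> 0 <= e ->
  (forall r, 0 < r < d -> \int[mu]_(t in ball x r) g t <= 2 * r * e) ->
  poisson_ext g (x, y) <= 16 * e + 4 * y / d * poisson_ext g (x, d / 2).
Proof.
move=> yd ig g0 e0 avg; have [N /andP[dN Nd]] := dyadic_scale yd.
have /andP[y0 y_lt_d] := yd; have d0 := lt_trans y0 y_lt_d.
have d20 : 0 < d / 2 by rewrite divr_gt0.
pose c k := 4 / (4 ^+ k * y); pose A k := ball x (2 ^+ k * y).
have c0 k : 0 <= c k by rewrite divr_ge0// mulr_ge0 ?exprn_ge0// ltW.
have mA k : measurable (A k) by exact: measurable_ball.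
have iA k : mu.-integrable (A k) (EFin \o g) by exact: poisson_integrable_ball.
have [inear nearE] := @integrable_simpleM _ _ R mu N.+1 c A g mA iA.
have ifar := integrable_mulrl measurableT (4 * y / d) (integrable_poisson_kernel x ig d20).
have kernel_le t : poisson y (x - t) <=
    \sum_(k < N.+1) c k * \1_(A k) t + 4 * y / d * poisson (d / 2) (x - t).
  have far0 : 0 <= 4 * y / d * poisson (d / 2) (x - t).
    apply: mulr_ge0 (poisson_ge0 _ d20).
    by rewrite divr_ge0 ?(ltW d0)// mulr_ge0// ltW.
  have [xt|xt] := ltP `|x - t| (2 ^+ N * y).
    apply: ler_wpDr => //; apply: le_trans (poisson_dyadic_le y0 xt) _.
    by apply: ler_sum => k _; rewrite indicE mem_setE.
  apply: ler_wpDl.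
    by apply: sumr_ge0 => k _; rewrite mulr_ge0// indicE.
  apply: le_trans (poisson_tail y0 d20 (le_trans dN xt)) _.
  by rewrite (_ : 2 * y / (d / 2) = 4 * y / d)//; field; rewrite gt_eqF.
have -> : 4 * y / d * poisson_ext g (x, d / 2) =
    \int[mu]_t (4 * y / d * (poisson (d / 2) (x - t) * g t)).
  by rewrite (RintegralZl _ measurableT (integrable_poisson_kernel x ig d20)).
apply: (@le_trans _ _ (\int[mu]_t ((\sum_(k < N.+1) c k * \1_(A k) t) * g t +
    4 * y / d * (poisson (d / 2) (x - t) * g t)))).
  apply: le_Rintegral => //; [exact: integrable_poisson_kernel|exact: integrable_addr|].
  by move=> t _; rewrite mulrA -mulrDl ler_wpM2r.
rewrite RintegralD// lerD2r nearE; apply: le_trans _ (sum_dyadic_le N.+1 y0 e0).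
apply: ler_sum => k _; apply: ler_wpM2l => //; apply: avg.
rewrite mulr_gt0 ?exprn_gt0//=; apply: le_lt_trans Nd.
by rewrite ler_pM2r// ler_eXn2l ?ltr1n// -ltnS.
Qed.

Lemma lebesgue_pt_average u x e : poisson_integrable u -> lebesgue_pt u x -> 0 < e ->
  exists2 d, 0 < d & forall r, 0 < r < d ->
    \int[mu]_(t in ball x r) `|u t - u x| <= 2 * r * e.
Proof.
move=> iu xpt e0; have ig : poisson_integrable (fun t => `|u t - u x|).
  by apply: poisson_integrable_normr; exact: poisson_integrableB (poisson_integrable_cst _).
have [d /= d0 davg_lt] : \forall r \near (0 : R)^'+, (davg u x r < e%:E)%E.
  move: xpt => /fine_cvgP[davg_fin /cvgrPdist_lt/(_ _ e0) davg_small].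
  apply: filterS2 davg_fin davg_small => r davg_fin.
  rewrite sub0r normrN ger0_norm; last by rewrite fine_ge0// davg_ge0.
  by rewrite -lte_fin fineK.
exists d => // r /andP[r0 rd].
have := davg_lt r; rewrite /ball_/= sub0r normrN gtr0_norm// => /(_ rd r0)/ltW.
rewrite /davg /iavg lebesgue_measure_ball ?(ltW r0)//.
have r2 : r *+ 2 != 0 by rewrite mulrn_eq0/= gt_eqF.
rewrite inver (negbTE r2) muleC lee_pdivrMr ?lte_fin ?mulrn_wgt0//.
rewrite -lee_fin EFin_Rintegral; last exact: poisson_integrable_ball.
  by rewrite -EFinM mulrC mulr_natl.
exact: measurable_ball.
Qed.

Lemma lebesgue_pt_poisson_ext u x : poisson_integrable u -> lebesgue_pt u x ->
  poisson_ext u (x, y) @[y --> 0^'+] --> u x.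
Proof.
move=> iu xpt; pose g t := `|u t - u x|.
have iux : poisson_integrable (fun t => u t - u x).
  exact: poisson_integrableB (poisson_integrable_cst _).
have ig : poisson_integrable g by exact: poisson_integrable_normr.
have g0 t : 0 <= g t by exact: normr_ge0.
have dist_le y : 0 < y -> `|u x - poisson_ext u (x, y)| <= poisson_ext g (x, y).
  move=> y0; rewrite distrC -[X in _ - X](@poisson_ext_cst _ _ (x, y))// -poisson_extB//.
    by apply: ler_normr_poisson_ext => //; case: iux.
  exact: poisson_integrable_cst.
apply/cvgrPdist_le => /= e e0; have e320 : 0 < e / 32 by rewrite divr_gt0.
have [d d0 avg] := lebesgue_pt_average iu xpt e320.
pose c := 4 / d * poisson_ext g (x, d / 2).
have c0 : 0 <= c by rewrite mulr_ge0 ?poisson_ext_ge0 ?divr_gt0// ltW// divr_gt0.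
have small0 : 0 < e / 2 / (c + 1) by rewrite !divr_gt0// ltr_wpDl.
have far_small y : 0 < y -> y <= e / 2 / (c + 1) ->
    4 * y / d * poisson_ext g (x, d / 2) <= e / 2.
  rewrite ler_pdivlMr ?ltr_wpDl// => y0; apply: le_trans.
  by rewrite (_ : _ * _ = y * c) ?ler_pM2l ?lerDl//; rewrite /c; ring.
near=> y; have y0 : 0 < y by near: y; exact: nbhs_right_gt.
have yd : 0 < y < d by rewrite y0; near: y; exact: nbhs_right_lt.
apply: le_trans (dist_le y y0) _.
apply: le_trans (poisson_ext_le_averages yd ig g0 (ltW e320) avg) _.
have eE : e = 16 * (e / 32) + e / 2 by field.
by rewrite [leRHS]eE lerD2l far_small//; near: y; exact: nbhs_right_le.
Unshelve. all: by end_near. Qed.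

Lemma ae_poisson_ext_cvg u : poisson_integrable u ->
  {ae mu, forall x, poisson_ext u (x, y) @[y --> 0^'+] --> u x}.
Proof.
move=> iu; have := lebesgue_differentiation (poisson_integrable_locally iu).
by apply: negligibleS; apply: subsetC => x xpt; exact: lebesgue_pt_poisson_ext.
Qed.

Lemma poisson_ext_inj u v : poisson_integrable u -> poisson_integrable v ->
  (forall z, 0 < z.2 -> poisson_ext u z = poisson_ext v z) ->
  {ae mu, forall x, u x = v x}.
Proof.
move=> iu iv uv; apply: filterS2 (ae_poisson_ext_cvg iu) (ae_poisson_ext_cvg iv).
  exact: (ae_filter_ringOfSetsType mu).
move=> x ux vx.
apply: cvg_unique ux _ => //; apply: cvg_trans vx; apply: near_eq_cvg.
by near=> y; apply/esym/uv; near: y; exact: nbhs_right_gt.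
Unshelve. all: by end_near. Qed.

End BoundaryValues.

(** * Existence of the boundary function *)

Section WeightedYoung.
Context {R : realType}.
Implicit Types (p : R -> R) (a e q t K : R).

Lemma poisson1_le1 t : poisson 1 t <= 1 :> R.
Proof. by apply: le_trans (poisson_le t ltr01) _; rewrite invr1. Qed.

Lemma normr_le_1D_powR q a : 1 <= q -> 0 <= a -> a <= 1 + a `^ q.
Proof. by move=> q1 a0; have := young_split q1 a0 ltr01; rewrite powR1 mul1r. Qed.

(* On a compact interval the exponent is bounded away from [1], so a high
   splitting level makes the power term small; outside it the weight is small. *)
Lemma weighted_young p e : continuous p -> (forall t, 1 < p t) -> 0 < e ->
  exists2 K, 0 <= K & forall t a, 0 <= a ->
    poisson 1 t * a <= K * poisson 1 t + e * a `^ p t.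
Proof.
move=> cp p1 e0; pose L := 1 + e^-1.
have eV0 : 0 < e^-1 by rewrite invr_gt0.
have L1 : 1 <= L by rewrite lerDl ltW.
have L0 : 0 < L by exact: lt_le_trans L1.
have LVe : L^-1 <= e by rewrite -[leRHS]invrK lef_pV2 ?posrE// lerDr.
have LL : - L <= L by rewrite (@le_trans _ _ 0)// ?oppr_le0 ltW.
have [c _ c_min] := EVT_min LL (continuous_subspaceT cp (A := `[- L, L]%classic)).
have q1 : 0 < p c - 1 by rewrite subr_gt0.
pose K := L `^ (p c - 1)^-1.
have K0 : 0 < K by exact: powR_gt0.
have K1 : 1 <= K by rewrite -(powRr0 L) ler_powR// invr_ge0 ltW.
have KL : K `^ (1 - p c) = L^-1.
  by rewrite -(opprB (p c) 1) -powRrM mulrN mulVf ?gt_eqF// powR_inv1// ltW.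
exists K => [|t a a0]; first exact: ltW.
have P0 : 0 <= poisson 1 t by exact: poisson_ge0.
have [tL|Lt] := leP `|t| L.
  have tI : t \in `[- L, L] by rewrite in_itv/= -ler_norml.
  have KpL : K `^ (1 - p t) <= L^-1.
    by rewrite -KL ler_powR// lerD2l lerN2; exact: c_min.
  have := ler_wpM2l P0 (young_split (ltW (p1 t)) a0 K0).
  move/le_trans; apply; rewrite mulrDr (mulrC K) lerD2l mulrA ler_wpM2r ?powR_ge0//.
  rewrite -[leRHS]mul1r; apply: ler_pM; rewrite ?powR_ge0 ?poisson1_le1//.
  exact: le_trans KpL LVe.
have t0 : t != 0 by rewrite -normr_gt0 (lt_trans L0).
have Pe : poisson 1 t <= e.
  apply: le_trans (poisson_le_sqr ltr01 t0) _; rewrite mul1r; apply: le_trans LVe.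
  rewrite lef_pV2 ?posrE ?exprn_even_gt0// -(real_normK (num_real t)) expr2.
  by rewrite (le_trans (ltW Lt))// ler_peMl// (le_trans L1)// ltW.
have := ler_wpM2l P0 (normr_le_1D_powR (ltW (p1 t)) a0).
move/le_trans; apply; rewrite mulrDr mulr1.
by apply: lerD; [rewrite ler_peMl|rewrite ler_wpM2r ?powR_ge0].
Qed.

End WeightedYoung.

Section Existence.
Context {R : realType}.
Local Notation mu := (@lebesgue_measure R).
Variables (p : R -> R) (f : R * R -> R) (M : R).
Hypothesis p1 : forall x, 1 < p x.
Hypothesis cp : continuous p.
Hypothesis hf : harmonic_on (@upper_half_plane R) f.
Hypothesis fM : forall y, 0 < y -> (\int[mu]_t (`|f (t, y)| `^ p t)%:E <= M%:E)%E.
Implicit Types (x y s t : R) (z : R * R) (A : set R).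

Lemma harmonic_slice_measurable s : 0 < s -> measurable_fun setT (fun t => f (t, s)).
Proof.
move=> s0; apply: continuous_measurable_fun; apply: continuous_slice => // z z0.
exact: harmonic_continuous.
Qed.

Lemma integrable_slice_powR s : 0 < s ->
  mu.-integrable setT (EFin \o (fun t => `|f (t, s)| `^ p t)).
Proof.
move=> s0; apply: ge0_integrable_lty  => [||]; last first.
- exact: le_lt_trans (fM s0) (ltry _).
- by move=> t; exact: powR_ge0.
apply: measurable_powR_fun => [||t]; last by rewrite gt_eqF// (lt_trans ltr01).
  by apply: measurableT_comp => //; exact: harmonic_slice_measurable.
exact: continuous_measurable_fun.
Qed.

Lemma Rintegral_slice_powR_le s A : 0 < s -> measurable A ->
  \int[mu]_(t in A) `|f (t, s)| `^ p t <= M.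
Proof.
move=> s0 mA; have ifp := integrable_slice_powR s0.
apply: (@le_trans _ _ (\int[mu]_t `|f (t, s)| `^ p t)).
  by apply: le_Rintegral_subset => // t; exact: powR_ge0.
by rewrite -lee_fin EFin_Rintegral//; exact: fM.
Qed.

Lemma unit_segment_le x y : 0 < y -> \int[mu]_(t in `[x, x + 1]) `|f (t, y)| <= 1 + M.
Proof.
move=> y0; have x1 : x <= x + 1 by rewrite lerDl.
have i1 : mu.-integrable `[x, x + 1] (EFin \o (cst 1 : R -> R)).
  by apply: continuous_integrable_itv => t; exact: cvg_cst.
have ifp : mu.-integrable `[x, x + 1] (EFin \o (fun t => `|f (t, y)| `^ p t)).
  by apply: integrable_restr => //; exact: integrable_slice_powR.
have -> : 1 + M = \int[mu]_(t in `[x, x + 1]) (1 : R) + M.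
  by rewrite Rintegral_cst_itv// addrAC subrr add0r mul1r.
apply: (@le_trans _ _ (\int[mu]_(t in `[x, x + 1]) (1 + `|f (t, y)| `^ p t))).
  apply: le_Rintegral; [by []| |exact: integrable_addr|].
    apply: integrable_normr => //; apply: continuous_integrable_itv.
    by apply: continuous_slice => // z z0; exact: harmonic_continuous.
  by move=> t _; rewrite normr_le_1D_powR// ltW.
by rewrite RintegralD// lerD2l; exact: Rintegral_slice_powR_le.
Qed.

Lemma slice_poisson_integrable s : 0 < s -> poisson_integrable (fun t => f (t, s)).
Proof.
move=> s0; have mfs := harmonic_slice_measurable s0; split => //.
have i1 := integrable_addr measurableT (@integrable_poisson1 R) (integrable_slice_powR s0).
apply: integrable_dominated i1 _ => // [|t _].
  by apply: measurable_funM => //; exact: measurable_poisson1.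
rewrite normr_poissonM//; apply: le_trans (ler_wpM2l _ (normr_le_1D_powR (ltW (p1 t)) _)) _ => //.
  exact: poisson_ge0.
by rewrite mulrDr mulr1 lerD2l ler_piMl ?powR_ge0 ?poisson1_le1.
Qed.

Lemma weighted_slices_equi_integrable : equi_integrable mu (@poisson R 1)
  (fun n t => poisson 1 t * f (t, harmonic n)).
Proof.
move=> e e0; pose e' := e / (`|M| + 1).
have e'0 : 0 < e' by rewrite divr_gt0// ltr_wpDl.
have e'M : e' * M <= e.
  rewrite mulrAC ler_pdivrMr ?ltr_wpDl// ler_pM2l//.
  by rewrite (le_trans (ler_norm _))// lerDl.
have [K K0 KP] := weighted_young cp p1 e'0; exists K => // n A mA.
have s0 : 0 < harmonic n :> R by exact: harmonic_gt0.
have iP : mu.-integrable A (EFin \o @poisson R 1).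
  by apply: integrable_restr => //; exact: integrable_poisson1.
have ifp : mu.-integrable A (EFin \o (fun t => `|f (t, harmonic n)| `^ p t)).
  by apply: integrable_restr => //; exact: integrable_slice_powR.
have iKP := integrable_mulrl mA K iP; have iefp := integrable_mulrl mA e' ifp.
apply: (@le_trans _ _ (\int[mu]_(t in A)
    (K * poisson 1 t + e' * `|f (t, harmonic n)| `^ p t))).
  apply: le_Rintegral => //; last by move=> t _; rewrite normr_poissonM// KP.
    apply: integrable_normr => //; apply: integrable_restr => //.
    by case: (slice_poisson_integrable s0).
  exact: integrable_addr.
rewrite RintegralD// RintegralZl// RintegralZl// lerD2l; apply: le_trans e'M.
by rewrite ler_pM2l// Rintegral_slice_powR_le.
Qed.

Lemma cvg_harmonic_translate z : 0 < z.2 ->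
  f (z.1, harmonic n + z.2) @[n --> \oo] --> f z.
Proof.
case: z => x y /= y0.
have fz : {for (x, y), continuous f} by exact: harmonic_continuous.
have cst_cvg : (fun=> x) @ \oo --> x by exact: cvg_cst.
have shift_cvg : harmonic n + y @[n --> \oo] --> y.
  by rewrite -[X in _ --> X]add0r; apply: cvgD; [exact: cvg_harmonic|exact: cvg_cst].
exact: (cvg_comp _ _ (cvg_pair cst_cvg shift_cvg) fz).
Qed.

Lemma boundary_value : exists2 u : R -> R, poisson_integrable u &
  forall z, 0 < z.2 -> poisson_ext u z = f z.
Proof.
have [F [UF sF]] := @ultraFilterLemma nat \oo _.
have P_gt0 t : 0 < poisson 1 t :> R by exact: poisson_gt0.
have Pn0 t : poisson 1 t != 0 :> R by rewrite gt_eqF.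
have islice n : mu.-integrable setT (EFin \o (fun t => poisson 1 t * f (t, harmonic n))).
  by case: (slice_poisson_integrable (harmonic_gt0 n)).
have [v iv weak_lim] := dunford_pettis UF islice (@integrable_poisson1 R)
  (fun t => ltW (P_gt0 t)) weighted_slices_equi_integrable.
have mPV : measurable_fun setT (fun t : R => (poisson 1 t)^-1).
  apply: continuous_measurable_fun => t; apply: cvgV => //.
  exact: continuous_poisson.
have mv := measurable_fun_integrable iv.
exists (fun t => (poisson 1 t)^-1 * v t) => [|z z0].
  split; first exact: measurable_funM.
  by apply: eq_integrable iv => // t _ /=; rewrite mulrA divff// mul1r.
have [C C0 CP] := poisson_le_poisson1 z.1 z0.
pose phi t := poisson z.2 (z.1 - t) / poisson 1 t.
have phiC t : `|phi t| <= C.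
  rewrite ger0_norm; last by apply: divr_ge0; [exact: poisson_ge0|exact: ltW].
  by rewrite ler_pdivrMr.
have mphi : measurable_fun setT phi.
  by apply: measurable_funM => //; exact: measurable_poissonB.
have -> : poisson_ext (fun t => (poisson 1 t)^-1 * v t) z = \int[mu]_t (phi t * v t).
  by apply: eq_Rintegral => t _; rewrite mulrA.
apply: cvg_unique (weak_lim phi C mphi phiC) _ => //.
have phiE n : \int[mu]_t (phi t * (poisson 1 t * f (t, harmonic n))) =
    f (z.1, harmonic n + z.2).
  rewrite (harmonic_poisson_ext hf unit_segment_le) ?harmonic_gt0//.
  by apply: eq_Rintegral => t _; rewrite mulrA divfK.
by rewrite (funext phiE); exact: cvg_trans (cvg_app _ sF) (cvg_harmonic_translate z0).
Qed.

End Existence.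

(** * Luxemburg norms *)

Section ComplexModulus.
Context {R : realType}.
Implicit Types (a b l q : R) (fr fi : R -> R).

Lemma cmod_ge0 a b : 0 <= cmod a b.
Proof. exact: sqrtr_ge0. Qed.

Lemma cmod_ge_norml a b : `|a| <= cmod a b.
Proof. by rewrite /cmod -sqrtr_sqr ler_wsqrtr// lerDl sqr_ge0. Qed.

Lemma cmod_ge_normr a b : `|b| <= cmod a b.
Proof. by rewrite /cmod -sqrtr_sqr ler_wsqrtr// lerDr sqr_ge0. Qed.

Lemma cmod_le_normD a b : cmod a b <= `|a| + `|b|.
Proof.
rewrite -(@ler_pXn2r _ 2) ?nnegrE ?cmod_ge0 ?addr_ge0//.
rewrite /cmod sqr_sqrtr ?addr_ge0 ?sqr_ge0// sqrrD !real_normK ?num_real//.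
by rewrite lerD2r lerDl mulrn_wge0// mulr_ge0.
Qed.

Lemma cmodMr a b l : 0 <= l -> cmod (a * l) (b * l) = cmod a b * l.
Proof.
move=> l0; rewrite /cmod !exprMn -mulrDl sqrtrM ?addr_ge0 ?sqr_ge0//.
by rewrite sqrtr_sqr ger0_norm.
Qed.

Lemma measurable_cmod fr fi : measurable_fun setT fr -> measurable_fun setT fi ->
  measurable_fun setT (fun t => cmod (fr t) (fi t)).
Proof.
move=> mr mi; apply: (measurableT_comp (f := @Num.sqrt R)).
  by apply: continuous_measurable_fun; exact: sqrt_continuous.
by apply: measurable_funD; exact: measurable_funX.
Qed.

Lemma cvg_cmod (ar br : nat -> R) a b : ar @ \oo --> a -> br @ \oo --> b ->
  cmod (ar n) (br n) @[n --> \oo] --> cmod a b.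
Proof.
move=> ca cb; apply: (@continuous_cvg _ _ _ _ _ (fun n => ar n ^+ 2 + br n ^+ 2)
  (@Num.sqrt R) (a ^+ 2 + b ^+ 2)); first exact: sqrt_continuous.
by apply: cvgD; rewrite expr2; apply: cvgM.
Qed.

Lemma cvg_powR_base (an : nat -> R) a q : 0 < q -> (forall n, 0 <= an n) ->
  an @ \oo --> a -> an n `^ q @[n --> \oo] --> a `^ q.
Proof.
move=> q0 an0 ca.
have : 0 <= a by apply: (ler_cvg_to (cvg_cst (0 : R)) ca); exact: nearW.
rewrite le_eqVlt => /predU1P[a0|a0].
  rewrite -a0 powR0 ?gt_eqF//; rewrite -a0 in ca.
  apply/cvgr0Pnorm_le => /= e e0; have eV0 : 0 < e `^ q^-1 by exact: powR_gt0.
  move/cvgr0Pnorm_le : ca => /(_ _ eV0); apply: filterS => n.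
  rewrite !ger0_norm ?powR_ge0// => /(le_powR (ltW q0) (an0 n)).
  by rewrite -powRrM mulVf ?gt_eqF// powRr1// ltW.
apply: (@continuous_cvg _ _ _ _ _ an (fun z : R => z `^ q) a) => //.
apply: differentiable_continuous; apply/derivable1_diffP.
by apply: derivable_powR; rewrite in_itv/= andbT.
Qed.

End ComplexModulus.

Section Modular.
Context {R : realType}.
Local Notation mu := (@lebesgue_measure R).
Variable p : R -> R.
Hypothesis mp : measurable_fun setT p.
Hypothesis p1 : forall x, 1 < p x.
Implicit Types (l : R) (fr fi gr gi u : R -> R).

Lemma measurable_modular fr fi : measurable_fun setT fr -> measurable_fun setT fi ->
  measurable_fun setT (fun t => (cmod (fr t) (fi t) `^ p t)%:E).
Proof.
move=> mr mi; apply/measurable_EFinP; apply: measurable_powRp => //.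
  by move=> x; exact: ltW.
exact: measurable_cmod.
Qed.

Lemma le_modular fr fi gr gi : measurable_fun setT fr -> measurable_fun setT fi ->
  measurable_fun setT gr -> measurable_fun setT gi ->
  (forall t, cmod (fr t) (fi t) <= cmod (gr t) (gi t)) ->
  (modular p fr fi <= modular p gr gi)%E.
Proof.
move=> mfr mfi mgr mgi fg; apply: ge0_le_integral => //.
- by move=> x _; rewrite lee_fin powR_ge0.
- exact: measurable_modular.
- exact: measurable_modular.
by move=> x _; rewrite lee_fin le_powR ?cmod_ge0// (le_trans ler01)// ltW.
Qed.

Lemma lp_norm_ge0 fr fi : (0 <= lp_norm p fr fi)%E.
Proof. by apply: le_ereal_inf_tmp => _ [l [l0 _] <-]; rewrite lee_fin ltW. Qed.

Lemma lp_norm_lt fr fi l : measurable_fun setT fr -> measurable_fun setT fi ->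
  (lp_norm p fr fi < l%:E)%E -> (modular p (fun x => fr x / l)%R (fun x => fi x / l)%R <= 1)%E.
Proof.
move=> mr mi /ereal_inf_lt[_ [k [k0 modk] <-]]; rewrite lte_fin => kl.
have l0 := lt_trans k0 kl; apply: le_trans modk.
apply: le_modular; [exact: measurable_funM.. |move=> t].
rewrite !cmodMr ?invr_ge0 ?(ltW k0) ?(ltW l0)// ler_wpM2l ?cmod_ge0// lef_pV2 ?posrE//.
exact: ltW.
Qed.

Lemma modular_fatou (fr fi : nat -> R -> R) (gr gi : R -> R) (c : \bar R) :
  (forall n, measurable_fun setT (fr n)) -> (forall n, measurable_fun setT (fi n)) ->
  measurable_fun setT gr -> measurable_fun setT gi ->
  {ae mu, forall x, fr n x @[n --> \oo] --> gr x} ->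
  {ae mu, forall x, fi n x @[n --> \oo] --> gi x} ->
  (forall n, modular p (fr n) (fi n) <= c)%E -> (modular p gr gi <= c)%E.
Proof.
move=> mfr mfi mgr mgi frg fig modc.
pose F n x := (cmod (fr n x) (fi n x) `^ p x)%:E.
have mF n : measurable_fun setT (F n) by exact: measurable_modular.
have F0 n x : (0 <= F n x)%E by rewrite lee_fin powR_ge0.
have -> : modular p gr gi = (\int[mu]_x limn_einf (F^~ x))%E.
  apply: ae_eq_integral => //; first exact: measurable_modular.
    apply: (measurableT_comp (f := @oppe R)) => //.
    apply: (@measurable_fun_limn_esup _ _ _ setT (fun n x => - F n x)%E) => n.
    exact: (measurableT_comp (f := @oppe R)).
  apply: filterS2 frg fig; first exact: (ae_filter_ringOfSetsType mu).
  move=> x cr ci _; have : F n x @[n --> \oo] --> (cmod (gr x) (gi x) `^ p x)%:E.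
    apply: cvg_EFin; first exact: nearW.
    apply: cvg_powR_base; [exact: lt_trans (p1 x)|by move=> n; exact: cmod_ge0|].
    exact: cvg_cmod.
  by move=> /cvg_limn_einf_sup[->].
apply: (@le_trans _ _ (limn_einf (fun n => \int[mu]_x F n x)%E)).
  by apply: fatou => // n x _; exact: F0.
rewrite limn_einf_lim; apply: lime_le; first exact: is_cvg_einfs.
apply: nearW => n; apply: le_trans (modc n); apply: ereal_inf_lbound.
by exists n => /=.
Qed.

Lemma in_Lp_poisson_integrable fr fi u : in_Lp p fr fi -> measurable_fun setT u ->
  (forall t, `|u t| <= cmod (fr t) (fi t)) -> poisson_integrable u.
Proof.
move=> [mr mi foo] mu_ u_le; pose h t := cmod (fr t) (fi t) `^ p t.
have mh : measurable_fun setT h by apply/measurable_EFinP; exact: measurable_modular.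
have ih : mu.-integrable setT (EFin \o h).
  by apply: ge0_integrable_lty => // t; exact: powR_ge0.
have ph := integrable_poisson_integrable ih.
apply: poisson_integrable_dominated mu_ (poisson_integrableD (poisson_integrable_cst 1) ph) _ => t.
apply: le_trans (u_le t) _; apply: normr_le_1D_powR; first exact: ltW.
exact: cmod_ge0.
Qed.

Lemma integral_powR_div_le (f : R -> R) K : 1 <= K -> measurable_fun setT f ->
  (forall t, 0 <= f t) ->
  (\int[mu]_x ((f x / K)%R `^ p x)%:E <= K^-1%:E * \int[mu]_x (f x `^ p x)%:E)%E.
Proof.
move=> K1 mf f0; have K0 : 0 < K by exact: lt_le_trans K1.
have mfp : measurable_fun setT (fun x => f x `^ p x).
  by apply: measurable_powRp => // x; exact: ltW.
rewrite -ge0_integralZl//; last 3 first.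
- exact/measurable_EFinP.
- by move=> x _; rewrite lee_fin powR_ge0.
- by rewrite lee_fin invr_ge0 ltW.
apply: ge0_le_integral => //.
- by move=> x _; rewrite lee_fin powR_ge0.
- apply/measurable_EFinP; apply: measurable_powRp => //; first by move=> x; exact: ltW.
  exact: measurable_funM.
- by apply: measurable_funeM; exact/measurable_EFinP.
move=> x _; rewrite -EFinM lee_fin mulrC; apply: ge1r_powRZ => //; last exact: ltW.
by rewrite invr_gt0 K0 invf_le1.
Qed.

End Modular.

Section PoissonRepresentation.
Context {R : realType}.
Local Notation mu := (@lebesgue_measure R).
Implicit Types (x y l C : R) (z : R * R) (u ur ui vr vi : R -> R) (Ur Ui : R * R -> R).

Lemma poisson_repP Ur Ui ur ui : poisson_integrable ur -> poisson_integrable ui ->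
  poisson_rep Ur Ui ur ui <->
  forall z, 0 < z.2 -> poisson_ext ur z = Ur z /\ poisson_ext ui z = Ui z.
Proof.
move=> iur iui; split=> [rep [x y] y0|repE x y y0].
  by rewrite /poisson_ext /Rintegral; have [-> ->] := rep x y y0.
have [<- <-] := repE (x, y) y0.
by split; rewrite -EFin_Rintegral//; exact: integrable_poisson_kernel.
Qed.

Lemma measurable_poisson_ext_slice u y : 0 < y -> poisson_integrable u ->
  measurable_fun setT (fun x : R => poisson_ext u (x, y)).
Proof.
move=> y0 iu; apply: continuous_measurable_fun; apply: continuous_slice => // z z0.
exact: poisson_ext_continuous.
Qed.

Lemma ae_poisson_ext_cvg_div u l : poisson_integrable u ->
  {ae mu, forall x, poisson_ext u (x, harmonic n) / l @[n --> \oo] --> u x / l}.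
Proof.
move=> iu; apply: filterS (ae_poisson_ext_cvg iu); first exact: (ae_filter_ringOfSetsType mu).
move=> x cx; apply: cvgM; last exact: cvg_cst.
move/cvg_at_rightP: cx; apply; split; last exact: cvg_harmonic.
by move=> n; exact: harmonic_gt0.
Qed.

Lemma cmod_poisson_ext_le ur ui z : 0 < z.2 -> poisson_integrable ur -> poisson_integrable ui ->
  poisson_integrable (fun t => cmod (ur t) (ui t)) /\
  cmod (poisson_ext ur z) (poisson_ext ui z) <= 2 * poisson_ext (fun t => cmod (ur t) (ui t)) z.
Proof.
move=> z0 iur iui; have [[mur _] [mui _]] := (iur, iui).
have icmod : poisson_integrable (fun t => cmod (ur t) (ui t)).
  apply: (poisson_integrable_dominated (measurable_cmod mur mui)
    (poisson_integrableD (poisson_integrable_normr iur) (poisson_integrable_normr iui))) => t.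
  by rewrite ger0_norm ?cmod_ge0// cmod_le_normD.
split=> //; apply: le_trans (cmod_le_normD _ _) _; rewrite mulrDl !mul1r.
by apply: lerD; apply: ler_normr_poisson_ext => // t; [exact: cmod_ge_norml|exact: cmod_ge_normr].
Qed.

Variable p : R -> R.
Hypothesis mp : measurable_fun setT p.
Hypothesis p1 : forall x, 1 < p x.

Lemma modular_poisson_ext_le C ur ui l y : 0 < C -> poisson_modular_bound p C ->
  poisson_integrable ur -> poisson_integrable ui -> 0 < l -> 0 < y ->
  (modular p (fun x => ur x / l)%R (fun x => ui x / l)%R <= 1)%E ->
  (modular p (fun x => poisson_ext ur (x, y) / (2 * (C + 1) * l))%R
             (fun x => poisson_ext ui (x, y) / (2 * (C + 1) * l))%R <= 1)%E.
Proof.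
move=> C0 mod_le iur iui l0 y0 mod1; have C1 : 1 <= C + 1 by rewrite lerDr ltW.
have C10 : 0 < C + 1 by exact: lt_le_trans C1.
have lV0 : 0 <= l^-1 by rewrite invr_ge0 ltW.
have [icmod cmod_le] : poisson_integrable (fun t => cmod (ur t) (ui t)) /\ forall x,
    cmod (poisson_ext ur (x, y)) (poisson_ext ui (x, y)) <=
      2 * poisson_ext (fun t => cmod (ur t) (ui t)) (x, y).
  split=> [|x]; first by have [] := @cmod_poisson_ext_le ur ui (0, y) y0 iur iui.
  by have [] := @cmod_poisson_ext_le ur ui (x, y) y0 iur iui.
pose f t := cmod (ur t / l) (ui t / l).
have fE : f = (fun t => cmod (ur t) (ui t) / l) by apply/funext => t; rewrite /f cmodMr.
have f0 t : 0 <= f t by exact: cmod_ge0.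
have pf : poisson_integrable f by rewrite fE; exact: poisson_integrableMr.
have [mf _] := pf; have mPf := measurable_poisson_ext_slice y0 pf.
have Pf0 x : 0 <= poisson_ext f (x, y) by exact: poisson_ext_ge0.
apply: (@le_trans _ _ (\int[mu]_x ((poisson_ext f (x, y) / (C + 1)) `^ p x)%:E)%E).
  apply: ge0_le_integral => //.
  - by move=> x _; rewrite lee_fin powR_ge0.
  - by apply: measurable_modular => //; apply: measurable_funM => //;
       exact: measurable_poisson_ext_slice.
  - apply/measurable_EFinP; apply: measurable_powRp => //; first by move=> x; exact: ltW.
    exact: measurable_funM.
  move=> x _; rewrite lee_fin; apply: le_powR; rewrite ?cmod_ge0//.
    by rewrite (le_trans ler01)// ltW.
  have K0 : 0 < 2 * (C + 1) * l by rewrite !mulr_gt0.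
  rewrite cmodMr ?invr_ge0 ?(ltW K0)// ler_pdivrMr// fE poisson_extMr//.
  apply: le_trans (cmod_le x) _; rewrite le_eqVlt; apply/orP; left; apply/eqP.
  by field; rewrite ?gt_eqF.
apply: le_trans (integral_powR_div_le mp p1 C1 mPf Pf0) _.
rewrite lee_pdivrMl// mule1; apply: le_trans (mod_le f y mf f0 mod1 y0) _.
by rewrite lee_fin lerDl.
Qed.

Variables (Ur Ui : R * R -> R) (ur ui : R -> R).
Hypothesis iur : poisson_integrable ur.
Hypothesis iui : poisson_integrable ui.
Hypothesis rep : poisson_rep Ur Ui ur ui.

Lemma poisson_rep_slice y : 0 < y -> (fun x => Ur (x, y)) = (fun x => poisson_ext ur (x, y)) /\
  (fun x => Ui (x, y)) = (fun x => poisson_ext ui (x, y)).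
Proof.
move=> y0; have repE := (poisson_repP Ur Ui iur iui).1 rep.
by split; apply/funext => x; have [] := repE (x, y) y0.
Qed.

Lemma modular_poisson_rep l y : 0 < y ->
  modular p (fun x => Ur (x, y) / l) (fun x => Ui (x, y) / l) =
  modular p (fun x => poisson_ext ur (x, y) / l) (fun x => poisson_ext ui (x, y) / l).
Proof.
move=> y0; have repE := (poisson_repP Ur Ui iur iui).1 rep.
by apply: eq_integral => x _; have [-> ->] := repE (x, y) y0.
Qed.

Lemma boundary_modular_le l (c : \bar R) :
  (forall y, 0 < y ->
    (modular p (fun x => Ur (x, y) / l)%R (fun x => Ui (x, y) / l)%R <= c)%E) ->
  (modular p (fun x => ur x / l)%R (fun x => ui x / l)%R <= c)%E.
Proof.
move=> modc; have [[mur _] [mui _]] := (iur, iui).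
apply: (modular_fatou mp p1 _ _ _ _ (ae_poisson_ext_cvg_div l iur) (ae_poisson_ext_cvg_div l iui)).
- by move=> n; apply: measurable_funM => //; exact: measurable_poisson_ext_slice (harmonic_gt0 n) _.
- by move=> n; apply: measurable_funM => //; exact: measurable_poisson_ext_slice (harmonic_gt0 n) _.
- exact: measurable_funM.
- exact: measurable_funM.
by move=> n; rewrite -modular_poisson_rep ?harmonic_gt0// modc ?harmonic_gt0.
Qed.

Lemma boundary_in_Lp : in_hp p Ur Ui -> in_Lp p ur ui.
Proof.
move=> [_ _ [M modM]]; split; [by case: iur|by case: iui|].
apply: (@le_lt_trans _ _ M%:E); last exact: ltry.
have divr1E (g : R -> R) : (fun x => g x / 1) = g by apply/funext => x; rewrite divr1.
rewrite -(divr1E ur) -(divr1E ui); apply: boundary_modular_le => y y0.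
by rewrite (divr1E (fun x => Ur _)) (divr1E (fun x => Ui _)); exact: modM.
Qed.

Lemma lp_norm_boundary_le : (lp_norm p ur ui <= sup_norm_hp p Ur Ui)%E.
Proof.
have slice_le y : 0 < y ->
    (lp_norm p (fun x => Ur (x, y)) (fun x => Ui (x, y)) <= sup_norm_hp p Ur Ui)%E.
  by move=> y0; apply: ereal_sup_ubound; exists y.
have : (0 <= sup_norm_hp p Ur Ui)%E := le_trans (lp_norm_ge0 _ _ _) (slice_le 1 ltr01).
case E : (sup_norm_hp p Ur Ui) => [r| |] // r0; last by rewrite leey.
apply/lee_addgt0Pr => e e0; apply: ereal_inf_lbound.
exists (r + e) => //; split; first by rewrite ltr_wpDl.
apply: boundary_modular_le => y y0; have [UrE UiE] := poisson_rep_slice y0.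
apply: lp_norm_lt => //; rewrite ?UrE ?UiE; try exact: measurable_poisson_ext_slice.
rewrite -UrE -UiE; apply: le_lt_trans (slice_le y y0) _.
by rewrite E lte_fin ltrDl.
Qed.

Lemma sup_norm_hp_le C : 0 < C -> poisson_modular_bound p C ->
  (sup_norm_hp p Ur Ui <= (2 * (C + 1))%:E * lp_norm p ur ui)%E.
Proof.
move=> C0 mod_le; have K0 : 0 < 2 * (C + 1) by rewrite mulr_gt0// addr_gt0.
apply: ge_ereal_sup => _ [y /= y0 <-].
rewrite -lee_pdivrMl//; apply: le_ereal_inf_tmp => _ [l [l0 modl] <-].
rewrite lee_pdivrMl// -EFinM; apply: ereal_inf_lbound.
exists (2 * (C + 1) * l); [split; first exact: mulr_gt0|by []].
rewrite (modular_poisson_rep _ y0).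
exact: (modular_poisson_ext_le C0 mod_le iur iui l0 y0 modl).
Qed.

Lemma boundary_unique vr vi : in_Lp p vr vi -> poisson_rep Ur Ui vr vi ->
  {ae mu, forall t, vr t = ur t /\ vi t = ui t}.
Proof.
move=> Lv repv; have [mvr mvi _] := Lv.
have ivr : poisson_integrable vr.
  by apply: (in_Lp_poisson_integrable mp p1 Lv) => // t; exact: cmod_ge_norml.
have ivi : poisson_integrable vi.
  by apply: (in_Lp_poisson_integrable mp p1 Lv) => // t; exact: cmod_ge_normr.
have repE := (poisson_repP Ur Ui iur iui).1 rep.
have repvE := (poisson_repP Ur Ui ivr ivi).1 repv.
have vr_ur : {ae mu, forall t, vr t = ur t}.
  apply: poisson_ext_inj => // z z0.
  by have [-> _] := repE z z0; have [-> _] := repvE z z0.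
have vi_ui : {ae mu, forall t, vi t = ui t}.
  apply: poisson_ext_inj => // z z0.
  by have [_ ->] := repE z z0; have [_ ->] := repvE z z0.
by apply: filterS2 vr_ur vi_ui; first exact: (ae_filter_ringOfSetsType mu).
Qed.

End PoissonRepresentation.

Lemma hp_boundary_value (R : realType) (p : R -> R) (Ur Ui : R * R -> R) :
  measurable_fun setT p -> (forall x, 1 < p x) -> LH p -> in_hp p Ur Ui ->
  exists ur ui : R -> R,
    [/\ poisson_integrable ur, poisson_integrable ui & poisson_rep Ur Ui ur ui].
Proof.
move=> mp p1 [[C [C0 plog]] _] [hUr hUi [M modM]].
have cp : continuous p := log_holder_continuous (ltW C0) plog.
have component_le (U : R * R -> R) : harmonic_on (@upper_half_plane R) U ->
    (forall z, `|U z| <= cmod (Ur z) (Ui z)) ->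
    forall y, 0 < y -> (\int[@lebesgue_measure R]_t (`|U (t, y)| `^ p t)%:E <= M%:E)%E.
  move=> hU U_le y y0; have mUr := harmonic_slice_measurable hUr y0.
  have mUi := harmonic_slice_measurable hUi y0; apply: le_trans (modM y y0).
  apply: ge0_le_integral => //.
  - apply/measurable_EFinP; apply: measurable_powRp => //; first by move=> x; exact: ltW.
    by apply: measurableT_comp => //; exact: harmonic_slice_measurable.
  - exact: measurable_modular.
  by move=> x _; rewrite lee_fin le_powR// (le_trans ler01)// ltW.
have [ur iur urE] := boundary_value p1 cp hUr
  (component_le _ hUr (fun z => cmod_ge_norml (Ur z) (Ui z))).
have [ui iui uiE] := boundary_value p1 cp hUi
  (component_le _ hUi (fun z => cmod_ge_normr (Ur z) (Ui z))).
exists ur, ui; split=> //; apply/(poisson_repP _ _ iur iui) => z z0.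
by rewrite urE ?uiE.
Qed.

Theorem theorem4p4 (R : realType) (p : R -> R) :
  measurable_fun setT p -> (forall x, 1 < p x) -> LH p ->
  exists c C : R, [/\ 0 < c, 0 < C &
    forall Ur Ui : R * R -> R, in_hp p Ur Ui ->
      exists ur ui : R -> R,
        [/\ in_Lp p ur ui, poisson_rep Ur Ui ur ui,
            (c%:E * lp_norm p ur ui <= sup_norm_hp p Ur Ui)%E,
            (sup_norm_hp p Ur Ui <= C%:E * lp_norm p ur ui)%E &
            forall vr vi : R -> R, in_Lp p vr vi -> poisson_rep Ur Ui vr vi ->
              {ae @lebesgue_measure R, forall t, vr t = ur t /\ vi t = ui t}]].
Proof.
move=> mp p1 LHp; have [C C0 poisson_mod_le] := LH_poisson_modular_bound mp p1 LHp.
exists 1, (2 * (C + 1)); split=> // [|Ur Ui hU]; first by rewrite mulr_gt0// addr_gt0.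
have [ur [ui [iur iui rep]]] := hp_boundary_value mp p1 LHp hU.
exists ur, ui; split=> //.
- exact: boundary_in_Lp rep hU.
- by rewrite mul1e; exact: lp_norm_boundary_le.
- exact: sup_norm_hp_le.
- by move=> vr vi Lv repv; exact: (boundary_unique mp p1 iur iui rep Lv repv).
Qed.
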